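(* For every $\epsilon>0$ there exists a function $w\in C(\mathbb{T})$ with $\int_{\mathbb{T}}w\,dm=1$ and $\sup_{z\in\mathbb{T}}|w(z)-1|\leqslant\epsilon$ such that, with $d\sigma=w\,dm$, the sequence $\{\phi_n^*(z,\sigma)\}_n$ diverges at every point $z\in\mathbb{T}$. Moreover, there is a sequence $\{\alpha_n\}\in\ell^2(\mathbb{Z}^+)$ such that the orthogonal series $\sum_{n\geqslant0}\alpha_n\phi_n(z,\sigma)$ diverges at every $z\in\mathbb{T}$.
   Context: $\mathbb{T}$ is the unit circle, $m$ the normalized Lebesgue probability measure on $\mathbb{T}$, $\mathbb{Z}^+=\{0,1,\dots\}$. For a probability measure $\sigma$ on $\mathbb{T}$ with infinite support, $\phi_n(z,\sigma)$ are the orthonormal polynomials ($\deg\phi_n=n$, positive leading coefficient, $\int\phi_n\overline{\phi_k}d\sigma=\delta_{nk}$), and $\phi_n^*(z)=z^n\overline{\phi_n(\bar z^{-1})}$. *)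

(* Defs.v *)
From Stdlib Require Import Reals.
From Coquelicot Require Import Coquelicot.

Open Scope R_scope.

Definition circ (t : R) : C := (cos t, sin t).

(* A function on T is given as a 2*PI-periodic function of the angle
   (w t stands for w(e^{it})); w is in C(T) iff it is periodic and
   continuous on R. *)
Definition continuous_on_T (w : R -> R) : Prop :=
  (forall t, w (t + 2 * PI) = w t) /\ (forall t, continuous w t).

(* Integral against the normalized Lebesgue measure m on T of a function
   given in angular form:  int_T f dm = (1/(2 PI)) int_0^{2 PI} f(t) dt. *)
Definition int_m (f : R -> C) : C :=
  scal (/ (2 * PI)) (RInt (V := C_R_CompleteNormedModule) f 0 (2 * PI)).

Definition int_m_R (f : R -> R) : R := / (2 * PI) * RInt f 0 (2 * PI).

Definition poly_eval (c : nat -> C) (n : nat) (z : C) : C :=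
  sum_n (fun k => Cmult (c k) (pow_n z k)) n.

(* The reversed polynomial: phi^*(z) = z^n * conj(phi(1 / conj z))
   = sum_{k<=n} conj(c k) z^(n-k). *)
Definition poly_star_eval (c : nat -> C) (n : nat) (z : C) : C :=
  sum_n (fun k => Cmult (Cconj (c k)) (pow_n z (n - k))) n.

(* c n is the coefficient sequence of phi_n(., sigma), d sigma = w dm:
   deg phi_n = n with positive leading coefficient c n n, and
   int phi_n conj(phi_k) d sigma = delta_{nk}. *)
Definition orthonormal_polys (w : R -> R) (c : nat -> nat -> C) : Prop :=
  (forall n, snd (c n n) = 0 /\ 0 < fst (c n n)) /\
  (forall n k,
      int_m (fun t => Cmult (Cmult (poly_eval (c n) n (circ t))
                                  (Cconj (poly_eval (c k) k (circ t))))
                            (RtoC (w t)))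
      = if Nat.eqb n k then RtoC 1 else RtoC 0).

Definition seq_converges (u : nat -> C) : Prop :=
  exists l : C, filterlim u eventually (locally l).

Definition in_l2 (a : nat -> C) : Prop :=
  ex_series (fun n => (Cmod (a n)) ^ 2).

(* Main.v *)
Require Import Defs.
From Stdlib Require Import Reals Lra Lia Psatz ZArith Classical.
From Coquelicot Require Import Coquelicot.

Open Scope R_scope.

(** The weight is built from its Verblunsky coefficients [al_n].  On the circle
    [u_n = phi_n^*(e^{it})] satisfies
    [u_{n+1} = (u_n - al_n e^{i(n+1)t} conj u_n) / sqrt (1 - |al_n|^2)].
    The coefficients form blocks of chirps [al_n = (d / p) e^{i PI n^2 / p^2}],
    [0 <= n < 2 p^2], so that for every [t] the phase of [al_n e^{i(n+1)t}] becomes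
    stationary somewhere in the block.  Averaging out the first-order oscillation, the
    block changes [log |u|] only by [O(d)], whereas the second-order term makes the
    argument of [u] drift by about [d^2 log p] while the stationary point is left.  With
    [d] running through a summable sequence and [d^2 log p] bounded below, the
    Bernstein-Szego weights [1 / |phi_n^*|^2] taken at the ends of the blocks converge
    uniformly to a continuous [w] close to [1], but [phi_n^*] oscillates in each block at
    every point.  The polynomials are orthonormal for the limit weight because
    [1 / |phi_{n+1}^*|^2 - 1 / |phi_n^*|^2
       = 2 Re (al_n z^{n+1} / (sqrt (1 - |al_n|^2) phi_n^* phi_{n+1}^* ))]
    and [1 / phi_n^*] is a uniform limit of polynomials on the circle.  Finally
    [kappa_n phi_n^* = sum_{k <= n} conj (phi_k(0)) phi_k], with convergent leading
    coefficients [kappa_n] and square-summable [phi_k(0)], transfers the divergence to an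
    orthogonal series. *)

(** * The unit circle *)

(** The weight sees only the modulus of [phi_n^*], so the divergence has to sit in the argument
    while the moduli converge. The amplitude is [d / p] because near the stationary point the
    coefficients stay coherent for about [p] indices, so that their first-order effect is at most
    [(d / p) p = d]. At distance [e] from the stationary point the frequency is [2 pi e / p^2], and
    the second-order rotation per step is about [(d / p)^2] divided by it, a constant times
    [d^2 / e]; summing over [p <= e <= p^2 / 8] produces [d^2 log p]. Hence [d] can be summable with
    [d^2 log p] constant, at the price of [log p] growing like [1 / d^2]. The rotation is odd in the
    frequency, so it is measured on one side of the stationary point only; the [2 p^2] indices of a
    block are two full turns of the frequency, which leaves room after a stationary point found in
    the first turn. The errors must be [O(d)] uniformly in [p] and [t]: they are all expressed
    through one Poisson kernel whose sum over equidistant points is computed exactly. *)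

Lemma circ_plus (s t : R) : circ (s + t) = (circ s * circ t)%C.
Proof.
  unfold circ, Cmult; simpl.
  now rewrite cos_plus, sin_plus; f_equal; ring.
Qed.

Lemma circ_0 : circ 0 = RtoC 1.
Proof. unfold circ; now rewrite cos_0, sin_0. Qed.

Lemma Cmod_circ (t : R) : Cmod (circ t) = 1.
Proof.
  unfold Cmod, circ; simpl.
  replace (_ + _) with 1; [exact sqrt_1 |].
  generalize (sin2_cos2 t); unfold Rsqr; lra.
Qed.

Lemma Cconj_circ (t : R) : Cconj (circ t) = circ (- t).
Proof. unfold Cconj, circ; simpl; now rewrite cos_neg, sin_neg. Qed.

Lemma circ_conj_l (t : R) : (Cconj (circ t) * circ t)%C = RtoC 1.
Proof. rewrite Cconj_circ, <- circ_plus, <- circ_0; f_equal; ring. Qed.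

Lemma circ_conj_r (t : R) : (circ t * Cconj (circ t))%C = RtoC 1.
Proof. rewrite Cmult_comm; apply circ_conj_l. Qed.

Lemma pow_n_circ (t : R) (k : nat) : pow_n (circ t) k = circ (INR k * t).
Proof.
  induction k as [|k IH].
  - simpl; rewrite Rmult_0_l, circ_0; reflexivity.
  - rewrite S_INR.
    change (pow_n (circ t) (S k)) with (circ t * pow_n (circ t) k)%C.
    rewrite IH, <- circ_plus; f_equal; ring.
Qed.

Lemma circ_period (t : R) (k : Z) : circ (t + 2 * PI * IZR k) = circ t.
Proof.
  assert (Hn : forall (n : nat) s, circ (s + 2 * INR n * PI) = circ s).
  { intros n s; unfold circ; now rewrite cos_period, sin_period. }
  destruct (Z_le_gt_dec 0 k) as [Hk | Hk].
  - rewrite <- (Hn (Z.to_nat k) t), INR_IZR_INZ, Z2Nat.id by assumption.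
    f_equal; ring.
  - rewrite <- (Hn (Z.to_nat (- k)) (t + 2 * PI * IZR k)), INR_IZR_INZ, Z2Nat.id by lia.
    rewrite opp_IZR; f_equal; ring.
Qed.

Lemma circ_2PI (t : R) : circ (t + 2 * PI) = circ t.
Proof. rewrite <- (circ_period t 1); f_equal; ring. Qed.

Lemma Cmod_sub_sym (x y : C) : Cmod (x - y) = Cmod (y - x).
Proof. rewrite <- Cmod_opp; f_equal; ring. Qed.

Lemma Cmod_triangle_rev (x y : C) : Cmod x - Cmod y <= Cmod (x - y).
Proof.
  generalize (Cmod_triangle (x - y) y).
  replace (x - y + y)%C with x by ring; lra.
Qed.

Lemma Cmod_sub_le (x y : C) : Cmod (x - y) <= Cmod x + Cmod y.
Proof.
  unfold Cminus; eapply Rle_trans; [apply Cmod_triangle|].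
  rewrite Cmod_opp; lra.
Qed.

Lemma Cmod_pair_le (x y : R) : Cmod (x, y) <= Rabs x + Rabs y.
Proof.
  replace (x, y) with (RtoC x + Ci * RtoC y)%C
    by (unfold Cplus, Cmult, RtoC; simpl; f_equal; ring).
  eapply Rle_trans; [apply Cmod_triangle|].
  rewrite Cmod_mult, Cmod_Ci, !Cmod_R; lra.
Qed.

Lemma Cmod_sqr (z : C) : Cmod z ^ 2 = fst z ^ 2 + snd z ^ 2.
Proof. apply Cmod2_alt. Qed.

(** * Continuous complex-valued functions of the angle and their means *)

(** Continuity is stated for the two components because integrals are split in the same way by
    [int_m_pair]. *)
Definition Ccont (f : R -> C) : Prop :=
  forall t, continuous (fun s => fst (f s)) t /\ continuous (fun s => snd (f s)) t.

Lemma Ccont_fst (f : R -> C) : Ccont f -> forall t, continuous (fun s => fst (f s)) t.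
Proof. intros Hf t; exact (proj1 (Hf t)). Qed.

Lemma Ccont_snd (f : R -> C) : Ccont f -> forall t, continuous (fun s => snd (f s)) t.
Proof. intros Hf t; exact (proj2 (Hf t)). Qed.

Ltac Ccont_parts :=
  intros;
  lazymatch goal with
  | |- continuous (fun s => fst (@?f s)) _ => apply (Ccont_fst f)
  | |- continuous (fun s => snd (@?f s)) _ => apply (Ccont_snd f)
  end; assumption.

Lemma Ccont_ext (f g : R -> C) : (forall t, f t = g t) -> Ccont f -> Ccont g.
Proof.
  intros Hfg Hf t; destruct (Hf t) as [H1 H2]; split.
  - eapply continuous_ext; [|exact H1]; intros s; simpl; now rewrite Hfg.
  - eapply continuous_ext; [|exact H2]; intros s; simpl; now rewrite Hfg.
Qed.

Lemma Ccont_const (c : C) : Ccont (fun _ => c).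
Proof. intros t; split; apply continuous_const. Qed.

Lemma Ccont_circ : Ccont circ.
Proof. intros t; split; simpl; [apply continuous_cos | apply continuous_sin]. Qed.

Lemma Ccont_plus (f g : R -> C) :
  Ccont f -> Ccont g -> Ccont (fun t => (f t + g t)%C).
Proof.
  intros Hf Hg t; destruct (Hf t), (Hg t); split; simpl;
    now apply @continuous_plus.
Qed.

Lemma Ccont_mult (f g : R -> C) :
  Ccont f -> Ccont g -> Ccont (fun t => (f t * g t)%C).
Proof.
  intros Hf Hg t; destruct (Hf t), (Hg t); split; simpl.
  - apply (continuous_minus (fun s => fst (f s) * fst (g s)) (fun s => snd (f s) * snd (g s)));
      now apply (@continuous_mult _ R_AbsRing).
  - apply (continuous_plus (fun s => fst (f s) * snd (g s)) (fun s => snd (f s) * fst (g s)));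
      now apply (@continuous_mult _ R_AbsRing).
Qed.

Lemma Ccont_opp (f : R -> C) : Ccont f -> Ccont (fun t => (- f t)%C).
Proof.
  intros Hf; apply Ccont_ext with (fun t => (RtoC (-1) * f t)%C).
  - intros t; unfold RtoC, Cmult, Copp; simpl; f_equal; ring.
  - apply Ccont_mult; [apply Ccont_const | exact Hf].
Qed.

Lemma Ccont_minus (f g : R -> C) :
  Ccont f -> Ccont g -> Ccont (fun t => (f t - g t)%C).
Proof. intros Hf Hg; apply Ccont_plus; [|apply Ccont_opp]; assumption. Qed.

Lemma Ccont_conj (f : R -> C) : Ccont f -> Ccont (fun t => Cconj (f t)).
Proof.
  intros Hf t; destruct (Hf t); split; simpl; [assumption|].
  now apply @continuous_opp.
Qed.

Lemma Ccont_RtoC (f : R -> R) :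
  (forall t, continuous f t) -> Ccont (fun t => RtoC (f t)).
Proof. intros Hf t; split; simpl; [apply Hf | apply continuous_const]. Qed.

Lemma continuous_Cmod_sqr (f : R -> C) :
  Ccont f -> forall t, continuous (fun s => Cmod (f s) ^ 2) t.
Proof.
  intros Hf t; destruct (Hf t) as [H1 H2].
  assert (E : forall s, fst (f s) * fst (f s) + snd (f s) * snd (f s) = Cmod (f s) ^ 2)
    by (intros s; rewrite Cmod_sqr; ring).
  eapply continuous_ext; [exact E|].
  apply (continuous_plus (fun s => fst (f s) * fst (f s)) (fun s => snd (f s) * snd (f s)));
    now apply (@continuous_mult _ R_AbsRing).
Qed.

Lemma Cinv_eq_conj (z : C) : z <> 0 -> (/ z)%C = (Cconj z * RtoC (/ Cmod z ^ 2))%C.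
Proof.
  intros Hz.
  assert (H : Cmod z ^ 2 <> 0) by (apply pow_nonzero; apply Cmod_gt_0 in Hz; lra).
  assert (HC : RtoC (Cmod z ^ 2) <> RtoC 0) by (intros E; apply H; now apply RtoC_inj).
  rewrite RtoC_inv by assumption.
  replace (Cconj z) with (RtoC (Cmod z ^ 2) / z)%C.
  - field; now split.
  - rewrite Cmod2_conj; field; assumption.
Qed.

Lemma Ccont_inv (f : R -> C) :
  Ccont f -> (forall t, f t <> 0) -> Ccont (fun t => (/ f t)%C).
Proof.
  intros Hf Hnz.
  apply Ccont_ext with (fun t => (Cconj (f t) * RtoC (/ Cmod (f t) ^ 2))%C).
  { intros t; now rewrite Cinv_eq_conj. }
  apply Ccont_mult; [now apply Ccont_conj|].
  apply Ccont_RtoC; intros t; apply continuous_Rinv_comp.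
  - now apply continuous_Cmod_sqr.
  - apply pow_nonzero; generalize (proj1 (Cmod_gt_0 (f t)) (Hnz t)); lra.
Qed.

(** * Normalized integrals over the circle *)

Lemma ex_RInt_continuous_everywhere (f : R -> R) (a b : R) :
  (forall t, continuous f t) -> ex_RInt f a b.
Proof. intros H; apply (@ex_RInt_continuous R_CompleteNormedModule); intros; apply H. Qed.

Lemma int_m_pair (f : R -> C) :
  Ccont f -> int_m f = (int_m_R (fun t => fst (f t)), int_m_R (fun t => snd (f t))).
Proof.
  intros Hf; unfold int_m, int_m_R.
  assert (H1 : ex_RInt (fun t => fst (f t)) 0 (2 * PI))
    by (apply ex_RInt_continuous_everywhere; Ccont_parts).
  assert (H2 : ex_RInt (fun t => snd (f t)) 0 (2 * PI))
    by (apply ex_RInt_continuous_everywhere; Ccont_parts).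
  rewrite (@is_RInt_unique C_R_CompleteNormedModule f 0 (2 * PI)
            (RInt (fun t => fst (f t)) 0 (2 * PI), RInt (fun t => snd (f t)) 0 (2 * PI))).
  - reflexivity.
  - apply (@is_RInt_fct_extend_pair R_NormedModule R_NormedModule);
      now apply (@RInt_correct R_CompleteNormedModule).
Qed.

Lemma int_m_R_ext (f g : R -> R) : (forall t, f t = g t) -> int_m_R f = int_m_R g.
Proof. intros H; unfold int_m_R; f_equal; apply RInt_ext; intros; apply H. Qed.

Lemma int_m_ext (f g : R -> C) : (forall t, f t = g t) -> int_m f = int_m g.
Proof. intros H; unfold int_m; f_equal; apply RInt_ext; intros; apply H. Qed.

Lemma int_m_R_plus (f g : R -> R) :
  (forall t, continuous f t) -> (forall t, continuous g t) ->
  int_m_R (fun t => f t + g t) = int_m_R f + int_m_R g.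
Proof.
  intros Hf Hg; unfold int_m_R.
  rewrite (RInt_plus (V := R_CompleteNormedModule) f g);
    [unfold plus; simpl; ring | |]; now apply ex_RInt_continuous_everywhere.
Qed.

Lemma int_m_R_scal (k : R) (f : R -> R) :
  (forall t, continuous f t) -> int_m_R (fun t => k * f t) = k * int_m_R f.
Proof.
  intros Hf; unfold int_m_R.
  rewrite (RInt_scal (V := R_CompleteNormedModule) f);
    [unfold scal; simpl; unfold mult; simpl; ring |].
  now apply ex_RInt_continuous_everywhere.
Qed.

Lemma int_m_R_const (k : R) : int_m_R (fun _ => k) = k.
Proof.
  unfold int_m_R; rewrite RInt_const; unfold scal; simpl; unfold mult; simpl.
  field; generalize PI_RGT_0; lra.
Qed.

Lemma int_m_R_le_const (f : R -> R) (M : R) :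
  (forall t, continuous f t) -> (forall t, Rabs (f t) <= M) -> Rabs (int_m_R f) <= M.
Proof.
  intros Hf HM; unfold int_m_R.
  assert (HP := PI_RGT_0).
  assert (H := abs_RInt_le_const f 0 (2 * PI) M).
  rewrite Rabs_mult, (Rabs_pos_eq (/ (2 * PI))) by (apply Rlt_le, Rinv_0_lt_compat; lra).
  apply Rmult_le_reg_l with (2 * PI); [lra|].
  rewrite <- Rmult_assoc, Rinv_r, Rmult_1_l by lra.
  eapply Rle_trans; [apply H|]; try lra.
  - now apply ex_RInt_continuous_everywhere.
  - intros; apply HM.
Qed.

Lemma int_m_plus (f g : R -> C) :
  Ccont f -> Ccont g -> int_m (fun t => (f t + g t)%C) = (int_m f + int_m g)%C.
Proof.
  intros Hf Hg; rewrite !int_m_pair; try assumption; [|now apply Ccont_plus].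
  unfold Cplus; simpl; f_equal; apply int_m_R_plus; Ccont_parts.
Qed.

Lemma int_m_scal (k : C) (f : R -> C) :
  Ccont f -> int_m (fun t => (k * f t)%C) = (k * int_m f)%C.
Proof.
  intros Hf; rewrite !int_m_pair; try assumption;
    [|apply Ccont_mult; [apply Ccont_const | assumption]].
  assert (Hc : forall (a : R) (h : R -> R), (forall t, continuous h t) ->
                 forall t, continuous (fun s => a * h s) t).
  { intros a h Hh t; apply (@continuous_mult _ R_AbsRing);
      [apply continuous_const | apply Hh]. }
  unfold Cmult; simpl; f_equal.
  - rewrite (int_m_R_ext _ (fun t => fst k * fst (f t) + (- snd k) * snd (f t)))
      by (intros; ring).
    rewrite int_m_R_plus by (apply Hc; Ccont_parts).
    rewrite !int_m_R_scal by Ccont_parts; ring.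
  - rewrite int_m_R_plus by (apply Hc; Ccont_parts).
    rewrite !int_m_R_scal by Ccont_parts; ring.
Qed.

Lemma int_m_minus (f g : R -> C) :
  Ccont f -> Ccont g -> int_m (fun t => (f t - g t)%C) = (int_m f - int_m g)%C.
Proof.
  intros Hf Hg.
  rewrite (int_m_ext _ (fun t => (f t + RtoC (-1) * g t)%C)).
  - rewrite int_m_plus, int_m_scal; try assumption.
    + unfold Cminus; f_equal; unfold RtoC, Cmult, Copp; simpl; f_equal; ring.
    + apply Ccont_mult; [apply Ccont_const | assumption].
  - intros t; unfold Cminus; f_equal; unfold RtoC, Cmult, Copp; simpl; f_equal; ring.
Qed.

Lemma int_m_conj (f : R -> C) :
  Ccont f -> int_m (fun t => Cconj (f t)) = Cconj (int_m f).
Proof.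
  intros Hf; rewrite !int_m_pair; try assumption; [|now apply Ccont_conj].
  unfold Cconj; simpl; f_equal.
  rewrite (int_m_R_ext _ (fun t => (-1) * snd (f t))) by (intros; ring).
  rewrite int_m_R_scal by Ccont_parts; ring.
Qed.

Lemma int_m_const (c : C) : int_m (fun _ => c) = c.
Proof.
  rewrite int_m_pair by apply Ccont_const.
  rewrite !int_m_R_const; now destruct c.
Qed.

(** The factor 2 comes from bounding real and imaginary parts separately; it is harmless where [M]
    is sent to 0. *)
Lemma int_m_le_const (f : R -> C) (M : R) :
  Ccont f -> (forall t, Cmod (f t) <= M) -> Cmod (int_m f) <= 2 * M.
Proof.
  intros Hf HM; rewrite int_m_pair by assumption.
  eapply Rle_trans; [apply Cmod_pair_le|].
  assert (H1 : Rabs (int_m_R (fun t => fst (f t))) <= M).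
  { apply int_m_R_le_const; [Ccont_parts|].
    intros t; eapply Rle_trans; [|apply (HM t)].
    eapply Rle_trans; [apply Rmax_l | apply Rmax_Cmod]. }
  assert (H2 : Rabs (int_m_R (fun t => snd (f t))) <= M).
  { apply int_m_R_le_const; [Ccont_parts|].
    intros t; eapply Rle_trans; [|apply (HM t)].
    eapply Rle_trans; [apply Rmax_r | apply Rmax_Cmod]. }
  lra.
Qed.

Lemma int_m_circ_pow (k : nat) : int_m (fun t => circ (INR (S k) * t)) = RtoC 0.
Proof.
  assert (Hk : 0 < INR (S k)) by (apply lt_0_INR; lia).
  rewrite int_m_pair.
  2:{ intros t; split; simpl;
      [apply continuous_cos_comp | apply continuous_sin_comp];
      apply (@continuous_mult _ R_AbsRing);
      first [apply continuous_const | apply continuous_id]. }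
  unfold int_m_R.
  set (K := INR (S k)) in *; unfold circ; simpl fst; simpl snd.
  assert (E0 : circ (K * (2 * PI)) = circ (K * 0)).
  { rewrite <- (circ_period (K * 0) (Z.of_nat (S k))), <- INR_IZR_INZ; fold K.
    f_equal; ring. }
  assert (Ec : cos (K * (2 * PI)) = cos (K * 0)) by (injection E0; auto).
  assert (Es : sin (K * (2 * PI)) = sin (K * 0)) by (injection E0; auto).
  replace (RInt (fun t => cos (K * t)) 0 (2 * PI)) with 0.
  replace (RInt (fun t => sin (K * t)) 0 (2 * PI)) with 0.
  - unfold RtoC; now rewrite Rmult_0_r.
  - symmetry; apply is_RInt_unique.
    replace 0 with (minus (- cos (K * (2 * PI)) / K) (- cos (K * 0) / K)) at 2
      by (rewrite Ec; unfold minus, plus, opp; simpl; ring).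
    apply (is_RInt_derive (fun t => - cos (K * t) / K)).
    + intros x _; auto_derive; [easy | field; lra].
    + intros x _; apply continuous_sin_comp; apply (@continuous_mult _ R_AbsRing);
      first [apply continuous_const | apply continuous_id].
  - symmetry; apply is_RInt_unique.
    replace 0 with (minus (sin (K * (2 * PI)) / K) (sin (K * 0) / K)) at 2
      by (rewrite Es; unfold minus, plus, opp; simpl; ring).
    apply (is_RInt_derive (fun t => sin (K * t) / K)).
    + intros x _; auto_derive; [easy | field; lra].
    + intros x _; apply continuous_cos_comp; apply (@continuous_mult _ R_AbsRing);
      first [apply continuous_const | apply continuous_id].
Qed.

(** * The disk algebra, through its boundary values *)

(** Polynomials in [z = circ t] in Horner form: closure properties and bounds follow by induction
    without degrees or coefficients. *)
Inductive circle_poly : (R -> C) -> Prop :=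
| circle_poly_const (c : C) (f : R -> C) : (forall t, f t = c) -> circle_poly f
| circle_poly_step (c : C) (g f : R -> C) :
    circle_poly g -> (forall t, f t = (c + circ t * g t)%C) -> circle_poly f.

Lemma circle_poly_ext (f g : R -> C) :
  (forall t, g t = f t) -> circle_poly f -> circle_poly g.
Proof.
  intros E Hf; revert E; destruct Hf as [c h H | c h k Hh H]; intros E.
  - apply circle_poly_const with c; intros; now rewrite E.
  - apply circle_poly_step with c h; [exact Hh | intros; now rewrite E].
Qed.

Lemma circle_poly_shift (f : R -> C) :
  circle_poly f -> circle_poly (fun t => (circ t * f t)%C).
Proof. intros H; apply circle_poly_step with (RtoC 0) f; [exact H | intros; ring]. Qed.

Lemma circle_poly_scal (k : C) (f : R -> C) :
  circle_poly f -> circle_poly (fun t => (k * f t)%C).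
Proof.
  induction 1 as [c f E | c g f Hg IH E].
  - apply circle_poly_const with (k * c)%C; intros; now rewrite E.
  - apply circle_poly_step with (k * c)%C (fun t => (k * g t)%C); [exact IH|].
    intros; rewrite E; ring.
Qed.

Lemma circle_poly_plus (f g : R -> C) :
  circle_poly f -> circle_poly g -> circle_poly (fun t => (f t + g t)%C).
Proof.
  intros Hf; revert g; induction Hf as [c f E | c f' f Hf' IH E].
  - intros g [d h H | d h k Hh H].
    + apply circle_poly_const with (c + d)%C; intros; now rewrite E, H.
    + apply circle_poly_step with (c + d)%C h; [exact Hh|].
      intros; rewrite E, H; ring.
  - intros g [d h H | d h k Hh H].
    + apply circle_poly_step with (c + d)%C f'; [exact Hf'|].
      intros; rewrite E, H; ring.
    + apply circle_poly_step with (c + d)%C (fun t => (f' t + h t)%C); [now apply IH|].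
      intros; rewrite E, H; ring.
Qed.

Lemma circle_poly_mult (f g : R -> C) :
  circle_poly f -> circle_poly g -> circle_poly (fun t => (f t * g t)%C).
Proof.
  intros Hf Hg; induction Hf as [c f E | c f' f Hf' IH E].
  - apply circle_poly_ext with (fun t => (c * g t)%C); [intros; now rewrite E|].
    now apply circle_poly_scal.
  - apply circle_poly_ext with (fun t => (c * g t + circ t * (f' t * g t))%C).
    { intros; rewrite E; ring. }
    apply circle_poly_plus; [now apply circle_poly_scal | now apply circle_poly_shift].
Qed.

Lemma circle_poly_Ccont (f : R -> C) : circle_poly f -> Ccont f.
Proof.
  induction 1 as [c f E | c g f Hg IH E].
  - apply Ccont_ext with (fun _ => c); [intros; now rewrite E | apply Ccont_const].
  - apply Ccont_ext with (fun t => (c + circ t * g t)%C); [intros; now rewrite E|].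
    apply Ccont_plus; [apply Ccont_const|].
    apply Ccont_mult; [apply Ccont_circ | exact IH].
Qed.

Lemma circle_poly_bounded (f : R -> C) :
  circle_poly f -> exists B, 0 < B /\ forall t, Cmod (f t) <= B.
Proof.
  induction 1 as [c f E | c g f Hg [B [HB IH]] E].
  - exists (Cmod c + 1); split; [generalize (Cmod_ge_0 c); lra|].
    intros; rewrite E; lra.
  - exists (Cmod c + B); split; [generalize (Cmod_ge_0 c); lra|].
    intros; rewrite E; eapply Rle_trans; [apply Cmod_triangle|].
    rewrite Cmod_mult, Cmod_circ; generalize (IH t); lra.
Qed.

Lemma int_m_circ_mult_poly (f : R -> C) :
  circle_poly f -> int_m (fun t => (circ t * f t)%C) = RtoC 0.
Proof.
  intros Hf.
  (* All positive powers are needed at once: with [f = c + z g], the Horner step turns [z^(k+1) f]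
     into [c z^(k+1) + z^(k+2) g]. *)
  assert (H : forall k, int_m (fun t => (circ (INR (S k) * t) * f t)%C) = RtoC 0).
  { assert (Hc : forall k, Ccont (fun t => circ (INR (S k) * t))).
    { intros k; apply Ccont_ext with (fun t => pow_n (circ t) (S k)).
      { intros; apply pow_n_circ. }
      induction (S k) as [|n IH]; [exact (Ccont_const (RtoC 1))|].
      exact (Ccont_mult _ _ Ccont_circ IH). }
    induction Hf as [c f E | c g f Hg IH E]; intros k.
    - rewrite (int_m_ext _ (fun t => (c * circ (INR (S k) * t))%C))
        by (intros; rewrite E; ring).
      rewrite int_m_scal, int_m_circ_pow by apply Hc; ring.
    - rewrite (int_m_ext _ (fun t => (c * circ (INR (S k) * t)
                                      + circ (INR (S (S k)) * t) * g t)%C)).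
      2:{ intros t; rewrite E, (S_INR (S k)), Rmult_plus_distr_r, circ_plus, Rmult_1_l.
          ring. }
      rewrite int_m_plus, int_m_scal, int_m_circ_pow, IH.
      + ring.
      + apply Hc.
      + apply Ccont_mult; [apply Ccont_const | apply Hc].
      + apply Ccont_mult; [apply Hc | now apply circle_poly_Ccont]. }
  rewrite <- (H O); apply int_m_ext; intros t; simpl; now rewrite Rmult_1_l.
Qed.

(** Analyticity inside the disc is encoded by uniform approximation on the circle, so that the mean
    value property is inherited from polynomials. *)
Definition disk_algebra (f : R -> C) : Prop :=
  Ccont f /\
  forall e, 0 < e -> exists g, circle_poly g /\ forall t, Cmod (f t - g t) <= e.

Lemma disk_algebra_ext (f g : R -> C) :
  (forall t, g t = f t) -> disk_algebra f -> disk_algebra g.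
Proof.
  intros E [Hc Ha]; split; [now apply Ccont_ext with f|].
  intros e He; destruct (Ha e He) as [h [Hh Hb]]; exists h; split; [exact Hh|].
  intros; now rewrite E.
Qed.

Lemma disk_algebra_poly (f : R -> C) : circle_poly f -> disk_algebra f.
Proof.
  intros Hf; split; [now apply circle_poly_Ccont|].
  intros e He; exists f; split; [exact Hf|]; intros t.
  replace (f t - f t)%C with (RtoC 0) by ring; rewrite Cmod_0; lra.
Qed.

Lemma disk_algebra_bounded (f : R -> C) :
  disk_algebra f -> exists B, 0 < B /\ forall t, Cmod (f t) <= B.
Proof.
  intros [_ H]; destruct (H 1 Rlt_0_1) as [g [Hg Hb]].
  destruct (circle_poly_bounded g Hg) as [B [HB HgB]].
  exists (1 + B); split; [lra|]; intros t.
  replace (f t) with ((f t - g t) + g t)%C by ring.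
  eapply Rle_trans; [apply Cmod_triangle|]; generalize (Hb t) (HgB t); lra.
Qed.

Lemma disk_algebra_closed (f : R -> C) :
  Ccont f ->
  (forall e, 0 < e -> exists g, disk_algebra g /\ forall t, Cmod (f t - g t) <= e) ->
  disk_algebra f.
Proof.
  intros Hc H; split; [exact Hc|]; intros e He.
  destruct (H (e / 2)) as [g [[_ Hg] Hb]]; [lra|].
  destruct (Hg (e / 2)) as [h [Hh Hb']]; [lra|].
  exists h; split; [exact Hh|]; intros t.
  replace (f t - h t)%C with ((f t - g t) + (g t - h t))%C by ring.
  eapply Rle_trans; [apply Cmod_triangle|]; generalize (Hb t) (Hb' t); lra.
Qed.

Lemma disk_algebra_plus (f g : R -> C) :
  disk_algebra f -> disk_algebra g -> disk_algebra (fun t => (f t + g t)%C).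
Proof.
  intros [Hf Af] [Hg Ag]; split; [now apply Ccont_plus|]; intros e He.
  destruct (Af (e / 2)) as [f' [Hf' Bf]]; [lra|].
  destruct (Ag (e / 2)) as [g' [Hg' Bg]]; [lra|].
  exists (fun t => (f' t + g' t)%C); split; [now apply circle_poly_plus|]; intros t.
  replace (f t + g t - (f' t + g' t))%C with ((f t - f' t) + (g t - g' t))%C by ring.
  eapply Rle_trans; [apply Cmod_triangle|]; generalize (Bf t) (Bg t); lra.
Qed.

Lemma disk_algebra_mult (f g : R -> C) :
  disk_algebra f -> disk_algebra g -> disk_algebra (fun t => (f t * g t)%C).
Proof.
  intros Df Dg.
  destruct (disk_algebra_bounded f Df) as [B [HB Bf]].
  destruct Df as [Hf Af], Dg as [Hg Ag]; split; [now apply Ccont_mult|]; intros e He.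
  destruct (Ag (e / 2 / B)) as [g' [Hg' Bg]]; [apply Rdiv_lt_0_compat; lra|].
  destruct (circle_poly_bounded g' Hg') as [B' [HB' Bg']].
  (* [f'] is chosen after [g'] because its precision depends on the bound [B'] of [g']. *)
  destruct (Af (e / 2 / B')) as [f' [Hf' Bf']]; [apply Rdiv_lt_0_compat; lra|].
  exists (fun t => (f' t * g' t)%C); split; [now apply circle_poly_mult|]; intros t.
  replace (f t * g t - f' t * g' t)%C
    with (f t * (g t - g' t) + (f t - f' t) * g' t)%C by ring.
  eapply Rle_trans; [apply Cmod_triangle|]; rewrite !Cmod_mult.
  replace e with (B * (e / 2 / B) + (e / 2 / B') * B') by (field; lra).
  apply Rplus_le_compat; apply Rmult_le_compat; try apply Cmod_ge_0; auto.
Qed.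

Lemma disk_algebra_const (c : C) : disk_algebra (fun _ => c).
Proof. apply disk_algebra_poly; now apply circle_poly_const with c. Qed.

Lemma circle_poly_circ : circle_poly circ.
Proof.
  apply circle_poly_step with (RtoC 0) (fun _ => RtoC 1).
  - now apply circle_poly_const with (RtoC 1).
  - intros; ring.
Qed.

Lemma disk_algebra_circ : disk_algebra circ.
Proof. apply disk_algebra_poly, circle_poly_circ. Qed.

Lemma one_minus_neq_0 (z : C) (q : R) : q < 1 -> Cmod z <= q -> (1 - z)%C <> RtoC 0.
Proof.
  intros Hq Hz E.
  assert (E' : z = RtoC 1) by (replace z with (1 - (1 - z))%C by ring; rewrite E; ring).
  rewrite E', Cmod_1 in Hz; lra.
Qed.

Lemma disk_algebra_geom (f : R -> C) (q : R) :
  q < 1 -> (forall t, Cmod (f t) <= q) -> disk_algebra f ->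
  disk_algebra (fun t => (/ (1 - f t))%C).
Proof.
  intros Hq Hf Df.
  assert (Hq0 : 0 <= q) by (apply Rle_trans with (2 := Hf 0), Cmod_ge_0).
  assert (Hnz : forall t, (1 - f t)%C <> RtoC 0)
    by (intros t; now apply one_minus_neq_0 with q).
  apply disk_algebra_closed.
  { apply Ccont_inv; [|exact Hnz].
    apply Ccont_minus; [apply Ccont_const | apply Df]. }
  (* Partial sums of the geometric series in Horner form: the error of [S (k + 1)] is then exactly
     [f] times the error of [S k]. *)
  pose (S := fix S (k : nat) (t : R) : C :=
               match k with O => RtoC 1 | Datatypes.S k => (1 + f t * S k t)%C end).
  assert (DS : forall k, disk_algebra (S k)).
  { induction k as [|k IH]; [apply disk_algebra_const|].
    apply (disk_algebra_plus (fun _ => RtoC 1)); [apply disk_algebra_const|].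
    now apply disk_algebra_mult. }
  assert (HS : forall k t, Cmod (/ (1 - f t) - S k t) <= q ^ k * (1 + / (1 - q))).
  { intros k t; induction k as [|k IH].
    - simpl (S _ _); simpl (q ^ 0); rewrite Rmult_1_l.
      eapply Rle_trans; [apply Cmod_sub_le|]; rewrite Cmod_1, Cmod_inv by apply Hnz.
      rewrite Rplus_comm; apply Rplus_le_compat_l, Rinv_le_contravar; [lra|].
      generalize (Cmod_triangle_rev 1 (f t)) (Hf t); rewrite Cmod_1; lra.
    - replace (/ (1 - f t) - S (Datatypes.S k) t)%C
        with (f t * (/ (1 - f t) - S k t))%C by (simpl; field; apply Hnz).
      rewrite Cmod_mult; simpl (q ^ _); rewrite Rmult_assoc.
      apply Rmult_le_compat; try apply Cmod_ge_0; auto. }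
  intros e He.
  assert (Hpos : 0 < 1 + / (1 - q)) by (assert (0 < / (1 - q)) by (apply Rinv_0_lt_compat; lra); lra).
  destruct (pow_lt_1_zero q) with (y := e / (1 + / (1 - q))) as [k Hk].
  { rewrite Rabs_pos_eq; assumption. }
  { now apply Rdiv_lt_0_compat. }
  exists (S k); split; [apply DS|]; intros t.
  eapply Rle_trans; [apply HS|].
  specialize (Hk k (Nat.le_refl _)).
  rewrite Rabs_pos_eq in Hk by now apply pow_le.
  now apply Rlt_le, (Rlt_div_r _ _ _ Hpos).
Qed.

(** The mean value property: [z f(z)] vanishes at the origin. Every orthogonality relation for the
    Bernstein-Szego weights comes from it. *)
Lemma int_m_circ_mult (f : R -> C) :
  disk_algebra f -> int_m (fun t => (circ t * f t)%C) = RtoC 0.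
Proof.
  intros [Hc Ha]; apply Cmod_eq_0, Rle_antisym; [|apply Cmod_ge_0].
  apply le_epsilon; intros e He; rewrite Rplus_0_l.
  destruct (Ha (e / 2)) as [g [Hg Hb]]; [lra|].
  assert (Hgc := circle_poly_Ccont g Hg).
  replace (int_m (fun t => (circ t * f t)%C))
    with (int_m (fun t => (circ t * (f t - g t))%C)).
  - replace e with (2 * (e / 2)) by field; apply int_m_le_const.
    + apply Ccont_mult; [apply Ccont_circ | now apply Ccont_minus].
    + intros t; rewrite Cmod_mult, Cmod_circ, Rmult_1_l; apply Hb.
  - rewrite (int_m_ext _ (fun t => (circ t * f t - circ t * g t)%C)) by (intros; ring).
    rewrite int_m_minus by (apply Ccont_mult; assumption || apply Ccont_circ).
    rewrite (int_m_circ_mult_poly g Hg); ring.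
Qed.

(** * Polynomials given by their coefficients *)

Lemma csum_O (f : nat -> C) : sum_n f O = f O :> C.
Proof. exact (sum_O f). Qed.

Lemma csum_S (f : nat -> C) (n : nat) : sum_n f (S n) = (sum_n f n + f (S n))%C :> C.
Proof. exact (sum_Sn f n). Qed.

Lemma csum_ext (f g : nat -> C) (n : nat) :
  (forall k, (k <= n)%nat -> f k = g k) -> sum_n f n = sum_n g n :> C.
Proof. intros; now apply sum_n_ext_loc. Qed.

Lemma csum_first (f : nat -> C) (n : nat) :
  sum_n f (S n) = (f O + sum_n (fun k => f (S k)) n)%C :> C.
Proof.
  induction n as [|n IH].
  - now rewrite csum_S, !csum_O.
  - rewrite csum_S, IH, csum_S; ring.
Qed.

Lemma csum_rev (f : nat -> C) (n : nat) : sum_n (fun k => f (n - k)%nat) n = sum_n f n :> C.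
Proof.
  induction n as [|n IH]; [now rewrite !csum_O|].
  rewrite csum_first, csum_S, <- IH; simpl (S n - 0)%nat; simpl (S n - S _)%nat; ring.
Qed.

Lemma csum_plus (f g : nat -> C) (n : nat) :
  sum_n (fun k => (f k + g k)%C) n = (sum_n f n + sum_n g n)%C :> C.
Proof.
  induction n as [|n IH]; [now rewrite !csum_O | rewrite !csum_S, IH; ring].
Qed.

Lemma csum_scal (a : C) (f : nat -> C) (n : nat) :
  sum_n (fun k => (a * f k)%C) n = (a * sum_n f n)%C :> C.
Proof.
  induction n as [|n IH]; [now rewrite !csum_O | rewrite !csum_S, IH; ring].
Qed.

Lemma csum_conj (f : nat -> C) (n : nat) :
  sum_n (fun k => Cconj (f k)) n = Cconj (sum_n f n) :> C.
Proof.
  induction n as [|n IH]; [now rewrite !csum_O|].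
  now rewrite !csum_S, IH, Cplus_conj.
Qed.

Lemma poly_star_eval_circ (c : nat -> C) (n : nat) (t : R) :
  poly_star_eval c n (circ t) = (circ (INR n * t) * Cconj (poly_eval c n (circ t)))%C.
Proof.
  unfold poly_star_eval, poly_eval; rewrite <- csum_conj, <- csum_scal.
  apply csum_ext; intros k Hk.
  rewrite !pow_n_circ, Cmult_conj, Cconj_circ.
  replace (INR n * t) with (INR (n - k) * t + INR k * t)
    by (rewrite minus_INR by exact Hk; ring).
  rewrite circ_plus.
  transitivity (Cconj (c k) * circ (INR (n - k) * t) * (circ (- (INR k * t)) * circ (INR k * t)))%C.
  - rewrite <- Cconj_circ, circ_conj_l; ring.
  - ring.
Qed.

Lemma poly_eval_circle_poly (c : nat -> C) (n : nat) :
  circle_poly (fun t => poly_eval c n (circ t)).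
Proof.
  revert c; induction n as [|n IH]; intros c.
  - apply circle_poly_const with (c O); intros t.
    unfold poly_eval; rewrite csum_O; simpl; apply Cmult_1_r.
  - apply circle_poly_step with (c O) (fun t => poly_eval (fun k => c (S k)) n (circ t)).
    { apply IH. }
    intros t; unfold poly_eval; rewrite csum_first, <- csum_scal; f_equal.
    + simpl; apply Cmult_1_r.
    + apply csum_ext; intros k _.
      change (pow_n (circ t) (S k)) with (circ t * pow_n (circ t) k)%C; ring.
Qed.

Lemma poly_star_eval_eq (c : nat -> C) (n : nat) (z : C) :
  poly_star_eval c n z = poly_eval (fun k => Cconj (c (n - k)%nat)) n z.
Proof.
  unfold poly_star_eval, poly_eval; rewrite <- csum_rev; apply csum_ext; intros k Hk.
  now replace (n - (n - k))%nat with k by lia.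
Qed.

(** * The Szego recursion *)

Definition rho (a : C) : R := sqrt (1 - Cmod a ^ 2).

Lemma rho_pos (a : C) : Cmod a < 1 -> 0 < rho a.
Proof. intros H; apply sqrt_lt_R0; generalize (Cmod_ge_0 a); nra. Qed.

Lemma rho_sqr (a : C) : Cmod a < 1 -> rho a ^ 2 = 1 - Cmod a ^ 2.
Proof. intros H; apply pow2_sqrt; generalize (Cmod_ge_0 a); nra. Qed.

Lemma rho_le_1 (a : C) : rho a <= 1.
Proof.
  rewrite <- sqrt_1; apply sqrt_le_1_alt; generalize (pow2_ge_0 (Cmod a)); lra.
Qed.

Lemma RtoC_neq_0 (x : R) : x <> 0 -> RtoC x <> RtoC 0.
Proof. intros H E; apply H; now apply RtoC_inj. Qed.

Fixpoint szego (al : nat -> C) (n : nat) : nat -> C :=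
  match n with
  | O => fun k => match k with O => RtoC 1 | S _ => RtoC 0 end
  | S n => fun k =>
      (RtoC (/ rho (al n))
       * ((match k with O => RtoC 0 | S k => szego al n k end)
          - Cconj (al n) * (if Nat.leb k n then Cconj (szego al n (n - k)%nat) else RtoC 0)))%C
  end.

Definition phi (al : nat -> C) (n : nat) (t : R) : C := poly_eval (szego al n) n (circ t).
Definition phis (al : nat -> C) (n : nat) (t : R) : C := poly_star_eval (szego al n) n (circ t).

Lemma phi_0 (al : nat -> C) (t : R) : phi al 0 t = RtoC 1.
Proof. unfold phi, poly_eval; rewrite csum_O; simpl; apply Cmult_1_r. Qed.

Lemma phis_phi (al : nat -> C) (n : nat) (t : R) :
  phis al n t = (circ (INR n * t) * Cconj (phi al n t))%C.
Proof. apply poly_star_eval_circ. Qed.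

Lemma phi_phis (al : nat -> C) (n : nat) (t : R) :
  phi al n t = (circ (INR n * t) * Cconj (phis al n t))%C.
Proof.
  rewrite phis_phi, Cmult_conj, Cconj_conj, Cmult_assoc, circ_conj_r; ring.
Qed.

Lemma phis_0 (al : nat -> C) (t : R) : phis al 0 t = RtoC 1.
Proof.
  rewrite phis_phi, phi_0; simpl; rewrite Rmult_0_l, circ_0.
  unfold Cconj, RtoC, Cmult; simpl; f_equal; ring.
Qed.

Lemma phi_S (al : nat -> C) (n : nat) (t : R) :
  phi al (S n) t
  = (RtoC (/ rho (al n)) * (circ t * phi al n t - Cconj (al n) * phis al n t))%C.
Proof.
  unfold phi at 1, poly_eval.
  rewrite (csum_ext _ (fun k =>
     RtoC (/ rho (al n)) *
       ((match k with O => RtoC 0 | S k => szego al n k end) * pow_n (circ t) k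
        + (- Cconj (al n)) *
          ((if Nat.leb k n then Cconj (szego al n (n - k)%nat) else RtoC 0)
           * pow_n (circ t) k)))%C) by (intros; simpl szego; ring).
  rewrite csum_scal, csum_plus, csum_scal.
  rewrite csum_first.
  rewrite (csum_S (fun k => ((if Nat.leb k n then _ else _) * _)%C)).
  rewrite (csum_ext (fun k => ((if Nat.leb k n then _ else _) * _)%C)
             (fun k => (Cconj (szego al n (n - k)%nat) * pow_n (circ t) k)%C)).
  2:{ intros k Hk; now rewrite (proj2 (Nat.leb_le k n) Hk). }
  rewrite (proj2 (Nat.leb_gt (S n) n)) by lia.
  unfold phis; rewrite poly_star_eval_eq; unfold phi, poly_eval.
  rewrite (csum_ext (fun k => (szego al n k * pow_n (circ t) (S k))%C)
             (fun k => (circ t * (szego al n k * pow_n (circ t) k))%C)).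
  2:{ intros k _; change (pow_n (circ t) (S k)) with (circ t * pow_n (circ t) k)%C; ring. }
  rewrite csum_scal; ring.
Qed.

Lemma RtoC_conj (x : R) : Cconj (RtoC x) = RtoC x.
Proof. unfold Cconj, RtoC; simpl; f_equal; ring. Qed.

(** On the circle [phi_n] is [z^n] times the conjugate of [phis], so the recursion closes on [phis]
    alone, at the price of being only real-linear. This form serves the chirps; [phis_S] below
    serves the analytic arguments. *)
Lemma phis_S_conj (al : nat -> C) (n : nat) (t : R) :
  phis al (S n) t
  = (RtoC (/ rho (al n))
     * (phis al n t - al n * circ (INR (S n) * t) * Cconj (phis al n t)))%C.
Proof.
  rewrite (phis_phi al (S n)), phi_S, Cmult_conj, Cminus_conj, !Cmult_conj, RtoC_conj, Cconj_conj.
  rewrite (phis_phi al n) at 2.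
  rewrite S_INR, Rmult_plus_distr_r, circ_plus, Rmult_1_l.
  transitivity (RtoC (/ rho (al n)) *
     (circ (INR n * t) * (circ t * Cconj (circ t)) * Cconj (phi al n t)
      - al n * (circ (INR n * t) * circ t) * Cconj (phis al n t)))%C; [ring|].
  rewrite circ_conj_r; ring.
Qed.

Lemma phis_S (al : nat -> C) (n : nat) (t : R) :
  phis al (S n) t
  = (RtoC (/ rho (al n)) * (phis al n t - al n * circ t * phi al n t))%C.
Proof.
  rewrite phis_S_conj, (phi_phis al n t), S_INR, Rmult_plus_distr_r, circ_plus, Rmult_1_l.
  ring.
Qed.

Lemma Cmod_phi (al : nat -> C) (n : nat) (t : R) : Cmod (phi al n t) = Cmod (phis al n t).
Proof. rewrite phis_phi, Cmod_mult, Cmod_circ, Cmod_conj; ring. Qed.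

(** Since [phi] and [phis] have equal moduli on the circle, the subtracted term is smaller than
    [phis] by the factor [|al_n| < 1]. *)
Lemma Cmod_phis_pos (al : nat -> C) (n : nat) (t : R) :
  (forall k, Cmod (al k) < 1) -> 0 < Cmod (phis al n t).
Proof.
  intros Hal; induction n as [|n IH].
  - rewrite phis_0, Cmod_1; lra.
  - rewrite phis_S, Cmod_mult, Cmod_R.
    assert (Hr := rho_pos _ (Hal n)).
    apply Rmult_lt_0_compat.
    + apply Rabs_pos_lt, Rinv_neq_0_compat; lra.
    + eapply Rlt_le_trans; [|apply Cmod_triangle_rev].
      rewrite !Cmod_mult, Cmod_circ, Cmod_phi.
      generalize (Hal n); nra.
Qed.

Lemma phis_neq_0 (al : nat -> C) (n : nat) (t : R) :
  (forall k, Cmod (al k) < 1) -> phis al n t <> RtoC 0.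
Proof. intros Hal; now apply Cmod_gt_0, Cmod_phis_pos. Qed.

Lemma phi_circle_poly (al : nat -> C) (n : nat) : circle_poly (phi al n).
Proof. apply poly_eval_circle_poly. Qed.

Lemma phis_circle_poly (al : nat -> C) (n : nat) : circle_poly (phis al n).
Proof.
  apply circle_poly_ext with (2 := poly_eval_circle_poly (fun k => Cconj (szego al n (n - k)%nat)) n).
  intros t; apply poly_star_eval_eq.
Qed.

(* [1 / phis (n+1) = rho / phis n * 1 / (1 - al_n z phi_n / phis_n)], and the last
   factor is a geometric series of ratio of modulus [|al_n| < 1] on the circle. *)
Lemma inv_phis_disk_algebra (al : nat -> C) (n : nat) :
  (forall k, Cmod (al k) < 1) -> disk_algebra (fun t => (/ phis al n t)%C).
Proof.
  intros Hal; induction n as [|n IH].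
  - apply disk_algebra_ext with (fun _ => RtoC 1); [|apply disk_algebra_const].
    intros t; rewrite phis_0; field; apply RtoC_neq_0; lra.
  - pose (f := fun t => (al n * (circ t * (phi al n t * / phis al n t)))%C).
    assert (Hf : forall t, Cmod (f t) <= Cmod (al n)).
    { intros t; unfold f; rewrite !Cmod_mult, Cmod_circ, Cmod_inv, Cmod_phi
        by now apply phis_neq_0.
      right; field; generalize (Cmod_phis_pos al n t Hal); lra. }
    apply disk_algebra_ext with
      (fun t => (RtoC (rho (al n)) * (/ phis al n t * / (1 - f t)))%C).
    + intros t; rewrite phis_S.
      assert (H1 := phis_neq_0 al n t Hal).
      assert (H2 := one_minus_neq_0 (f t) _ (Hal n) (Hf t)).
      assert (H3 : rho (al n) <> 0) by (generalize (rho_pos _ (Hal n)); lra).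
      assert (H4 := RtoC_neq_0 _ H3).
      replace (phis al n t - al n * circ t * phi al n t)%C
        with (phis al n t * (1 - f t))%C by (unfold f; field; exact H1).
      rewrite RtoC_inv by exact H3; field; repeat split; assumption.
    + apply disk_algebra_mult; [apply disk_algebra_const|].
      apply disk_algebra_mult; [exact IH|].
      apply disk_algebra_geom with (Cmod (al n)); [apply Hal | exact Hf |].
      apply disk_algebra_mult; [apply disk_algebra_const|].
      apply disk_algebra_mult; [apply disk_algebra_circ|].
      apply disk_algebra_mult; [apply disk_algebra_poly, phi_circle_poly | exact IH].
Qed.

(** * Bernstein-Szego weights *)

Definition bs_weight (al : nat -> C) (n : nat) (t : R) : R := / Cmod (phis al n t) ^ 2.

Lemma Ccont_phi (al : nat -> C) (n : nat) : Ccont (phi al n).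
Proof. apply circle_poly_Ccont, phi_circle_poly. Qed.

Lemma Ccont_phis (al : nat -> C) (n : nat) : Ccont (phis al n).
Proof. apply circle_poly_Ccont, phis_circle_poly. Qed.

Lemma bs_weight_continuous (al : nat -> C) (n : nat) (t : R) :
  (forall k, Cmod (al k) < 1) -> continuous (bs_weight al n) t.
Proof.
  intros Hal; apply continuous_Rinv_comp.
  - apply continuous_Cmod_sqr, Ccont_phis.
  - apply pow_nonzero; generalize (Cmod_phis_pos al n t Hal); lra.
Qed.

Definition bs_step (al : nat -> C) (n : nat) (t : R) : C :=
  (RtoC (/ rho (al n)) * (al n * (circ (INR (S n) * t) * (/ phis al n t * / phis al (S n) t))))%C.

Lemma Cconj_neq_0 (z : C) : z <> RtoC 0 -> Cconj z <> RtoC 0.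
Proof.
  intros H; apply Cmod_gt_0; rewrite Cmod_conj; now apply Cmod_gt_0.
Qed.

Lemma bs_weight_conj (al : nat -> C) (n : nat) (t : R) :
  (forall k, Cmod (al k) < 1) ->
  RtoC (bs_weight al n t) = (/ (phis al n t * Cconj (phis al n t)))%C.
Proof.
  intros Hal; unfold bs_weight.
  rewrite RtoC_inv by (apply pow_nonzero; generalize (Cmod_phis_pos al n t Hal); lra).
  now rewrite Cmod2_conj.
Qed.

Lemma bs_weight_S (al : nat -> C) (n : nat) (t : R) :
  (forall k, Cmod (al k) < 1) ->
  RtoC (bs_weight al (S n) t)
  = (RtoC (bs_weight al n t) + (bs_step al n t + Cconj (bs_step al n t)))%C.
Proof.
  intros Hal; rewrite !bs_weight_conj by exact Hal; unfold bs_step.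
  assert (H1 := phis_neq_0 al n t Hal).
  assert (H2 := phis_neq_0 al (S n) t Hal).
  assert (Hr : rho (al n) <> 0) by (generalize (rho_pos _ (Hal n)); lra).
  assert (H3 := RtoC_neq_0 _ Hr).
  assert (H1' := Cconj_neq_0 _ H1); assert (H2' := Cconj_neq_0 _ H2).
  set (b := (al n * circ (INR (S n) * t))%C).
  assert (E1 : (RtoC (rho (al n)) * phis al (S n) t)%C = (phis al n t - b * Cconj (phis al n t))%C).
  { rewrite phis_S_conj, RtoC_inv by exact Hr; fold b; field; exact H3. }
  assert (E2 : (RtoC (rho (al n)) * Cconj (phis al (S n) t))%C
               = (Cconj (phis al n t) - Cconj b * phis al n t)%C).
  { rewrite <- (RtoC_conj (rho (al n))), <- Cmult_conj, E1, Cminus_conj, Cmult_conj.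
    now rewrite Cconj_conj. }
  assert (E3 : (RtoC (rho (al n)) * RtoC (rho (al n)))%C = (1 - b * Cconj b)%C).
  { rewrite <- RtoC_mult.
    replace (rho (al n) * rho (al n)) with (rho (al n) ^ 2) by ring.
    rewrite rho_sqr, RtoC_minus, Cmod2_conj by apply Hal.
    unfold b; rewrite Cmult_conj.
    transitivity (1 - al n * Cconj (al n) * (circ (INR (S n) * t) * Cconj (circ (INR (S n) * t))))%C;
      [rewrite circ_conj_r; ring | ring]. }
  rewrite !Cmult_conj, !Cinv_conj, RtoC_conj by assumption.
  rewrite RtoC_inv by exact Hr.
  set (r := RtoC (rho (al n))) in *; set (s := phis al n t) in *.
  set (s' := phis al (S n) t) in *; set (sc := Cconj s) in *; set (sc' := Cconj s') in *.
  transitivity (/ (s * sc) + (/ r * (b * (/ s * / s')) + / r * (Cconj b * (/ sc * / sc'))))%C.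
  2:{ unfold b; rewrite Cmult_conj; ring. }
  (* With denominators cleared the claim is a polynomial identity, which follows from
     [r s' = s - b sc], its conjugate and [r^2 = 1 - |b|^2]; [s'] stays an atom until these are
     substituted. *)
  assert (Z : (r * r * (s * sc - s' * sc') - (b * sc * (r * sc') + Cconj b * s * (r * s')))%C = RtoC 0).
  { replace (r * r * (s * sc - s' * sc'))%C with (r * r * s * sc - (r * s') * (r * sc'))%C by ring.
    rewrite E1, E2, E3; ring. }
  assert (Z' : (/ (s' * sc') - (/ (s * sc) + (/ r * (b * (/ s * / s')) + / r * (Cconj b * (/ sc * / sc')))))%C
               = ((r * r * (s * sc - s' * sc') - (b * sc * (r * sc') + Cconj b * s * (r * s')))
                 / (r * r * s * sc * s' * sc'))%C).
  { field; repeat split; assumption. }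
  rewrite Z in Z'.
  set (L := (/ (s' * sc'))%C) in *.
  set (Q := (/ (s * sc) + (/ r * (b * (/ s * / s')) + / r * (Cconj b * (/ sc * / sc'))))%C) in *.
  replace L with (Q + (L - Q))%C by ring; rewrite Z'.
  unfold Cdiv; ring.
Qed.

Lemma Ccont_bs_step (al : nat -> C) (n : nat) :
  (forall k, Cmod (al k) < 1) -> Ccont (bs_step al n).
Proof.
  intros Hal; unfold bs_step.
  apply Ccont_mult; [apply Ccont_const|].
  apply Ccont_mult; [apply Ccont_const|].
  apply Ccont_mult.
  - apply Ccont_ext with (fun t => pow_n (circ t) (S n)).
    { intros; apply pow_n_circ. }
    induction (S n) as [|k IH]; [exact (Ccont_const (RtoC 1))|].
    exact (Ccont_mult _ _ Ccont_circ IH).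
  - apply Ccont_mult; apply inv_phis_disk_algebra, Hal.
Qed.

Lemma circ_pow_disk_algebra (n : nat) : disk_algebra (fun t => circ (INR n * t)).
Proof.
  apply disk_algebra_ext with (fun t => pow_n (circ t) n); [intros; now rewrite pow_n_circ|].
  induction n as [|k IH]; [exact (disk_algebra_const (RtoC 1))|].
  exact (disk_algebra_mult _ _ disk_algebra_circ IH).
Qed.

(** On the circle [z^(M+1)] times the conjugate of [phi_k] is [z^(M+1-k) phi_k^*], and the exponent
    is positive for [k <= M]; so the integrand is [z] times a function of the disk algebra. *)
Lemma int_m_bs_step (al : nat -> C) (M n k : nat) :
  (forall k, Cmod (al k) < 1) -> (k <= M)%nat ->
  int_m (fun t => (phi al n t * Cconj (phi al k t) * bs_step al M t)%C) = RtoC 0.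
Proof.
  intros Hal Hk.
  rewrite (int_m_ext _ (fun t => (circ t * (RtoC (/ rho (al M)) * al M *
     (phi al n t * (circ (INR (M - k) * t) * (phis al k t *
        (/ phis al M t * / phis al (S M) t))))))%C)).
  - apply int_m_circ_mult.
    apply disk_algebra_mult; [apply disk_algebra_const|].
    apply disk_algebra_mult; [apply disk_algebra_poly, phi_circle_poly|].
    apply disk_algebra_mult; [apply circ_pow_disk_algebra|].
    apply disk_algebra_mult; [apply disk_algebra_poly, phis_circle_poly|].
    apply disk_algebra_mult; now apply inv_phis_disk_algebra.
  - intros t; unfold bs_step; rewrite (phis_phi al k).
    replace (INR (S M) * t) with (t + (INR (M - k) * t + INR k * t)).
    + rewrite !circ_plus; ring.
    + rewrite S_INR, minus_INR by exact Hk; ring.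
Qed.

(** On the circle the integrand equals [z^(n-k) phi_k^* / phi_n^*]: the constant 1 for [k = n], and
    [z] times a function of the disk algebra for [k < n]. *)
Lemma bs_weight_orthonormal_self (al : nat -> C) (n k : nat) :
  (forall k, Cmod (al k) < 1) -> (k <= n)%nat ->
  int_m (fun t => (phi al n t * Cconj (phi al k t) * RtoC (bs_weight al n t))%C)
  = if Nat.eqb n k then RtoC 1 else RtoC 0.
Proof.
  intros Hal Hk; destruct (Nat.eqb_spec n k) as [<- | Hne].
  - rewrite <- (int_m_const (RtoC 1)); apply int_m_ext; intros t.
    unfold bs_weight; rewrite <- Cmod_phi, <- Cmod2_conj, <- RtoC_mult.
    f_equal; field; rewrite Cmod_phi; generalize (Cmod_phis_pos al n t Hal); lra.
  - rewrite (int_m_ext _ (fun t => (circ t * (circ (INR (n - S k) * t) *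
                 (phis al k t * / phis al n t)))%C)).
    + apply int_m_circ_mult.
      apply disk_algebra_mult; [apply circ_pow_disk_algebra|].
      apply disk_algebra_mult; [apply disk_algebra_poly, phis_circle_poly|].
      now apply inv_phis_disk_algebra.
    + intros t; rewrite bs_weight_conj, (phi_phis al n), (phis_phi al k) by exact Hal.
      replace (INR n * t) with (t + (INR (n - S k) * t + INR k * t)).
      * rewrite !circ_plus; field; split;
          [now apply phis_neq_0 | now apply Cconj_neq_0, phis_neq_0].
      * rewrite minus_INR, S_INR by lia; ring.
Qed.

Lemma bs_weight_orthonormal (al : nat -> C) (M n k : nat) :
  (forall k, Cmod (al k) < 1) -> (k <= n)%nat -> (n <= M)%nat ->
  int_m (fun t => (phi al n t * Cconj (phi al k t) * RtoC (bs_weight al M t))%C)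
  = if Nat.eqb n k then RtoC 1 else RtoC 0.
Proof.
  intros Hal Hk HM; induction HM as [|M HM IH].
  - now apply bs_weight_orthonormal_self.
  - assert (Hphi : forall n k, Ccont (fun t => (phi al n t * Cconj (phi al k t))%C)).
    { intros; apply Ccont_mult; [|apply Ccont_conj]; apply Ccont_phi. }
    assert (Hs := Ccont_bs_step al M Hal).
    (* The increment of the weight is [bs_step] plus its conjugate; the second half is the conjugate
       of the first with [n] and [k] exchanged, and both indices are at most [M]. *)
    rewrite (int_m_ext _ (fun t =>
      (phi al n t * Cconj (phi al k t) * RtoC (bs_weight al M t)
       + (phi al n t * Cconj (phi al k t) * bs_step al M t
          + Cconj (phi al k t * Cconj (phi al n t) * bs_step al M t)))%C)).
    2:{ intros t; rewrite bs_weight_S, !Cmult_conj, Cconj_conj by exact Hal; ring. }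
    assert (Hw : Ccont (fun t => RtoC (bs_weight al M t)))
      by (apply Ccont_RtoC; intros; now apply bs_weight_continuous).
    assert (C1 : Ccont (fun t => (phi al n t * Cconj (phi al k t) * RtoC (bs_weight al M t))%C))
      by exact (Ccont_mult _ _ (Hphi n k) Hw).
    assert (C2 := Ccont_mult _ _ (Hphi n k) Hs).
    assert (C3 := Ccont_mult _ _ (Hphi k n) Hs).
    assert (C4 := Ccont_conj _ C3); cbv beta in C4.
    rewrite int_m_plus by (assumption || now apply Ccont_plus).
    rewrite IH, int_m_plus, int_m_conj, !int_m_bs_step by (assumption || lia).
    rewrite RtoC_conj; ring.
Qed.

(** * Half-open sums *)

Fixpoint rsum (f : nat -> R) (n : nat) : R :=
  match n with O => 0 | S n => rsum f n + f n end.

Fixpoint zsum (f : nat -> C) (n : nat) : C :=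
  match n with O => RtoC 0 | S n => (zsum f n + f n)%C end.

Lemma rsum_le (f g : nat -> R) (n : nat) :
  (forall k, (k < n)%nat -> f k <= g k) -> rsum f n <= rsum g n.
Proof.
  induction n as [|n IH]; intros H; simpl; [lra|].
  apply Rplus_le_compat; [apply IH; intros; apply H; lia | apply H; lia].
Qed.

Lemma rsum_ext (f g : nat -> R) (n : nat) :
  (forall k, (k < n)%nat -> f k = g k) -> rsum f n = rsum g n.
Proof.
  intros H; apply Rle_antisym; apply rsum_le; intros k Hk; rewrite (H k Hk); lra.
Qed.

Lemma rsum_const (c : R) (n : nat) : rsum (fun _ => c) n = INR n * c.
Proof. induction n as [|n IH]; [simpl; ring | rewrite S_INR; simpl; rewrite IH; ring]. Qed.

Lemma rsum_scal (c : R) (f : nat -> R) (n : nat) : rsum (fun k => c * f k) n = c * rsum f n.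
Proof. induction n as [|n IH]; simpl; [ring | rewrite IH; ring]. Qed.

Lemma rsum_plus (f g : nat -> R) (n : nat) : rsum (fun k => f k + g k) n = rsum f n + rsum g n.
Proof. induction n as [|n IH]; simpl; [ring | rewrite IH; ring]. Qed.

Lemma rsum_split (f : nat -> R) (m n : nat) :
  rsum f (m + n) = rsum f m + rsum (fun k => f (m + k)%nat) n.
Proof.
  induction n as [|n IH]; [rewrite Nat.add_0_r; simpl; ring|].
  rewrite Nat.add_succ_r; simpl; rewrite IH; ring.
Qed.

Lemma rsum_nonneg (f : nat -> R) (n : nat) : (forall k, 0 <= f k) -> 0 <= rsum f n.
Proof. intros H; induction n as [|n IH]; simpl; [lra | generalize (H n); lra]. Qed.

Lemma rsum_mono (f : nat -> R) (m n : nat) :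
  (forall k, 0 <= f k) -> (m <= n)%nat -> rsum f m <= rsum f n.
Proof.
  intros H; induction 1 as [|n _ IH]; simpl; [lra | generalize (H n); lra].
Qed.

Lemma zsum_ext (f g : nat -> C) (n : nat) :
  (forall k, (k < n)%nat -> f k = g k) -> zsum f n = zsum g n.
Proof.
  induction n as [|n IH]; intros H; simpl; [reflexivity|].
  rewrite IH, H by (intros; try apply H; lia); reflexivity.
Qed.

Lemma zsum_scal (c : C) (f : nat -> C) (n : nat) :
  zsum (fun k => (c * f k)%C) n = (c * zsum f n)%C.
Proof. induction n as [|n IH]; simpl; [ring | rewrite IH; ring]. Qed.

Lemma zsum_plus (f g : nat -> C) (n : nat) :
  zsum (fun k => (f k + g k)%C) n = (zsum f n + zsum g n)%C.
Proof. induction n as [|n IH]; simpl; [ring | rewrite IH; ring]. Qed.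

Lemma zsum_exchange (f : nat -> nat -> C) (m n : nat) :
  zsum (fun i => zsum (f i) n) m = zsum (fun j => zsum (fun i => f i j) m) n.
Proof.
  induction m as [|m IH]; simpl.
  - induction n as [|n IHn]; simpl; [reflexivity | rewrite <- IHn; ring].
  - now rewrite IH, <- zsum_plus.
Qed.

Lemma fst_zsum (f : nat -> C) (n : nat) : fst (zsum f n) = rsum (fun k => fst (f k)) n.
Proof. induction n as [|n IH]; simpl; [reflexivity | now rewrite IH]. Qed.

(** The denominators run from [2^k + 1] to [2^(k+i)], and each of the [i] dyadic groups contributes
    at least 1/2. This is the source of the logarithm of the block length. *)
Lemma harmonic_dyadic (k i : nat) :
  INR i / 2 <= rsum (fun j => / (INR (2 ^ k) + INR j + 1)) (2 ^ k * (2 ^ i - 1)).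
Proof.
  induction i as [|i IH]; [simpl; rewrite Nat.mul_0_r; simpl; lra|].
  assert (Hi : (1 <= 2 ^ i)%nat) by (apply Nat.neq_0_lt_0, Nat.pow_nonzero; lia).
  replace (2 ^ k * (2 ^ S i - 1))%nat with (2 ^ k * (2 ^ i - 1) + 2 ^ k * 2 ^ i)%nat
    by (rewrite Nat.pow_succ_r'; nia).
  rewrite rsum_split, S_INR.
  assert (H : rsum (fun _ => / (2 * INR (2 ^ k * 2 ^ i))) (2 ^ k * 2 ^ i) <=
              rsum (fun j => / (INR (2 ^ k) + INR (2 ^ k * (2 ^ i - 1) + j) + 1)) (2 ^ k * 2 ^ i)).
  { apply rsum_le; intros j Hj; apply Rinv_le_contravar.
    - generalize (pos_INR (2 ^ k)) (pos_INR (2 ^ k * (2 ^ i - 1) + j)); lra.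
    - replace 2 with (INR 2) by reflexivity.
      rewrite <- mult_INR, <- plus_INR, <- S_INR; apply le_INR; nia. }
  rewrite rsum_const in H.
  assert (Hp : 0 < INR (2 ^ k * 2 ^ i)).
  { apply lt_0_INR, Nat.neq_0_lt_0, Nat.neq_mul_0; split; apply Nat.pow_nonzero; lia. }
  replace (INR (2 ^ k * 2 ^ i) * / (2 * INR (2 ^ k * 2 ^ i))) with (/ 2) in H by (field; lra).
  lra.
Qed.

(** * Sums of the Poisson kernel over equidistant points *)

Lemma circ_neq_1 (x : R) : 0 < x < 2 * PI -> circ x <> RtoC 1.
Proof.
  intros Hx E.
  assert (Hc : cos x = 1) by (injection E; auto).
  replace x with (2 * (x / 2)) in Hc by field.
  rewrite cos_2a_sin in Hc.
  assert (0 < sin (x / 2)) by (apply sin_gt_0; lra); nra.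
Qed.

Lemma zsum_circ_equidistant (N k : nat) (tau : R) :
  (0 < k < N)%nat -> zsum (fun n => circ (INR k * (2 * PI / INR N * INR n + tau))) N = RtoC 0.
Proof.
  intros Hk.
  assert (HN : 0 < INR N) by (apply lt_0_INR; lia).
  assert (Hk' : 0 < INR k < INR N) by (split; [apply lt_0_INR | apply lt_INR]; lia).
  set (zeta := circ (INR k * (2 * PI / INR N))).
  assert (T : forall m, ((zeta - 1) * zsum (fun n => circ (INR k * (2 * PI / INR N * INR n + tau))) m)%C
     = (circ (INR k * (2 * PI / INR N * INR m + tau)) - circ (INR k * tau))%C).
  { induction m as [|m IH].
    - simpl; rewrite Rmult_0_r, Rplus_0_l; ring.
    - simpl zsum; rewrite Cmult_plus_distr_l, IH, S_INR.
      replace (INR k * (2 * PI / INR N * (INR m + 1) + tau))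
        with (INR k * (2 * PI / INR N) + INR k * (2 * PI / INR N * INR m + tau)) by ring.
      rewrite (circ_plus (INR k * (2 * PI / INR N))); fold zeta; ring. }
  specialize (T N).
  replace (INR k * (2 * PI / INR N * INR N + tau))
    with (INR k * tau + 2 * PI * IZR (Z.of_nat k)) in T
    by (rewrite <- INR_IZR_INZ; field; lra).
  rewrite circ_period in T.
  assert (Hz : (zeta - 1)%C <> RtoC 0).
  { intros E; apply (circ_neq_1 (INR k * (2 * PI / INR N))).
    - assert (HP := PI_RGT_0); split.
      + apply Rmult_lt_0_compat; [lra | apply Rdiv_lt_0_compat; lra].
      + apply Rmult_lt_reg_r with (INR N); [lra|].
        replace (INR k * (2 * PI / INR N) * INR N) with (INR k * (2 * PI)) by (field; lra); nra.
    - fold zeta; replace zeta with (1 + (zeta - 1))%C by ring; rewrite E; ring. }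
  set (s := zsum _ _) in *.
  replace s with (/ (zeta - 1) * ((zeta - 1) * s))%C by (field; exact Hz).
  rewrite T; ring.
Qed.

Lemma Cmod_one_minus_circ (q x : R) : Cmod (1 - q * circ x) ^ 2 = 1 - 2 * q * cos x + q ^ 2.
Proof.
  rewrite Cmod_sqr; simpl.
  generalize (sin2_cos2 x); unfold Rsqr; nra.
Qed.

(* Summing [1 / (1 - q z)] over the points [z] with [z^N = s] gives [N / (1 - q^N s)];
   the Poisson kernel is twice the real part of [1 / (1 - q z)] minus one. *)
Lemma poisson_sum_le (N : nat) (q tau : R) :
  (0 < N)%nat -> 0 <= q < 1 -> q ^ N <= / 2 ->
  rsum (fun n => / (1 - 2 * q * cos (2 * PI / INR N * INR n + tau) + q ^ 2)) N
  <= 3 * INR N / (1 - q ^ 2).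
Proof.
  intros HN Hq HqN.
  assert (HN' : 0 < INR N) by (apply lt_0_INR; lia).
  set (om := fun n => 2 * PI / INR N * INR n + tau).
  set (Q := (RtoC (q ^ N) * circ (INR N * tau))%C).
  assert (HQ : Cmod Q <= / 2).
  { unfold Q; rewrite Cmod_mult, Cmod_circ, Cmod_R, Rabs_pos_eq by (apply pow_le; lra); lra. }
  assert (HQ1 := one_minus_neq_0 Q (/ 2) ltac:(lra) HQ).
  assert (Hz : forall n, (1 - q * circ (om n))%C <> RtoC 0).
  { intros n; apply one_minus_neq_0 with q; [lra|].
    rewrite Cmod_mult, Cmod_circ, Cmod_R, Rabs_pos_eq; lra. }
  assert (G : forall n m, ((1 - q * circ (om n)) * zsum (fun k => RtoC (q ^ k) * circ (INR k * om n)) m)%C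
                  = (1 - RtoC (q ^ m) * circ (INR m * om n))%C).
  { intros n m; induction m as [|m IH].
    - simpl; rewrite Rmult_0_l, circ_0; ring.
    - simpl zsum; rewrite Cmult_plus_distr_l, IH, S_INR, Rmult_plus_distr_r, circ_plus, Rmult_1_l.
      simpl (q ^ S m); rewrite RtoC_mult; ring. }
  assert (G1 : forall n, (/ (1 - q * circ (om n)))%C
                 = (/ (1 - Q) * zsum (fun k => RtoC (q ^ k) * circ (INR k * om n)) N)%C).
  { intros n; specialize (G n N).
    replace (circ (INR N * om n)) with (circ (INR N * tau)) in G.
    - fold Q in G; rewrite <- G; field; split; [|apply Hz].
      intros E; apply HQ1; rewrite <- G, E; ring.
    - rewrite <- (circ_period (INR N * tau) (Z.of_nat n)), <- INR_IZR_INZ; unfold om.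
      f_equal; field; lra. }
  (* Only [k = 0] contributes: for [0 < k < N] the [k]-th powers of the equidistant points sum to
     0. *)
  assert (S0 : forall m, (0 < m <= N)%nat ->
     zsum (fun k => zsum (fun n => (RtoC (q ^ k) * circ (INR k * om n))%C) N) m = RtoC (INR N)).
  { intros m; induction m as [|[|m] IH]; intros Hm; [lia| |].
    - simpl zsum; rewrite Cplus_0_l.
      generalize N; intros l; induction l as [|l IHl]; [reflexivity|].
      simpl zsum; rewrite IHl, Rmult_0_l, circ_0, S_INR, RtoC_plus; ring.
    - change (zsum ?f (S (S m))) with (zsum f (S m) + f (S m))%C.
      rewrite IH by lia; cbv beta; rewrite zsum_scal.
      unfold om; rewrite zsum_circ_equidistant by lia; ring. }
  assert (S1 : zsum (fun n => / (1 - q * circ (om n)))%C N = (RtoC (INR N) * / (1 - Q))%C).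
  { rewrite (zsum_ext _ _ _ (fun n _ => G1 n)), zsum_scal, zsum_exchange, S0 by lia; ring. }
  (* Here [|1 - Q| >= 1/2] gives [2 N]; doubling and subtracting [N] yields the constant 3. *)
  assert (S2 : rsum (fun n => fst (/ (1 - q * circ (om n)))%C) N <= INR N * 2).
  { rewrite <- fst_zsum, S1.
    eapply Rle_trans; [apply Rle_abs|].
    eapply Rle_trans; [apply (re_le_Cmod (RtoC (INR N) * / (1 - Q)))|].
    rewrite Cmod_mult, Cmod_R, Rabs_pos_eq, Cmod_inv by (lra || exact HQ1).
    apply Rmult_le_compat_l; [lra|].
    replace 2 with (/ / 2) by field; apply Rinv_le_contravar; [lra|].
    generalize (Cmod_triangle_rev 1 Q); rewrite Cmod_1; lra. }
  assert (Hq2 : 0 < 1 - q ^ 2) by nra.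
  rewrite (rsum_ext _ (fun n => / (1 - q ^ 2) * (2 * fst (/ (1 - q * circ (om n)))%C + - (1)))).
  - rewrite rsum_scal, rsum_plus, rsum_scal, rsum_const.
    unfold Rdiv; rewrite (Rmult_comm (3 * INR N)).
    apply Rmult_le_compat_l; [left; now apply Rinv_0_lt_compat | lra].
  - intros n _; fold (om n).
    assert (HD : 0 < 1 - 2 * q * cos (om n) + q ^ 2).
    { rewrite <- Cmod_one_minus_circ; apply pow_lt, Cmod_gt_0, Hz. }
    rewrite Cinv_eq_conj, Cmod_one_minus_circ by apply Hz; simpl fst.
    field_simplify_eq; [|repeat split; nra].
    ring.
Qed.

(** * A regularised inverse of [e^{ix} - 1] *)

(** With [q = 1 - 1/p] one has [1 - 2 q cos x + q^2 = q (2 - 2 cos x + nu p)], so this value makes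
    [W] exactly [q] times a Poisson denominator inverted, whose sums are known. It is of order
    [p^-2], the square of the frequency below which the phase counts as stationary. *)
Definition nu (p : R) : R := / (p * (p - 1)).
Definition W (p x : R) : R := / (2 - 2 * cos x + nu p).
(** With [z = circ x] this is the conjugate of [z - 1] over [|z - 1|^2 + nu], so that
    [(z - 1) G = 1 - nu W]. *)
Definition G (p x : R) : C := ((circ (- x) - 1) * RtoC (W p x))%C.

Lemma nu_pos (p : R) : 2 <= p -> 0 < nu p.
Proof. intros; apply Rinv_0_lt_compat; nra. Qed.

Lemma W_pos (p x : R) : 2 <= p -> 0 < W p x.
Proof.
  intros Hp; apply Rinv_0_lt_compat.
  generalize (nu_pos p Hp) (COS_bound x); lra.
Qed.

Lemma W_mul (p x : R) : 2 <= p -> (2 - 2 * cos x) * W p x + nu p * W p x = 1.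
Proof.
  intros Hp; unfold W; field.
  generalize (nu_pos p Hp) (COS_bound x); lra.
Qed.

Lemma W_le (p x : R) : 2 <= p -> W p x <= p ^ 2.
Proof.
  intros Hp; unfold W; rewrite <- (Rinv_inv (p ^ 2)); apply Rinv_le_contravar.
  - apply Rinv_0_lt_compat; nra.
  - apply Rle_trans with (nu p); [|generalize (COS_bound x); lra].
    unfold nu; apply Rinv_le_contravar; nra.
Qed.

Lemma Cmod_circ_minus_1 (x : R) : Cmod (circ x - 1) ^ 2 = 2 - 2 * cos x.
Proof. rewrite Cmod_sqr; simpl; generalize (sin2_cos2 x); unfold Rsqr; nra. Qed.

Lemma Rabs_sin_le (x : R) : Rabs (sin x) <= Rabs x.
Proof.
  assert (H : forall y, 0 < y -> Rabs (sin y) <= y).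
  { intros y Hy; assert (B := SIN_bound y).
    destruct (Rle_lt_dec 1 y).
    - apply Rabs_le; lra.
    - assert (HP := PI2_1); assert (0 < sin y) by (apply sin_gt_0; lra).
      rewrite Rabs_pos_eq by lra; now apply Rlt_le, sin_lt_x. }
  destruct (Rtotal_order x 0) as [Hx | [-> | Hx]].
  - rewrite <- (Rabs_Ropp (sin x)), <- sin_neg, <- (Rabs_Ropp x), (Rabs_pos_eq (- x)) by lra.
    apply H; lra.
  - rewrite sin_0; lra.
  - rewrite (Rabs_pos_eq x) by lra; now apply H.
Qed.

Lemma two_minus_2cos_le (x : R) : 2 - 2 * cos x <= x ^ 2.
Proof.
  replace x with (2 * (x / 2)) at 1 by field; rewrite cos_2a_sin.
  assert (H := Rabs_sin_le (x / 2)); apply Rsqr_le_abs_1 in H; unfold Rsqr in H; nra.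
Qed.

Lemma Cmod_circ_minus_1_le (x : R) : Cmod (circ x - 1) <= Rabs x.
Proof.
  apply Rsqr_incr_0_var; [|apply Rabs_pos].
  rewrite <- Rsqr_abs; unfold Rsqr.
  generalize (Cmod_circ_minus_1 x) (two_minus_2cos_le x); nra.
Qed.

(** [W_mul] gives [|z - 1|^2 W <= 1] for [z = circ x], so one factor [W] is absorbed. The same holds
    for [sin x * W] in [sin_W_sqr]: quadratic quantities are controlled by the first power of [W],
    the one that can be summed. *)
Lemma Cmod_G (p x : R) : 2 <= p -> Cmod (G p x) ^ 2 <= W p x.
Proof.
  intros Hp; unfold G; rewrite Cmod_mult, Cmod_R, Rpow_mult_distr, Cmod_circ_minus_1, cos_neg.
  rewrite pow2_abs.
  generalize (W_mul p x Hp) (W_pos p x Hp) (nu_pos p Hp); intros; nra.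
Qed.

Lemma sin_W_sqr (p x : R) : 2 <= p -> (sin x * W p x) ^ 2 <= W p x.
Proof.
  intros Hp.
  assert (H : sin x ^ 2 <= 2 - 2 * cos x).
  { generalize (sin2_cos2 x); unfold Rsqr; intros; generalize (pow2_ge_0 (1 - cos x)); nra. }
  rewrite Rpow_mult_distr.
  apply Rle_trans with ((2 - 2 * cos x) * W p x ^ 2).
  - apply Rmult_le_compat_r; [apply pow2_ge_0 | exact H].
  - generalize (W_mul p x Hp) (W_pos p x Hp) (nu_pos p Hp); intros; nra.
Qed.

Lemma W_one_minus_cos (p x : R) : 2 <= p -> 0 <= (1 - cos x) * W p x <= / 2.
Proof.
  intros Hp.
  assert (H1 := W_mul p x Hp); assert (H2 := W_pos p x Hp).
  assert (H3 := nu_pos p Hp); assert (H4 := COS_bound x).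
  assert (0 < nu p * W p x) by now apply Rmult_lt_0_compat.
  assert (0 <= (1 - cos x) * W p x) by (apply Rmult_le_pos; lra).
  lra.
Qed.

(** A difference of reciprocals: [W - W' = W W' (|A'|^2 - |A|^2)]. The products [|A|^2 W] and
    [|A'|^2 W'] are at most 1, which brings the estimate back to first powers of [W]. *)
Lemma G_lipschitz (p x h : R) :
  2 <= p -> Cmod (G p x - G p (x - h)) <= 3 * Rabs h * (W p x + W p (x - h)).
Proof.
  intros Hp; unfold G.
  set (A := (circ (- x) - 1)%C); set (A' := (circ (- (x - h)) - 1)%C).
  assert (HW := W_pos p x Hp); assert (HW' := W_pos p (x - h) Hp).
  assert (EA : Cmod A ^ 2 = 2 - 2 * cos x) by (unfold A; now rewrite Cmod_circ_minus_1, cos_neg).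
  assert (EA' : Cmod A' ^ 2 = 2 - 2 * cos (x - h))
    by (unfold A'; now rewrite Cmod_circ_minus_1, cos_neg).
  assert (M1 := W_mul p x Hp); assert (M2 := W_mul p (x - h) Hp).
  assert (Hnu := nu_pos p Hp).
  rewrite <- EA in M1; rewrite <- EA' in M2.
  assert (HD : W p x - W p (x - h) = W p x * W p (x - h) * (Cmod A' ^ 2 - Cmod A ^ 2)).
  { set (w := W p x) in *; set (w' := W p (x - h)) in *.
    transitivity (w * (Cmod A' ^ 2 * w' + nu p * w') - w' * (Cmod A ^ 2 * w + nu p * w));
      [rewrite M1, M2; ring | ring]. }
  assert (HAA : Cmod (A - A') <= Rabs h).
  { replace (A - A')%C with (circ (- (x - h)) * (circ (- h) - 1))%C.
    - rewrite Cmod_mult, Cmod_circ, Rmult_1_l, <- (Rabs_Ropp h).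
      apply Cmod_circ_minus_1_le.
    - unfold A, A'; replace (- x) with (- (x - h) + - h) by ring.
      rewrite circ_plus; ring. }
  replace (A * RtoC (W p x) - A' * RtoC (W p (x - h)))%C
    with ((A - A') * RtoC (W p x) + A' * RtoC (W p x - W p (x - h)))%C
    by (rewrite RtoC_minus; ring).
  eapply Rle_trans; [apply Cmod_triangle|].
  rewrite !Cmod_mult, !Cmod_R, (Rabs_pos_eq (W p x)) by lra.
  assert (P := Rabs_pos h); assert (PA := Cmod_ge_0 A); assert (PA' := Cmod_ge_0 A').
  assert (HB : Rabs (W p x - W p (x - h)) <= W p x * W p (x - h) * (Rabs h * (Cmod A + Cmod A'))).
  { rewrite HD, Rabs_mult, Rabs_pos_eq by nra.
    apply Rmult_le_compat_l; [nra|].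
    replace (Cmod A' ^ 2 - Cmod A ^ 2) with ((Cmod A' - Cmod A) * (Cmod A + Cmod A')) by ring.
    rewrite Rabs_mult, (Rabs_pos_eq (Cmod A + Cmod A')) by lra.
    apply Rmult_le_compat_r; [lra|].
    apply Rle_trans with (2 := HAA), Rabs_le.
    generalize (Cmod_triangle_rev A A') (Cmod_triangle_rev A' A).
    rewrite (Cmod_sub_sym A' A); lra. }
  set (w := W p x) in *; set (w' := W p (x - h)) in *.
  set (a := Cmod A) in *; set (a' := Cmod A') in *.
  assert (K1 : a' ^ 2 * w' <= 1) by nra.
  assert (K2 : a ^ 2 * w <= 1) by nra.
  assert (K3 : w * w' * (a * a') <= (w + w') / 2).
  { assert (a * a' <= (a ^ 2 + a' ^ 2) / 2) by (generalize (pow2_ge_0 (a - a')); nra).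
    apply Rle_trans with (w * w' * ((a ^ 2 + a' ^ 2) / 2)).
    - apply Rmult_le_compat_l; [nra | assumption].
    - replace (w * w' * ((a ^ 2 + a' ^ 2) / 2))
        with (w' * (a ^ 2 * w) / 2 + w * (a' ^ 2 * w') / 2) by field; nra. }
  assert (K4 : w * w' * (a' * a') <= w).
  { replace (w * w' * (a' * a')) with (w * (a' ^ 2 * w')) by ring; nra. }
  apply Rle_trans with (Rabs h * w + a' * (w * w' * (Rabs h * (a + a')))).
  - apply Rplus_le_compat; [apply Rmult_le_compat_r; lra | apply Rmult_le_compat_l; assumption].
  - replace (Rabs h * w + a' * (w * w' * (Rabs h * (a + a'))))
      with (Rabs h * (w + w * w' * (a * a') + w * w' * (a' * a'))) by ring.
    replace (3 * Rabs h * (w + w')) with (Rabs h * (3 * (w + w'))) by ring.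
    apply Rmult_le_compat_l; [assumption | lra].
Qed.

Lemma W_sum_le (P : nat) (tau : R) :
  (2 <= P)%nat ->
  rsum (fun n => W (INR P) (2 * PI / INR (P * P) * INR n + tau)) (2 * (P * P)) <= 3 * INR P ^ 3.
Proof.
  intros HP.
  assert (Hp : 2 <= INR P) by (change 2 with (INR 2); now apply le_INR).
  set (p := INR P) in *; set (q := (p - 1) / p).
  assert (Hq : 0 <= q < 1).
  { split; unfold q; [apply Rdiv_le_0_compat; lra|].
    apply Rmult_lt_reg_r with p; [lra|]; unfold Rdiv; rewrite Rmult_assoc, Rinv_l; lra. }
  assert (HqP : q ^ P <= / 2).
  (* Bernoulli's inequality: [1 / q = 1 + 1 / (p - 1)], hence [(1 / q)^P >= 2]. *)
  { assert (B := poly P (/ (p - 1)) ltac:(apply Rinv_0_lt_compat; lra)); fold p in B.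
    assert (Hi : 1 <= p * / (p - 1)).
    { apply Rmult_le_reg_r with (p - 1); [lra|]; rewrite Rmult_assoc, Rinv_l; lra. }
    replace q with (/ (1 + / (p - 1))) by (unfold q; field; lra).
    rewrite pow_inv; apply Rinv_le_contravar; lra. }
  assert (HqN : q ^ (P * P) <= / 2).
  { rewrite pow_mult; apply Rle_trans with (2 := HqP).
    destruct P as [|P']; [lia|].
    assert (H0 : 0 <= q ^ S P') by (apply pow_le; lra).
    rewrite <- (Rmult_1_r (q ^ S P')) at 2; simpl (_ ^ S P') at 1.
    apply Rmult_le_compat_l; [exact H0|].
    rewrite <- (pow1 P'); apply pow_incr; split; [exact H0|].
    apply Rle_trans with (1 := HqP); lra. }
  assert (Hone : forall s, rsum (fun n => W p (2 * PI / INR (P * P) * INR n + s)) (P * P)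
                           <= 3 / 2 * p ^ 3).
  { intros s.
    rewrite (rsum_ext _ (fun n => q *
       / (1 - 2 * q * cos (2 * PI / INR (P * P) * INR n + s) + q ^ 2))).
    - rewrite rsum_scal.
      eapply Rle_trans.
      + apply Rmult_le_compat_l; [lra|].
        apply poisson_sum_le; [nia | exact Hq | exact HqN].
      + rewrite mult_INR; fold p; unfold q.
        replace ((p - 1) / p * (3 * (p * p) / (1 - ((p - 1) / p) ^ 2)))
          with (3 * p ^ 3 * ((p - 1) / (2 * p - 1))) by (field; nra).
        assert ((p - 1) / (2 * p - 1) <= / 2).
        { apply Rmult_le_reg_r with (2 * p - 1); [lra|].
          unfold Rdiv; rewrite Rmult_assoc, Rinv_l; lra. }
        assert (0 < p ^ 3) by (apply pow_lt; lra); nra.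
    - intros n _; unfold W, nu, q.
      set (c := cos _).
      assert (Hc : -1 <= c <= 1) by apply COS_bound.
      assert (H1 : 0 < 2 - 2 * c + / (p * (p - 1))).
      { assert (0 < / (p * (p - 1))) by (apply Rinv_0_lt_compat; nra); lra. }
      assert (H2 : 1 - 2 * ((p - 1) / p) * c + ((p - 1) / p) ^ 2
                   = (p - 1) / p * (2 - 2 * c + / (p * (p - 1)))) by (field; lra).
      rewrite H2; set (y := _ + / _) in *; field; lra. }
  (* The block covers two full turns of the frequency, each bounded by [3/2 p^3] whatever its
     starting point. *)
  replace (2 * (P * P))%nat with (P * P + P * P)%nat by lia.
  rewrite rsum_split.
  rewrite (rsum_ext (fun k => W p (2 * PI / INR (P * P) * INR (P * P + k) + tau))
             (fun k => W p (2 * PI / INR (P * P) * INR k + (2 * PI + tau)))).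
  - generalize (Hone tau) (Hone (2 * PI + tau)); lra.
  - intros k _; f_equal; rewrite plus_INR.
    assert (0 < INR (P * P)) by (apply lt_0_INR; nia).
    field; lra.
Qed.

(** * Szego recursion along a chirp *)

(** The phase increment between consecutive coefficients: it advances by one turn every [P^2]
    indices, and [tau] carries the point of the circle. *)
Definition freq (P : nat) (tau : R) (n : nat) : R := 2 * PI / INR (P * P) * INR n + tau.

(** Here [a n] already contains the factor of modulus one coming from the point of the circle. The
    chirp [a] is prescribed for all indices, the recursion for [u] only inside the block. *)
Definition chirp_block (P : nat) (d tau : R) (a u : nat -> C) : Prop :=
  (forall n, Cmod (a n) = d / INR P) /\
  (forall n, a (S n) = (a n * circ (freq P tau n))%C) /\
  (forall n, (n < 2 * (P * P))%nat ->
     u (S n) = (RtoC (/ rho (a n)) * (u n - a n * Cconj (u n)))%C).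

(* [corrector] nearly solves [b (n+1) - b n = a n], so that [averaged] removes the
   first-order oscillation from [u]. *)
Definition corrector (P : nat) (tau : R) (a : nat -> C) (n : nat) : C :=
  (a n * G (INR P) (freq P tau n - 2 * PI / INR (P * P)))%C.

Definition averaged (P : nat) (tau : R) (a u : nat -> C) (n : nat) : C :=
  (u n + corrector P tau a n * Cconj (u n))%C.

(** The imaginary part of the second-order coefficient [- |a n|^2 e^(ix) G x], with [x] the
    frequency, that is, the rotation of [u] in one step. It is about [(d / P)^2 / x] for small [x]
    well above [1 / P]. *)
Definition drift (P : nat) (d tau : R) (n : nat) : R :=
  (d / INR P) ^ 2 * (sin (freq P tau n) * W (INR P) (freq P tau n)).

Definition Wpair (P : nat) (tau : R) (n : nat) : R :=
  W (INR P) (freq P tau n) + W (INR P) (freq P tau n - 2 * PI / INR (P * P)).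

(** The term [(d / P)^2] covers the real part of the second-order coefficient and the factor [rho];
    the cube covers drift times corrector and the square of the drift; the last coefficient covers
    the variation of [G] over one step (three times the spacing [2 PI / P^2], by [G_lipschitz]) and
    the defect [nu W] of the regularised inverse. *)
Definition err (P : nat) (d tau : R) (n : nat) : R :=
  (d / INR P) ^ 2
  + ((d / INR P) ^ 3 + d / INR P * (6 * PI / INR (P * P) + nu (INR P))) * Wpair P tau n.

Lemma INR_ge_2 (P : nat) : (2 <= P)%nat -> 2 <= INR P.
Proof. intros H; change 2 with (INR 2); now apply le_INR. Qed.

Lemma Wpair_pos (P : nat) (tau : R) (n : nat) : (2 <= P)%nat -> 0 < Wpair P tau n.
Proof.
  intros HP; apply INR_ge_2 in HP; unfold Wpair.
  generalize (W_pos (INR P) (freq P tau n) HP)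
    (W_pos (INR P) (freq P tau n - 2 * PI / INR (P * P)) HP); lra.
Qed.

Lemma err_ge (P : nat) (d tau : R) (n : nat) :
  (2 <= P)%nat -> 0 <= d ->
  (d / INR P) ^ 2 <= err P d tau n /\ (d / INR P) ^ 3 * Wpair P tau n <= err P d tau n /\
  0 <= err P d tau n.
Proof.
  intros HP Hd.
  assert (Hw := Wpair_pos P tau n HP); assert (Hp := INR_ge_2 P HP).
  assert (Hr : 0 <= d / INR P) by (apply Rdiv_le_0_compat; lra).
  assert (Hr3 : 0 <= (d / INR P) ^ 3) by now apply pow_le.
  assert (Hr2 := pow2_ge_0 (d / INR P)).
  assert (HP2 : 0 < INR (P * P)) by (apply lt_0_INR; nia).
  assert (Hk : 0 <= d / INR P * (6 * PI / INR (P * P) + nu (INR P))).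
  { apply Rmult_le_pos; [exact Hr|].
    apply Rplus_le_le_0_compat; [|generalize (nu_pos _ Hp); lra].
    apply Rdiv_le_0_compat; [generalize PI_RGT_0; lra | exact HP2]. }
  assert (0 <= (d / INR P) ^ 3 * Wpair P tau n) by (apply Rmult_le_pos; lra).
  assert (0 <= d / INR P * (6 * PI / INR (P * P) + nu (INR P)) * Wpair P tau n)
    by (apply Rmult_le_pos; lra).
  unfold err; lra.
Qed.

Lemma err_sum_le (P : nat) (d tau : R) :
  (2 <= P)%nat -> 0 <= d <= 1 -> rsum (err P d tau) (2 * (P * P)) <= 170 * d.
Proof.
  intros HP Hd; assert (Hp := INR_ge_2 P HP); unfold err.
  rewrite rsum_plus, rsum_const, rsum_scal.
  assert (HS : rsum (Wpair P tau) (2 * (P * P)) <= 6 * INR P ^ 3).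
  { unfold Wpair; rewrite rsum_plus.
    rewrite (rsum_ext (fun k => W (INR P) (freq P tau k - _))
       (fun k => W (INR P) (2 * PI / INR (P * P) * INR k + (tau - 2 * PI / INR (P * P)))))
      by (intros; unfold freq; f_equal; ring).
    generalize (W_sum_le P tau HP) (W_sum_le P (tau - 2 * PI / INR (P * P)) HP).
    unfold freq; lra. }
  rewrite mult_INR, mult_INR; simpl (INR 2); set (p := INR P) in *.
  assert (HP4 := PI_4); assert (HP0 := PI_RGT_0).
  assert (Hr : 0 <= d / p) by (apply Rdiv_le_0_compat; lra).
  assert (Hk : 0 <= (d / p) ^ 3 + d / p * (6 * PI / (p * p) + nu p)).
  { apply Rplus_le_le_0_compat; [now apply pow_le|].
    apply Rmult_le_pos; [exact Hr|].
    apply Rplus_le_le_0_compat; [|generalize (nu_pos _ Hp); lra].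
    apply Rdiv_le_0_compat; nra. }
  apply Rle_trans with ((1 + 1) * (p * p) * (d / p) ^ 2
     + ((d / p) ^ 3 + d / p * (6 * PI / (p * p) + nu p)) * (6 * p ^ 3)).
  { apply Rplus_le_compat_l, Rmult_le_compat_l; assumption. }
  unfold nu.
  (* As [Wpair] sums to at most [6 p^3], all powers of [p] cancel. With [PI <= 4] and
     [p / (p - 1) <= 2] the total is at most [(2 + 6 + 144 + 12) d]. *)
  replace ((1 + 1) * (p * p) * (d / p) ^ 2
     + ((d / p) ^ 3 + d / p * (6 * PI / (p * p) + / (p * (p - 1)))) * (6 * p ^ 3))
    with (2 * d * d + 6 * d * d * d + 36 * d * PI + 6 * d * (p / (p - 1))) by (field; lra).
  assert (Hpp : p / (p - 1) <= 2).
  { apply Rmult_le_reg_r with (p - 1); [lra|].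
    unfold Rdiv; rewrite Rmult_assoc, Rinv_l; lra. }
  assert (d * PI <= d * 4) by (apply Rmult_le_compat_l; lra).
  assert (d * (p / (p - 1)) <= d * 2) by (apply Rmult_le_compat_l; lra).
  assert (d * d <= d) by nra.
  assert (d * d * d <= d) by nra.
  lra.
Qed.

(** The regularisation caps [|G|] at [P], which the amplitude [d / P] compensates exactly. *)
Lemma corrector_le (P : nat) (d tau : R) (a u : nat -> C) (n : nat) :
  (2 <= P)%nat -> 0 <= d -> chirp_block P d tau a u -> Cmod (corrector P tau a n) <= d.
Proof.
  intros HP Hd [Ha _]; assert (Hp := INR_ge_2 P HP).
  unfold corrector; rewrite Cmod_mult, Ha; set (x := freq P tau n - _).
  assert (HG : Cmod (G (INR P) x) <= INR P).
  { apply Rsqr_incr_0_var; [|lra]; unfold Rsqr.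
    generalize (Cmod_G (INR P) x Hp) (W_le (INR P) x Hp); lra. }
  apply Rle_trans with (d / INR P * INR P).
  - apply Rmult_le_compat_l; [apply Rdiv_le_0_compat; lra | exact HG].
  - right; field; lra.
Qed.

(** The terms in the conjugate of [u n] cancel up to the variation of [G] and the defect [nu W]; the
    terms in [u n] reduce to [- |a n|^2 e^(ix) G x], with imaginary part [drift]. A share
    [(d / P)^3 Wpair] of [err] is left free, to pay later for replacing [u] by [averaged] in the
    drift term. *)
Lemma averaged_step (P : nat) (d tau : R) (a u : nat -> C) (n : nat) :
  (2 <= P)%nat -> 0 <= d < 1 -> chirp_block P d tau a u -> (n < 2 * (P * P))%nat ->
  Cmod (RtoC (rho (a n)) * averaged P tau a u (S n) - averaged P tau a u n
        - Ci * RtoC (drift P d tau n) * u n)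
  <= (err P d tau n - (d / INR P) ^ 3 * Wpair P tau n) * Cmod (u n).
Proof.
  intros HP Hd [Ha [Hs Hu]] Hn; assert (Hp := INR_ge_2 P HP).
  assert (HP2 : 0 < INR (P * P)) by (apply lt_0_INR; nia).
  set (th := 2 * PI / INR (P * P)).
  assert (Hth : 0 < th) by (apply Rdiv_lt_0_compat; [generalize PI_RGT_0; lra | exact HP2]).
  (* The corrector uses the preceding frequency, so its value at [n + 1] is [a n * circ x * G x]
     with the current [x]. *)
  assert (Hf : freq P tau (S n) - th = freq P tau n).
  { unfold freq; fold th; rewrite S_INR; ring. }
  set (r := d / INR P).
  assert (Hr : 0 <= r < 1).
  { split; [apply Rdiv_le_0_compat; lra|].
    unfold r; apply Rmult_lt_reg_r with (INR P); [lra|].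
    unfold Rdiv; rewrite Rmult_assoc, Rinv_l; lra. }
  assert (Har : Cmod (a n) = r) by apply Ha.
  assert (Hrho : rho (a n) <> 0) by (generalize (rho_pos (a n)); lra).
  assert (Hrho' := RtoC_neq_0 _ Hrho).
  set (x := freq P tau n) in *.
  set (w := W (INR P) x); set (w' := W (INR P) (x - th)).
  (* [- y] is the real part of the coefficient of [u n], and [e] the whole coefficient of its
     conjugate. *)
  set (y := r ^ 2 * ((1 - cos x) * w)).
  set (e := (a n * (G (INR P) x - G (INR P) (x - th) - RtoC (nu (INR P) * w)))%C).
  assert (Haa : (a n * Cconj (a n))%C = RtoC (r ^ 2)) by (rewrite <- Cmod2_conj, Har; reflexivity).
  assert (HG : (circ x * G (INR P) x)%C = ((1 - circ x) * RtoC w)%C).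
  { unfold G; fold w; rewrite <- Cconj_circ.
    transitivity ((circ x * Cconj (circ x) - circ x) * RtoC w)%C; [ring|].
    now rewrite circ_conj_r. }
  assert (HG2 : ((circ x - 1) * G (INR P) x)%C = (1 - RtoC (nu (INR P) * w))%C).
  { transitivity (circ x * G (INR P) x - G (INR P) x)%C; [ring|]; rewrite HG.
    unfold G; fold w; rewrite <- Cconj_circ.
    assert (M := W_mul (INR P) x Hp); fold w in M.
    unfold circ, Cconj, Cmult, Cminus, Cplus, Copp, RtoC; simpl.
    f_equal; [nra | ring]. }
  assert (E : (RtoC (rho (a n)) * averaged P tau a u (S n) - averaged P tau a u n
        - Ci * RtoC (drift P d tau n) * u n)%C = (e * Cconj (u n) - RtoC y * u n)%C).
  { unfold averaged, corrector; fold th; rewrite Hf; fold x.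
    rewrite Hu, Hs by exact Hn; fold x.
    rewrite Cmult_conj, Cminus_conj, Cmult_conj, Cconj_conj, RtoC_conj, RtoC_inv by exact Hrho.
    transitivity (u n - a n * Cconj (u n) + a n * (circ x * G (INR P) x) * Cconj (u n)
        - (a n * Cconj (a n)) * (circ x * G (INR P) x) * u n
        - (u n + a n * G (INR P) (x - th) * Cconj (u n))
        - Ci * RtoC (drift P d tau n) * u n)%C.
    { field; exact Hrho'. }
    replace (a n * (circ x * G (INR P) x) * Cconj (u n))%C
      with (a n * ((circ x - 1) * G (INR P) x + G (INR P) x) * Cconj (u n))%C by ring.
    rewrite HG2, Haa, HG.
    assert (Ey : (RtoC (r ^ 2) * ((1 - circ x) * RtoC w))%C = (RtoC y - Ci * RtoC (drift P d tau n))%C).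
    { unfold drift; fold r x w; unfold y, circ, Ci, Cmult, Cminus, Cplus, Copp, RtoC; simpl.
      f_equal; ring. }
    rewrite Ey; unfold e; ring. }
  rewrite E; eapply Rle_trans; [apply Cmod_sub_le|].
  rewrite !Cmod_mult, Cmod_conj, Cmod_R.
  rewrite <- Rmult_plus_distr_r; apply Rmult_le_compat_r; [apply Cmod_ge_0|].
  assert (Hw := W_pos (INR P) x Hp); fold w in Hw.
  assert (Hw' := W_pos (INR P) (x - th) Hp); fold w' in Hw'.
  assert (Hnu := nu_pos (INR P) Hp).
  assert (Hy : Rabs y <= r ^ 2).
  { assert (B := W_one_minus_cos (INR P) x Hp); fold w in B.
    unfold y; rewrite Rabs_pos_eq; generalize (pow2_ge_0 r); nra. }
  assert (He : Cmod e <= r * (3 * th + nu (INR P)) * (w + w')).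
  { unfold e; rewrite Cmod_mult, Har, Rmult_assoc; apply Rmult_le_compat_l; [lra|].
    eapply Rle_trans; [apply Cmod_sub_le|].
    rewrite Cmod_R, Rabs_pos_eq by nra.
    assert (L := G_lipschitz (INR P) x th Hp); rewrite (Rabs_pos_eq th) in L by lra.
    fold w w' in L; nra. }
  replace (err P d tau n - r ^ 3 * Wpair P tau n)
    with (r * (3 * th + nu (INR P)) * (w + w') + r ^ 2).
  { lra. }
  unfold err, Wpair; fold r th x w w'; unfold th; field; lra.
Qed.

(** Multiplication by [1 + i drift] changes the modulus only through the square of the drift; since
    [(d / P)^4 <= (d / P)^3], this square fits into [err]. *)
Lemma drift_sqr_le (P : nat) (d tau : R) (n : nat) :
  (2 <= P)%nat -> 0 <= d <= 1 ->
  drift P d tau n ^ 2 <= (d / INR P) ^ 3 * Wpair P tau n.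
Proof.
  intros HP Hd; assert (Hp := INR_ge_2 P HP).
  unfold drift; rewrite Rpow_mult_distr.
  assert (Hr : 0 <= d / INR P <= 1).
  { split; [apply Rdiv_le_0_compat; lra|].
    apply Rmult_le_reg_r with (INR P); [lra|].
    unfold Rdiv; rewrite Rmult_assoc, Rinv_l; lra. }
  set (r := d / INR P) in *.
  assert (H := sin_W_sqr (INR P) (freq P tau n) Hp).
  assert (Hr3 : 0 <= r ^ 3) by (apply pow_le; lra).
  assert (Hr4 : (r ^ 2) ^ 2 <= r ^ 3).
  { replace ((r ^ 2) ^ 2) with (r ^ 3 * r) by ring; nra. }
  apply Rle_trans with (r ^ 3 * W (INR P) (freq P tau n)).
  - apply Rmult_le_compat; try assumption; apply pow2_ge_0.
  - apply Rmult_le_compat_l; [exact Hr3|]; unfold Wpair.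
    generalize (W_pos (INR P) (freq P tau n - 2 * PI / INR (P * P)) Hp); lra.
Qed.

Lemma drift_corrector_le (P : nat) (d tau : R) (a u : nat -> C) (n : nat) :
  (2 <= P)%nat -> 0 <= d -> chirp_block P d tau a u ->
  Rabs (drift P d tau n) * Cmod (corrector P tau a n) <= (d / INR P) ^ 3 * Wpair P tau n.
Proof.
  intros HP Hd [Ha _]; assert (Hp := INR_ge_2 P HP).
  unfold drift, corrector, Wpair; rewrite Cmod_mult, Ha, Rabs_mult.
  set (r := d / INR P).
  assert (Hr : 0 <= r) by (apply Rdiv_le_0_compat; lra).
  rewrite (Rabs_pos_eq (r ^ 2)) by apply pow2_ge_0.
  set (x := freq P tau n); set (x' := x - _).
  assert (H1 := sin_W_sqr (INR P) x Hp); rewrite <- pow2_abs in H1.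
  assert (H2 := Cmod_G (INR P) x' Hp).
  set (A := Rabs _) in *; set (B := Cmod _) in *.
  (* The two squares are at most [W] at neighbouring frequencies, which is why [Wpair] adds both
     values. *)
  assert (AB : A * B <= W (INR P) x + W (INR P) x').
  { generalize (pow2_ge_0 (A - B)) (pow2_ge_0 (A + B)); nra. }
  replace (r ^ 2 * A * (r * B)) with (r ^ 3 * (A * B)) by ring.
  apply Rmult_le_compat_l; [now apply pow_le | exact AB].
Qed.

(** * Modulus along one block *)

Lemma inv_rho_le (a : C) : Cmod a ^ 2 <= / 2 -> / rho a <= 1 + Cmod a ^ 2.
Proof.
  intros H.
  assert (H1 : Cmod a < 1) by (generalize (Cmod_ge_0 a); nra).
  assert (Hr := rho_pos a H1); assert (Hq := rho_sqr a H1).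
  set (s := Cmod a ^ 2) in *.
  assert (Hs : 0 <= s) by apply pow2_ge_0.
  apply Rmult_le_reg_l with (rho a); [exact Hr|]; rewrite Rinv_r by lra.
  apply Rsqr_incr_0_var; [|nra]; unfold Rsqr.
  replace (rho a * (1 + s) * (rho a * (1 + s))) with (rho a ^ 2 * (1 + s) ^ 2) by ring.
  rewrite Hq; nra.
Qed.

Lemma one_minus_rho_le (a : C) : Cmod a < 1 -> 0 <= 1 - rho a <= Cmod a ^ 2.
Proof.
  intros H1; assert (Hr := rho_pos a H1); assert (Hq := rho_sqr a H1).
  assert (Hl := rho_le_1 a); nra.
Qed.

Lemma exp_neg_4_le (x : R) : 0 <= x <= / 4 -> exp (- (4 * x)) <= 1 - 2 * x.
Proof.
  intros Hx; rewrite exp_Ropp.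
  assert (H : 1 + 4 * x <= exp (4 * x)) by apply exp_ineq1_le.
  apply Rle_trans with (/ (1 + 4 * x)).
  - apply Rinv_le_contravar; lra.
  - apply Rmult_le_reg_l with (1 + 4 * x); [lra|]; rewrite Rinv_r by lra; nra.
Qed.

Lemma Cmod_one_plus_Ci (x : R) : 1 <= Cmod (1 + Ci * RtoC x) <= 1 + x ^ 2.
Proof.
  assert (E : Cmod (1 + Ci * RtoC x) ^ 2 = 1 + x ^ 2).
  { rewrite Cmod_sqr; unfold Ci, RtoC; simpl; ring. }
  assert (P := Cmod_ge_0 (1 + Ci * RtoC x)).
  assert (Q := pow2_ge_0 x); split.
  - apply Rsqr_incr_0_var; [unfold Rsqr; nra | exact P].
  - apply Rsqr_incr_0_var; [unfold Rsqr; nra | lra].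
Qed.

Lemma averaged_comparable (P : nat) (d tau : R) (a u : nat -> C) (n : nat) :
  (2 <= P)%nat -> 0 <= d <= 1 -> chirp_block P d tau a u ->
  (1 - d) * Cmod (u n) <= Cmod (averaged P tau a u n) <= (1 + d) * Cmod (u n).
Proof.
  intros HP Hd Hb; assert (Hc := corrector_le P d tau a u n HP ltac:(lra) Hb).
  unfold averaged; set (b := corrector P tau a n) in *.
  assert (Hm : Cmod (b * Cconj (u n)) <= d * Cmod (u n)).
  { rewrite Cmod_mult, Cmod_conj; apply Rmult_le_compat_r; [apply Cmod_ge_0 | exact Hc]. }
  split.
  - generalize (Cmod_triangle (u n + b * Cconj (u n)) (- (b * Cconj (u n)))); rewrite Cmod_opp.
    replace (u n + b * Cconj (u n) + - (b * Cconj (u n)))%C with (u n) by ring; lra.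
  - generalize (Cmod_triangle (u n) (b * Cconj (u n))); lra.
Qed.

(** Up to a relative error [2 err], [rho] times the next value is [1 + i drift] times the current
    one. The sum of the drift may be large, but being purely imaginary it leaves no first-order
    trace in the modulus. *)
Lemma averaged_growth (P : nat) (d tau : R) (a u : nat -> C) (n : nat) :
  (2 <= P)%nat -> 0 <= d <= / 1000 -> chirp_block P d tau a u -> (n <= 2 * (P * P))%nat ->
  exp (- (4 * rsum (err P d tau) n)) * Cmod (averaged P tau a u 0) <= Cmod (averaged P tau a u n)
  <= exp (4 * rsum (err P d tau) n) * Cmod (averaged P tau a u 0).
Proof.
  intros HP Hd Hb; induction n as [|n IH]; intros Hn.
  { simpl; rewrite Rmult_0_r, Ropp_0, exp_0; lra. }
  specialize (IH ltac:(lia)).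
  destruct (err_ge P d tau n HP ltac:(lra)) as [Er2 [Er3 Er0]].
  (* One error is at most the whole sum, hence at most [170 / 1000]; [exp_neg_4_le] requires 1/4. *)
  assert (Etot : err P d tau n <= / 4).
  { assert (H := err_sum_le P d tau HP ltac:(lra)).
    assert (M : rsum (err P d tau) n + err P d tau n <= rsum (err P d tau) (2 * (P * P)))
      by exact (rsum_mono (err P d tau) (S n) (2 * (P * P))
       (fun k => proj2 (proj2 (err_ge P d tau k HP ltac:(lra)))) Hn).
    assert (M0 := rsum_nonneg (err P d tau) n
       (fun k => proj2 (proj2 (err_ge P d tau k HP ltac:(lra))))).
    lra. }
  assert (S1 := averaged_step P d tau a u n HP ltac:(lra) Hb ltac:(lia)).
  assert (C1 := averaged_comparable P d tau a u n HP ltac:(lra) Hb).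
  assert (DC := drift_corrector_le P d tau a u n HP ltac:(lra) Hb).
  assert (DS := drift_sqr_le P d tau n HP ltac:(lra)).
  assert (Har : Cmod (a n) = d / INR P) by apply Hb.
  assert (Hp := INR_ge_2 P HP).
  assert (Hr : 0 <= d / INR P <= / 2).
  { split; [apply Rdiv_le_0_compat; lra|].
    apply Rmult_le_reg_r with (INR P); [lra|].
    unfold Rdiv; rewrite Rmult_assoc, Rinv_l; lra. }
  assert (Hr1 : Cmod (a n) < 1) by lra.
  assert (Hrho := rho_pos _ Hr1); assert (Hrho1 := rho_le_1 (a n)).
  assert (Hinv := inv_rho_le (a n) ltac:(rewrite Har; nra)); rewrite Har in Hinv.
  set (e := err P d tau n) in *; set (x := drift P d tau n) in *.
  set (v := averaged P tau a u n) in *; set (v' := averaged P tau a u (S n)) in *.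
  set (b := corrector P tau a n) in *.
  assert (Hu0 := Cmod_ge_0 (u n)); assert (Hv0 := Cmod_ge_0 v).
  (* Passing from [u n] to [v] in the drift term costs drift times corrector, the share of [err]
     that [averaged_step] left free. *)
  assert (D1 : Cmod (RtoC (rho (a n)) * v' - (1 + Ci * RtoC x) * v) <= e * Cmod (u n)).
  { replace (RtoC (rho (a n)) * v' - (1 + Ci * RtoC x) * v)%C
      with ((RtoC (rho (a n)) * v' - v - Ci * RtoC x * u n) - Ci * RtoC x * (b * Cconj (u n)))%C
      by (unfold v, averaged; fold b; ring).
    eapply Rle_trans; [apply Cmod_sub_le|].
    replace (Cmod (Ci * RtoC x * (b * Cconj (u n)))) with (Rabs x * Cmod b * Cmod (u n))
      by (rewrite !Cmod_mult, Cmod_Ci, Cmod_R, Cmod_conj; ring).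
    apply Rmult_le_compat_r with (r := Cmod (u n)) in DC; [lra | exact Hu0]. }
  assert (D2 : Cmod (RtoC (rho (a n)) * v' - (1 + Ci * RtoC x) * v) <= 2 * e * Cmod v).
  { apply Rle_trans with (1 := D1).
    assert (Cmod (u n) <= 2 * Cmod v) by nra.
    replace (2 * e * Cmod v) with (e * (2 * Cmod v)) by ring.
    apply Rmult_le_compat_l; assumption. }
  assert (B := Cmod_one_plus_Ci x).
  assert (Ev : Cmod (RtoC (rho (a n)) * v') = rho (a n) * Cmod v')
    by (rewrite Cmod_mult, Cmod_R, Rabs_pos_eq; lra).
  assert (Ev2 : Cmod ((1 + Ci * RtoC x) * v) = Cmod (1 + Ci * RtoC x) * Cmod v) by apply Cmod_mult.
  assert (T1 := Cmod_triangle_rev (RtoC (rho (a n)) * v') ((1 + Ci * RtoC x) * v)).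
  assert (T2 := Cmod_triangle_rev ((1 + Ci * RtoC x) * v) (RtoC (rho (a n)) * v')).
  rewrite Cmod_sub_sym in T2; rewrite Ev, Ev2 in T1, T2.
  assert (Hv'0 := Cmod_ge_0 v').
  simpl rsum; fold e; set (s := rsum _ n) in *.
  rewrite !Rmult_plus_distr_l, Ropp_plus_distr, !exp_plus; split.
  - apply Rle_trans with ((1 - 2 * e) * Cmod v).
    + assert (X := exp_neg_4_le e ltac:(lra)).
      apply Rle_trans with (exp (- (4 * e)) * Cmod v).
      * replace (exp (- (4 * s)) * exp (- (4 * e)) * Cmod (averaged P tau a u 0))
          with (exp (- (4 * e)) * (exp (- (4 * s)) * Cmod (averaged P tau a u 0))) by ring.
        apply Rmult_le_compat_l; [left; apply exp_pos | apply IH].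
      * apply Rmult_le_compat_r; assumption.
    + nra.
  - assert (U1 : rho (a n) * Cmod v' <= (1 + 3 * e) * Cmod v) by nra.
    assert (U2 : Cmod v' <= (1 + e) * ((1 + 3 * e) * Cmod v)).
    { replace (Cmod v') with (/ rho (a n) * (rho (a n) * Cmod v')) by (field; lra).
      apply Rmult_le_compat.
      - left; now apply Rinv_0_lt_compat.
      - nra.
      - lra.
      - exact U1. }
    apply Rle_trans with (1 := U2).
    replace (exp (4 * s) * exp (4 * e) * Cmod (averaged P tau a u 0))
      with (exp (4 * e) * (exp (4 * s) * Cmod (averaged P tau a u 0))) by ring.
    assert (X1 := exp_ineq1_le e); assert (X2 := exp_ineq1_le (3 * e)).
    apply Rle_trans with (exp (4 * e) * Cmod v).
    + replace (4 * e) with (e + 3 * e) by ring; rewrite exp_plus, <- Rmult_assoc.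
      apply Rmult_le_compat_r; [exact Hv0|].
      apply Rmult_le_compat; lra.
    + apply Rmult_le_compat_l; [left; apply exp_pos | apply IH].
Qed.

Lemma chirp_modulus (P : nat) (d tau : R) (a u : nat -> C) (n : nat) :
  (2 <= P)%nat -> 0 <= d <= / 1000 -> chirp_block P d tau a u -> (n <= 2 * (P * P))%nat ->
  exp (- (700 * d)) * Cmod (u O) <= Cmod (u n) <= exp (700 * d) * Cmod (u O).
Proof.
  intros HP Hd Hb Hn.
  assert (Gr := averaged_growth P d tau a u n HP Hd Hb Hn).
  assert (C0 := averaged_comparable P d tau a u 0 HP ltac:(lra) Hb).
  assert (C1 := averaged_comparable P d tau a u n HP ltac:(lra) Hb).
  assert (ES := err_sum_le P d tau HP ltac:(lra)).
  assert (Hpos : forall k, 0 <= err P d tau k) by (intros k; apply err_ge; [assumption | lra]).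
  assert (EM := rsum_mono (err P d tau) n (2 * (P * P)) Hpos Hn).
  set (s := rsum (err P d tau) n) in *.
  assert (U0 := Cmod_ge_0 (u O)); assert (Un := Cmod_ge_0 (u n)).
  (* [680 = 4 * 170] comes from the growth of [averaged], and a further 4 pays for exchanging [u]
     and [averaged] at both ends; 700 leaves some slack. *)
  assert (X1 : exp (4 * s) <= exp (680 * d)).
  { destruct (Rle_lt_or_eq_dec (4 * s) (680 * d)) as [L | ->]; [lra | left; now apply exp_increasing | lra]. }
  assert (X2 : exp (- (680 * d)) <= exp (- (4 * s))).
  { rewrite !exp_Ropp; apply Rinv_le_contravar; [apply exp_pos | exact X1]. }
  assert (Y1 : 1 + d <= exp (4 * d) * (1 - d)).
  { generalize (exp_ineq1_le (4 * d)); nra. }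
  assert (P1 := exp_pos (680 * d)); assert (P2 := exp_pos (- (680 * d))).
  assert (P3 := exp_pos (4 * d)); assert (P4 := exp_pos (- (4 * d))).
  assert (I1 : exp (4 * d) * exp (- (4 * d)) = 1)
    by (rewrite <- exp_plus, <- exp_0; f_equal; ring).
  assert (Z1 : exp (- (700 * d)) <= exp (- (680 * d)) * exp (- (4 * d))).
  { rewrite <- exp_plus.
    destruct (Req_dec d 0) as [-> | Hd0]; [right; f_equal; ring|].
    left; apply exp_increasing; lra. }
  assert (Z2 : exp (680 * d) * exp (4 * d) <= exp (700 * d)).
  { rewrite <- exp_plus.
    destruct (Req_dec d 0) as [-> | Hd0]; [right; f_equal; ring|].
    left; apply exp_increasing; lra. }
  set (E := exp (680 * d)) in *; set (E' := exp (- (680 * d))) in *.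
  set (F := exp (4 * d)) in *; set (F' := exp (- (4 * d))) in *.
  split.
  - apply Rle_trans with (E' * F' * Cmod (u O)); [apply Rmult_le_compat_r; assumption|].
    assert (L1 : E' * ((1 - d) * Cmod (u O)) <= (1 + d) * Cmod (u n)).
    { apply Rle_trans with (E' * Cmod (averaged P tau a u 0)).
      - apply Rmult_le_compat_l; lra.
      - apply Rle_trans with (exp (- (4 * s)) * Cmod (averaged P tau a u 0)); [|lra].
        apply Rmult_le_compat_r; [apply Cmod_ge_0 | exact X2]. }
    assert (L2 : F' * (1 + d) <= 1 - d).
    { apply Rle_trans with (F' * (F * (1 - d))).
      - apply Rmult_le_compat_l; lra.
      - right; transitivity (F * F' * (1 - d)); [ring | rewrite I1; ring]. }
    apply Rmult_le_reg_l with (1 + d); [lra|].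
    apply Rle_trans with (2 := L1).
    replace ((1 + d) * (E' * F' * Cmod (u O))) with (E' * ((F' * (1 + d)) * Cmod (u O))) by ring.
    apply Rmult_le_compat_l; [lra|]; apply Rmult_le_compat_r; assumption.
  - apply Rle_trans with (E * F * Cmod (u O)); [|apply Rmult_le_compat_r; assumption].
    assert (L1 : (1 - d) * Cmod (u n) <= E * ((1 + d) * Cmod (u O))).
    { apply Rle_trans with (E * Cmod (averaged P tau a u 0)).
      - apply Rle_trans with (exp (4 * s) * Cmod (averaged P tau a u 0)); [lra|].
        apply Rmult_le_compat_r; [apply Cmod_ge_0 | exact X1].
      - apply Rmult_le_compat_l; lra. }
    apply Rmult_le_reg_l with (1 - d); [lra|].
    apply Rle_trans with (1 := L1).
    replace ((1 - d) * (E * F * Cmod (u O))) with (E * (F * (1 - d) * Cmod (u O))) by ring.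
    apply Rmult_le_compat_l; [lra|]; apply Rmult_le_compat_r; assumption.
Qed.

(** * Rotation after the stationary point *)

(** Frequencies are spaced by [2 pi / P^2], so among the first [P^2] of them one lies less than one
    spacing above a multiple of [2 pi]. The bound [n0 < P^2] keeps the second turn of the block
    available after it. *)
Lemma freq_resonance (P : nat) (tau : R) :
  (2 <= P)%nat ->
  exists (n0 : nat) (z : Z) (s : R), (n0 < P * P)%nat /\ 0 <= s < 1 /\
    forall e, freq P tau (n0 + e) = 2 * PI / INR (P * P) * (INR e + s) + 2 * PI * IZR z.
Proof.
  intros HP.
  assert (HN : 0 < INR (P * P)) by (apply lt_0_INR; nia).
  assert (HP0 := PI_RGT_0).
  set (N := (P * P)%nat) in *; set (y := tau / (2 * PI / INR N)).
  (* [y] is [tau] in units of the spacing and [c + y] lies in [[0, 1)]; reducing [c] modulo [P^2]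
     gives the index, the quotient gives the number of turns. *)
  set (c := (1 - up y)%Z).
  assert (HNZ : (0 < Z.of_nat N)%Z) by (unfold N; nia).
  assert (Hm := Z.mod_pos_bound c (Z.of_nat N) HNZ).
  assert (Hd := Z.div_mod c (Z.of_nat N) ltac:(lia)).
  exists (Z.to_nat (c mod Z.of_nat N)), (- (c / Z.of_nat N))%Z, (IZR c + y).
  split; [lia|]; split.
  { unfold c; rewrite minus_IZR; generalize (archimed y); lra. }
  intros e; unfold freq; fold N.
  assert (E : INR (Z.to_nat (c mod Z.of_nat N)) = IZR c - INR N * IZR (c / Z.of_nat N)).
  { rewrite INR_IZR_INZ, Z2Nat.id by lia; rewrite Hd at 2.
    rewrite plus_IZR, mult_IZR, <- INR_IZR_INZ; ring. }
  rewrite plus_INR, E, opp_IZR; unfold y; field; lra.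
Qed.

Lemma sin_ge_half (y : R) : 0 <= y <= 1 -> y / 2 <= sin y.
Proof.
  intros [[Hy | <-] Hy1]; [|rewrite sin_0; lra].
  destruct (MVT_cor2 sin cos 0 y Hy) as [c [E Hc]].
  { intros; apply derivable_pt_lim_sin. }
  rewrite sin_0 in E; generalize (two_minus_2cos_le c); nra.
Qed.

(** At [e] steps past the resonance the reduced frequency is [y = 2 pi (e + s) / P^2]. The bound
    [P <= e] gives [y P >= 2], so that [nu] is dominated by [y^2]; the bound [8 (e + 1) <= P^2]
    gives [y <= 1], so that [sin y >= y / 2]. Then [sin y * W] is at least [1 / (4 y)]. *)
Lemma drift_ge (P : nat) (d tau : R) (n e : nat) (z : Z) (s : R) :
  (2 <= P)%nat -> (P <= e)%nat -> (8 * (e + 1) <= P * P)%nat -> 0 <= s < 1 ->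
  freq P tau n = 2 * PI / INR (P * P) * (INR e + s) + 2 * PI * IZR z ->
  d ^ 2 / 32 * / (INR e + 1) <= drift P d tau n.
Proof.
  intros HP He1 He2 Hs Hf; assert (Hp := INR_ge_2 P HP).
  assert (HP0 := PI_RGT_0); assert (HP4 := PI_4); assert (HP21 := PI2_1).
  apply le_INR in He1, He2; rewrite !mult_INR, plus_INR in He2; simpl (INR 1) in He2.
  replace (INR 8) with 8 in He2 by (simpl; lra).
  set (y := 2 * PI / INR (P * P) * (INR e + s)) in *.
  assert (Ec : circ (freq P tau n) = circ y) by (rewrite Hf; apply circ_period).
  assert (Ecos : cos (freq P tau n) = cos y) by (injection Ec; auto).
  assert (Esin : sin (freq P tau n) = sin y) by (injection Ec; auto).
  unfold drift, W; rewrite Ecos, Esin.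
  set (p := INR P) in *.
  assert (Hp2 : 0 < p * p) by nra.
  assert (Hy : y * (p * p) = 2 * PI * (INR e + s)) by (unfold y; rewrite mult_INR; fold p; field; lra).
  assert (Hy1 : y <= 1).
  { apply Rmult_le_reg_r with (p * p); [exact Hp2|]; rewrite Hy; nra. }
  assert (Hy2 : 2 <= y * p).
  { apply Rmult_le_reg_r with p; [lra|]; rewrite Rmult_assoc, Hy; nra. }
  assert (Hy0 : 0 < y) by nra.
  assert (Hnu : nu p <= y ^ 2).
  { unfold nu; apply Rmult_le_reg_l with (p * (p - 1)); [nra|]; rewrite Rinv_r by nra.
    assert (4 <= (y * p) * (y * p)) by nra.
    replace (p * (p - 1) * y ^ 2) with ((y * p) * (y * p) * ((p - 1) / p)) by (field; lra).
    assert (/ 2 <= (p - 1) / p).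
    { apply Rmult_le_reg_r with p; [lra|]; unfold Rdiv; rewrite Rmult_assoc, Rinv_l; lra. }
    nra. }
  assert (Hnu0 := nu_pos p Hp).
  assert (Hden : / (2 * y ^ 2) <= / (2 - 2 * cos y + nu p)).
  { apply Rinv_le_contravar.
    - generalize (COS_bound y); lra.
    - generalize (two_minus_2cos_le y); lra. }
  assert (Hsin := sin_ge_half y ltac:(lra)).
  assert (Hq : / (4 * y) <= sin y * / (2 - 2 * cos y + nu p)).
  { apply Rle_trans with (y / 2 * / (2 * y ^ 2)).
    - right; field; lra.
    - apply Rmult_le_compat; try lra.
      left; apply Rinv_0_lt_compat; nra. }
  apply Rle_trans with ((d / p) ^ 2 * / (4 * y)).
  2:{ apply Rmult_le_compat_l; [apply pow2_ge_0 | exact Hq]. }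
  (* The constant 32 is 4 times the bound [2 PI <= 8]. *)
  assert (Hy3 : 4 * y <= 32 * (INR e + 1) / (p * p)).
  { apply Rmult_le_reg_r with (p * p); [exact Hp2|].
    replace (32 * (INR e + 1) / (p * p) * (p * p)) with (32 * (INR e + 1)) by (field; lra).
    rewrite Rmult_assoc, Hy; nra. }
  apply Rle_trans with ((d / p) ^ 2 * / (32 * (INR e + 1) / (p * p))).
  - right; field; repeat split; try lra; nra.
  - apply Rmult_le_compat_l; [apply pow2_ge_0|].
    apply Rinv_le_contravar; [lra | exact Hy3].
Qed.

(** The one-step estimate is summed with [u n] frozen at [u m], so that all rotations push in the
    same direction [i u m]. Near-constancy of [u] is the assumption to be refuted in
    [chirp_oscillation]; freezing costs a tenth of the drift. *)
Lemma averaged_drift (P : nat) (d tau : R) (a u : nat -> C) (m l : nat) :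
  (2 <= P)%nat -> 0 <= d <= / 1000 -> chirp_block P d tau a u ->
  (m + l <= 2 * (P * P))%nat ->
  (forall n, (n <= 2 * (P * P))%nat -> Cmod (u n) <= 2) ->
  (forall n k, (n <= 2 * (P * P))%nat -> (k <= 2 * (P * P))%nat -> Cmod (u n - u k) <= / 10) ->
  (forall j, (j < l)%nat -> 0 <= drift P d tau (m + j)) ->
  Cmod (averaged P tau a u (m + l) - averaged P tau a u m
        - Ci * RtoC (rsum (fun j => drift P d tau (m + j)) l) * u m)
  <= rsum (fun j => 5 * err P d tau (m + j) + / 10 * drift P d tau (m + j)) l.
Proof.
  intros HP Hd Hb Hl Hu Hc Hx; induction l as [|l IH].
  { simpl; rewrite Nat.add_0_r.
    replace (_ - _ - _)%C with (RtoC 0) by ring; rewrite Cmod_0; lra. }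
  specialize (IH ltac:(lia) ltac:(intros; apply Hx; lia)).
  rewrite Nat.add_succ_r; simpl rsum; rewrite RtoC_plus.
  assert (Hn : (m + l < 2 * (P * P))%nat) by lia.
  assert (Hxn := Hx l ltac:(lia)).
  set (n := (m + l)%nat) in *.
  assert (S1 := averaged_step P d tau a u n HP ltac:(lra) Hb Hn).
  destruct (err_ge P d tau n HP ltac:(lra)) as [Er2 [Er3 Er0]].
  assert (Hp := INR_ge_2 P HP).
  assert (Har : Cmod (a n) = d / INR P) by apply Hb.
  assert (Hr : 0 <= d / INR P <= / 2).
  { split; [apply Rdiv_le_0_compat; lra|].
    apply Rmult_le_reg_r with (INR P); [lra|].
    unfold Rdiv; rewrite Rmult_assoc, Rinv_l; lra. }
  assert (Hrho := one_minus_rho_le (a n) ltac:(lra)); rewrite Har in Hrho.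
  assert (C1 := averaged_comparable P d tau a u (S n) HP ltac:(lra) Hb).
  assert (Hu1 := Hu n ltac:(lia)); assert (Hu2 := Hu (S n) ltac:(lia)).
  assert (Hcm := Hc n m ltac:(lia) ltac:(lia)).
  set (v' := averaged P tau a u (S n)) in *; set (v := averaged P tau a u n) in *.
  set (x := drift P d tau n) in *; set (X := rsum _ l) in *.
  set (e := err P d tau n) in *; set (vm := averaged P tau a u m) in *.
  replace (v' - vm - Ci * (RtoC X + RtoC x) * u m)%C
    with ((v - vm - Ci * RtoC X * u m)
          + ((RtoC (rho (a n)) * v' - v - Ci * RtoC x * u n)
             + (RtoC (1 - rho (a n)) * v' + Ci * RtoC x * (u n - u m))))%C
    by (rewrite RtoC_minus; ring).
  eapply Rle_trans; [apply Cmod_triangle|]; apply Rplus_le_compat; [exact IH|].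
  eapply Rle_trans; [apply Cmod_triangle|].
  eapply Rle_trans; [apply Rplus_le_compat_l, Cmod_triangle|].
  rewrite !Cmod_mult, Cmod_Ci, !Cmod_R, Rmult_1_l, !Rabs_pos_eq by lra.
  assert (Hun := Cmod_ge_0 (u n)); assert (Hun' := Cmod_ge_0 (u (S n))).
  assert (Hv' := Cmod_ge_0 v').
  (* The constant 5 is 2, from [|u| <= 2], plus 3, from removing the factor [rho] in front of
     [v']. *)
  assert (T1 : Cmod (RtoC (rho (a n)) * v' - v - Ci * RtoC x * u n) <= 2 * e).
  { apply Rle_trans with (1 := S1).
    assert (0 < Wpair P tau n) by now apply Wpair_pos.
    assert (0 <= (d / INR P) ^ 3) by (apply pow_le; lra).
    assert (0 <= (d / INR P) ^ 3 * Wpair P tau n) by (apply Rmult_le_pos; lra).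
    apply Rle_trans with (e * Cmod (u n)); [apply Rmult_le_compat_r; lra | nra]. }
  assert (T2 : (1 - rho (a n)) * Cmod v' <= 3 * e).
  { assert (Cmod v' <= 3) by nra.
    apply Rle_trans with ((d / INR P) ^ 2 * 3); [apply Rmult_le_compat; lra | lra]. }
  assert (T3 : x * Cmod (u n - u m) <= / 10 * x).
  { rewrite (Rmult_comm (/ 10)); apply Rmult_le_compat_l; assumption. }
  lra.
Qed.

(** If [u] moved by at most 1/10, the accumulated drift [X >= 1] would displace [averaged] by at
    least [3/4 X - X/10 - 850 d], whereas [averaged] stays within [2 d] of [u] and so moves by at
    most [1/10 + 4 d]. *)
Lemma chirp_oscillation (k : nat) (d tau : R) (a u : nat -> C) :
  (4 <= k)%nat -> 0 < d <= / 100000 -> 64 <= INR (k - 3) * d ^ 2 ->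
  chirp_block (2 ^ k) d tau a u ->
  (forall n, (n <= 2 * (2 ^ k * 2 ^ k))%nat -> 3 / 4 <= Cmod (u n) <= 2) ->
  exists n m, (n <= 2 * (2 ^ k * 2 ^ k))%nat /\ (m <= 2 * (2 ^ k * 2 ^ k))%nat /\
    / 10 < Cmod (u n - u m).
Proof.
  intros Hk Hd Hbig Hb Hu.
  apply NNPP; intros Hno.
  assert (Hc : forall n m, (n <= 2 * (2 ^ k * 2 ^ k))%nat -> (m <= 2 * (2 ^ k * 2 ^ k))%nat ->
                 Cmod (u n - u m) <= / 10).
  { intros n m Hn Hm; apply Rnot_lt_le; intros H; apply Hno; now exists n, m. }
  clear Hno.
  assert (E3 : (2 ^ k = 8 * 2 ^ (k - 3))%nat)
    by (replace k with (3 + (k - 3))%nat at 1 by lia; rewrite Nat.pow_add_r; reflexivity).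
  assert (H2 : (2 <= 2 ^ (k - 3))%nat)
    by (change 2%nat with (2 ^ 1)%nat at 1; apply Nat.pow_le_mono_r; lia).
  assert (HP : (2 <= 2 ^ k)%nat) by lia.
  destruct (freq_resonance (2 ^ k) tau HP) as [n0 [z [s [Hn0 [Hs Hf]]]]].
  (* With [P = 2^k], the window starts [P] indices after the resonance, past the zone governed by
     [nu], and ends at distance [P^2 / 8], as [drift_ge] demands. *)
  set (m := (n0 + 2 ^ k)%nat).
  set (l := (2 ^ k * (2 ^ (k - 3) - 1))%nat).
  assert (Hl : (8 * (2 ^ k + l) = 2 ^ k * 2 ^ k)%nat) by (unfold l; nia).
  assert (Hml : (m + l <= 2 * (2 ^ k * 2 ^ k))%nat) by (unfold m; lia).
  assert (Hge : forall j, (j < l)%nat ->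
     d ^ 2 / 32 * / (INR (2 ^ k) + INR j + 1) <= drift (2 ^ k) d tau (m + j)).
  { intros j Hj; rewrite <- plus_INR.
    apply drift_ge with z s; try assumption; try lia.
    unfold m; rewrite <- Nat.add_assoc; apply Hf. }
  assert (Hx0 : forall j, (j < l)%nat -> 0 <= drift (2 ^ k) d tau (m + j)).
  { intros j Hj; apply Rle_trans with (2 := Hge j Hj).
    apply Rmult_le_pos; [generalize (pow2_ge_0 d); lra|].
    left; apply Rinv_0_lt_compat; generalize (pos_INR (2 ^ k)) (pos_INR j); lra. }
  assert (Hu2 : forall n, (n <= 2 * (2 ^ k * 2 ^ k))%nat -> Cmod (u n) <= 2)
    by (intros; now apply Hu).
  assert (D := averaged_drift (2 ^ k) d tau a u m l HP ltac:(lra) Hb Hml Hu2 Hc Hx0).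
  set (X := rsum (fun j => drift (2 ^ k) d tau (m + j)) l) in *.
  (* The harmonic sum over [k - 3] dyadic groups gives [d^2 / 32 * (k - 3) / 2]; this is where the
     threshold 64 comes from. *)
  assert (HX : 1 <= X).
  { apply Rle_trans with (rsum (fun j => d ^ 2 / 32 * / (INR (2 ^ k) + INR j + 1)) l).
    - rewrite rsum_scal.
      assert (H := harmonic_dyadic k (k - 3)); fold l in H.
      apply Rle_trans with (d ^ 2 / 32 * (INR (k - 3) / 2)); [lra|].
      apply Rmult_le_compat_l; [generalize (pow2_ge_0 d); lra | exact H].
    - apply rsum_le; exact Hge. }
  rewrite rsum_plus, !rsum_scal in D; fold X in D.
  assert (HS : rsum (fun j => err (2 ^ k) d tau (m + j)) l <= 170 * d).
  { apply Rle_trans with (2 := err_sum_le (2 ^ k) d tau HP ltac:(lra)).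
    assert (Hpos : forall j, 0 <= err (2 ^ k) d tau j) by (intros; apply err_ge; [assumption | lra]).
    apply Rle_trans with (rsum (err (2 ^ k) d tau) (m + l)).
    - rewrite rsum_split; generalize (rsum_nonneg _ m Hpos); lra.
    - now apply rsum_mono. }
  assert (Hv : forall n, (n <= 2 * (2 ^ k * 2 ^ k))%nat ->
                 Cmod (averaged (2 ^ k) tau a u n - u n) <= 2 * d).
  { intros n Hn; unfold averaged.
    replace (u n + corrector (2 ^ k) tau a n * Cconj (u n) - u n)%C
      with (corrector (2 ^ k) tau a n * Cconj (u n))%C by ring.
    rewrite Cmod_mult, Cmod_conj, Rmult_comm.
    apply Rmult_le_compat; try apply Cmod_ge_0; [now apply Hu2|].
    apply corrector_le with (d := d) (u := u); [assumption | lra | assumption]. }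
  assert (V1 := Hv (m + l)%nat ltac:(lia)); assert (V2 := Hv m ltac:(lia)).
  assert (V3 := Hc (m + l)%nat m ltac:(lia) ltac:(lia)).
  assert (Hum := Hu m ltac:(lia)).
  set (v' := averaged (2 ^ k) tau a u (m + l)) in *; set (v := averaged (2 ^ k) tau a u m) in *.
  assert (Hvv : Cmod (v' - v) <= 4 * d + / 10).
  { replace (v' - v)%C with ((v' - u (m + l)%nat) + ((u (m + l)%nat - u m) - (v - u m)))%C by ring.
    eapply Rle_trans; [apply Cmod_triangle|].
    eapply Rle_trans; [apply Rplus_le_compat_l, Cmod_sub_le|]; lra. }
  assert (HXu : Cmod (Ci * RtoC X * u m) = X * Cmod (u m))
    by (rewrite !Cmod_mult, Cmod_Ci, Cmod_R, Rabs_pos_eq; lra).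
  assert (T := Cmod_triangle_rev (Ci * RtoC X * u m) (v' - v)).
  rewrite (Cmod_sub_sym (Ci * RtoC X * u m)), HXu in T.
  assert (X * (3 / 4) <= X * Cmod (u m)) by (apply Rmult_le_compat_l; lra).
  lra.
Qed.

(** * Concatenated chirps *)

(** The amplitudes sum to at most [2 / m], so a large [m] makes the weight close to 1. The exponent
    is [64 / amp^2 + 3]: the oscillation threshold is met with equality in every block, however
    small its amplitude, and the 3 makes up for stopping at [P^2 / 8]. *)
Definition amp (m j : nat) : R := / (INR m * 2 ^ j).
Definition expo (m j : nat) : nat := (64 * (m * m) * 4 ^ j + 3)%nat.
Definition side (m j : nat) : nat := (2 ^ expo m j)%nat.
Definition len (m j : nat) : nat := (2 * (side m j * side m j))%nat.

Fixpoint start (m j : nat) : nat :=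
  match j with O => O | S j => (start m j + len m j)%nat end.

(* [pos m n = (j, i)] when [n] is the [i]-th index of the [j]-th block. *)
Fixpoint pos (m n : nat) : nat * nat :=
  match n with
  | O => (O, O)
  | S n => let (j, i) := pos m n in
           if Nat.ltb (S i) (len m j) then (j, S i) else (S j, O)
  end.

Definition chirp (m j i : nat) : C :=
  (RtoC (amp m j / INR (side m j)) * circ (PI / INR (side m j * side m j) * INR i ^ 2))%C.

Definition verb (m n : nat) : C := chirp m (fst (pos m n)) (snd (pos m n)).

Lemma amp_pos (m j : nat) : (1 <= m)%nat -> 0 < amp m j.
Proof.
  intros Hm; apply Rinv_0_lt_compat, Rmult_lt_0_compat; [apply lt_0_INR; lia|].
  apply pow_lt; lra.
Qed.

Lemma amp_le (m j : nat) : (1 <= m)%nat -> amp m j <= / INR m.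
Proof.
  intros Hm; apply Rinv_le_contravar; [apply lt_0_INR; lia|].
  assert (0 < INR m) by (apply lt_0_INR; lia).
  assert (1 <= 2 ^ j) by (apply pow_R1_Rle; lra); nra.
Qed.

Lemma amp_sum_le (m j : nat) : (1 <= m)%nat -> rsum (amp m) j <= 2 * / INR m.
Proof.
  intros Hm; assert (H : 0 < INR m) by (apply lt_0_INR; lia).
  assert (E : rsum (amp m) j = 2 * / INR m * (1 - / 2 ^ j)).
  { induction j as [|j IH]; [simpl; field; lra|].
    simpl rsum; rewrite IH; unfold amp; simpl; field; split; [apply pow_nonzero|]; lra. }
  rewrite E.
  assert (0 < / 2 ^ j) by (apply Rinv_0_lt_compat, pow_lt; lra).
  assert (0 < / INR m) by now apply Rinv_0_lt_compat.
  nra.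
Qed.

Lemma expo_amp (m j : nat) :
  (1 <= m)%nat -> (4 <= expo m j)%nat /\ INR (expo m j - 3) * amp m j ^ 2 = 64.
Proof.
  intros Hm; assert (H : 0 < INR m) by (apply lt_0_INR; lia).
  assert (H4 : (1 <= 4 ^ j)%nat) by (apply Nat.neq_0_lt_0, Nat.pow_nonzero; lia).
  unfold expo; split; [nia|].
  replace (64 * (m * m) * 4 ^ j + 3 - 3)%nat with (64 * (m * m) * 4 ^ j)%nat by lia.
  rewrite !mult_INR, pow_INR; unfold amp.
  replace (INR 4) with (2 * 2) by (simpl; ring); rewrite Rpow_mult_distr.
  replace (INR 64) with 64 by (simpl; ring).
  field; split; [apply pow_nonzero|]; lra.
Qed.

Lemma side_ge (m j : nat) : (2 <= side m j)%nat.
Proof.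
  unfold side; change 2%nat with (2 ^ 1)%nat at 1; apply Nat.pow_le_mono_r; [lia|].
  unfold expo; lia.
Qed.

Lemma len_ge (m j : nat) : (1 <= len m j)%nat.
Proof. unfold len; generalize (side_ge m j); nia. Qed.

Lemma start_ge (m j : nat) : (j <= start m j)%nat.
Proof. induction j as [|j IH]; cbn [start]; [lia | generalize (len_ge m j); lia]. Qed.

Lemma pos_start (m j i : nat) : (i < len m j)%nat -> pos m (start m j + i) = (j, i).
Proof.
  revert i; induction j as [|j IHj]; intros i; induction i as [|i IHi]; intros Hi.
  - reflexivity.
  - rewrite Nat.add_succ_r; cbn [pos]; rewrite IHi by lia.
    now rewrite (proj2 (Nat.ltb_lt _ _) Hi).
  - rewrite Nat.add_0_r; cbn [start].
    assert (Hl := len_ge m j).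
    replace (start m j + len m j)%nat with (S (start m j + (len m j - 1))) by lia.
    cbn [pos]; rewrite IHj by lia.
    now rewrite (proj2 (Nat.ltb_ge _ _)) by lia.
  - rewrite Nat.add_succ_r; cbn [pos]; rewrite IHi by lia.
    now rewrite (proj2 (Nat.ltb_lt _ _) Hi).
Qed.

Lemma verb_start (m j i : nat) : (i < len m j)%nat -> verb m (start m j + i) = chirp m j i.
Proof. intros Hi; unfold verb; now rewrite pos_start. Qed.

Lemma Cmod_chirp (m j i : nat) : (1 <= m)%nat -> Cmod (chirp m j i) = amp m j / INR (side m j).
Proof.
  intros Hm; unfold chirp; rewrite Cmod_mult, Cmod_circ, Cmod_R, Rmult_1_r.
  apply Rabs_pos_eq, Rdiv_le_0_compat; [left; now apply amp_pos|].
  apply lt_0_INR; generalize (side_ge m j); lia.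
Qed.

Lemma Cmod_verb_le (m n : nat) : (1 <= m)%nat -> Cmod (verb m n) <= / 2.
Proof.
  intros Hm; unfold verb; rewrite Cmod_chirp by exact Hm.
  set (j := fst _).
  assert (Hp := INR_ge_2 _ (side_ge m j)).
  assert (H1 := amp_le m j Hm).
  assert (/ INR m <= 1).
  { rewrite <- Rinv_1; apply Rinv_le_contravar; [lra|].
    change 1 with (INR 1); now apply le_INR. }
  apply Rmult_le_reg_r with (INR (side m j)); [lra|].
  unfold Rdiv; rewrite Rmult_assoc, Rinv_l; lra.
Qed.

Lemma Cmod_verb_lt_1 (m n : nat) : (1 <= m)%nat -> Cmod (verb m n) < 1.
Proof. intros Hm; generalize (Cmod_verb_le m n Hm); lra. Qed.

(** With [N] the square of the side, the ratio of consecutive chirp values has phase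
    [2 pi i / N + pi / N], and the factor [e^(i(n+1)t)] adds [t] at each step; hence
    [tau = pi / N + t]. Factors of modulus one do not affect [rho]. *)
Lemma verb_chirp_block (m j : nat) (t : R) :
  (1 <= m)%nat ->
  chirp_block (side m j) (amp m j) (PI / INR (side m j * side m j) + t)
    (fun i => (chirp m j i * circ (INR (S (start m j + i)) * t))%C)
    (fun i => phis (verb m) (start m j + i) t).
Proof.
  intros Hm; split; [|split].
  - intros i; now rewrite Cmod_mult, Cmod_circ, Rmult_1_r, Cmod_chirp.
  - intros i; unfold chirp, freq.
    set (N := INR (side m j * side m j)).
    replace (PI / N * INR (S i) ^ 2)
      with (PI / N * INR i ^ 2 + (2 * PI / N * INR i + PI / N)) by (rewrite S_INR; unfold Rdiv; ring).
    replace (INR (S (start m j + S i)) * t) with (INR (S (start m j + i)) * t + t)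
      by (rewrite Nat.add_succ_r, (S_INR (S _)); ring).
    replace (2 * PI / N * INR i + (PI / N + t)) with ((2 * PI / N * INR i + PI / N) + t) by ring.
    rewrite !circ_plus; ring.
  - intros i Hi; rewrite Nat.add_succ_r, phis_S_conj, verb_start by exact Hi.
    do 2 f_equal; unfold rho; rewrite Cmod_mult, Cmod_circ, Rmult_1_r; reflexivity.
Qed.

(** * Uniform bounds and oscillation over all blocks *)

Lemma INR_ge_1_inv (m : nat) : 1 <= INR m -> (1 <= m)%nat.
Proof. intros H; apply INR_le; exact H. Qed.

Lemma phis_block_modulus (m j i : nat) (t : R) :
  1000 <= INR m -> (i <= len m j)%nat ->
  exp (- (700 * amp m j)) * Cmod (phis (verb m) (start m j) t)
  <= Cmod (phis (verb m) (start m j + i) t)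
  <= exp (700 * amp m j) * Cmod (phis (verb m) (start m j) t).
Proof.
  intros Hm Hi; assert (Hm1 := INR_ge_1_inv m ltac:(lra)).
  assert (B := verb_chirp_block m j t Hm1).
  assert (Hd : 0 <= amp m j <= / 1000).
  { split; [left; now apply amp_pos|].
    apply Rle_trans with (1 := amp_le m j Hm1), Rinv_le_contravar; lra. }
  assert (H := chirp_modulus _ _ _ _ _ i (side_ge m j) Hd B Hi); cbv beta in H.
  now rewrite Nat.add_0_r in H.
Qed.

Lemma phis_start_modulus (m j : nat) (t : R) :
  1000 <= INR m ->
  exp (- (700 * rsum (amp m) j)) <= Cmod (phis (verb m) (start m j) t)
  <= exp (700 * rsum (amp m) j).
Proof.
  intros Hm; induction j as [|j IH].
  - cbn [start rsum]; rewrite phis_0, Cmod_1, Rmult_0_r, Ropp_0, exp_0; lra.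
  - cbn [start rsum].
    assert (H := phis_block_modulus m j (len m j) t Hm (Nat.le_refl _)).
    rewrite Rmult_plus_distr_l, Ropp_plus_distr, !exp_plus.
    assert (P1 := exp_pos (700 * amp m j)); assert (P2 := exp_pos (- (700 * amp m j))).
    split.
    + apply Rle_trans with (2 := proj1 H); rewrite Rmult_comm.
      apply Rmult_le_compat_l; [lra | apply IH].
    + apply Rle_trans with (1 := proj2 H); rewrite (Rmult_comm (exp (700 * rsum _ _))).
      apply Rmult_le_compat_l; [lra | apply IH].
Qed.

Lemma exp_le_mono (x y : R) : x <= y -> exp x <= exp y.
Proof. intros [H | ->]; [left; now apply exp_increasing | lra]. Qed.

Lemma exp_le_1_2x (x : R) : 0 <= x <= / 2 -> exp x <= 1 + 2 * x.
Proof.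
  intros Hx; replace x with (- - x) at 1 by ring; rewrite exp_Ropp.
  assert (H := exp_ineq1_le (- x)).
  apply Rle_trans with (/ (1 + - x)); [apply Rinv_le_contravar; lra|].
  apply Rmult_le_reg_l with (1 + - x); [lra|]; rewrite Rinv_r by lra; nra.
Qed.

Lemma phis_bounds (m n : nat) (t : R) :
  100000 <= INR m -> 9 / 10 <= Cmod (phis (verb m) n t) <= 11 / 10.
Proof.
  intros Hm; assert (Hm1 := INR_ge_1_inv m ltac:(lra)).
  assert (Hm' : / INR m <= / 100000).
  { apply Rinv_le_contravar; lra. }
  (* The end of a block is counted as its index [len m j], which [phis_block_modulus] allows; the
     next index is number 1 of the next block. *)
  assert (Hex : exists j i, (i <= len m j)%nat /\ n = (start m j + i)%nat).
  { induction n as [|n [j [i [Hi ->]]]]; [exists O, O; split; [lia | reflexivity]|].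
    destruct (Nat.eq_dec i (len m j)) as [-> | Hne].
    - exists (S j), 1%nat; split; [apply len_ge | cbn [start]; lia].
    - exists j, (S i); split; lia. }
  destruct Hex as [j [i [Hi ->]]].
  assert (H1 := phis_start_modulus m j t ltac:(lra)).
  assert (H2 := phis_block_modulus m j i t ltac:(lra) Hi).
  assert (A := amp_sum_le m (S j) ltac:(lia)); cbn [rsum] in A.
  assert (Hd := amp_pos m j ltac:(lia)).
  set (x := Cmod (phis (verb m) (start m j) t)) in *.
  assert (P1 := exp_pos (700 * amp m j)); assert (P2 := exp_pos (- (700 * amp m j))).
  (* The exponents add up to at most [700 * 2 / 100000], which is below 1/50. *)
  assert (U : exp (700 * amp m j) * exp (700 * rsum (amp m) j) <= 11 / 10).
  { rewrite <- exp_plus.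
    apply Rle_trans with (exp (/ 50)); [apply exp_le_mono; lra|].
    apply Rle_trans with (1 := exp_le_1_2x (/ 50) ltac:(lra)); lra. }
  assert (L : 9 / 10 <= exp (- (700 * amp m j)) * exp (- (700 * rsum (amp m) j))).
  { rewrite <- exp_plus.
    apply Rle_trans with (1 + - / 50); [lra|].
    apply Rle_trans with (1 := exp_ineq1_le (- / 50)), exp_le_mono; lra. }
  split.
  - apply Rle_trans with (1 := L), Rle_trans with (2 := proj1 H2).
    apply Rmult_le_compat_l; [lra | apply H1].
  - apply Rle_trans with (2 := U), Rle_trans with (1 := proj2 H2).
    apply Rmult_le_compat_l; [lra | apply H1].
Qed.

(** Block [N] lies beyond index [N] and oscillates by more than 1/10 at every [t], since [expo_amp]
    keeps the rotation from decaying with the amplitude. *)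
Lemma phis_not_Cauchy (m : nat) (t : R) (N : nat) :
  100000 <= INR m ->
  exists n k, (N <= n)%nat /\ (N <= k)%nat /\
    / 10 < Cmod (phis (verb m) n t - phis (verb m) k t).
Proof.
  intros Hm; assert (Hm1 := INR_ge_1_inv m ltac:(lra)).
  destruct (expo_amp m N Hm1) as [He Ha].
  assert (Hd : 0 < amp m N <= / 100000).
  { split; [now apply amp_pos|]; apply Rle_trans with (1 := amp_le m N Hm1).
    apply Rinv_le_contravar; lra. }
  destruct (chirp_oscillation (expo m N) (amp m N) _ _ _ He Hd ltac:(lra)
              (verb_chirp_block m N t Hm1)) as [n [k [_ [_ H]]]].
  { intros n _; generalize (phis_bounds m (start m N + n) t Hm); lra. }
  exists (start m N + n)%nat, (start m N + k)%nat.
  assert (Hs := start_ge m N); repeat split; try lia; exact H.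
Qed.

(** The weight depends only on the modulus, which a block changes by a factor between
    [exp (- (700 * amp m j))] and [exp (700 * amp m j)]; the rotation inside the block is invisible
    here. *)
Lemma bs_weight_increment (m j : nat) (t : R) :
  100000 <= INR m ->
  Rabs (bs_weight (verb m) (start m (S j)) t - bs_weight (verb m) (start m j) t)
  <= 5600 * / INR m / 2 ^ j.
Proof.
  intros Hm; assert (Hm1 := INR_ge_1_inv m ltac:(lra)); unfold bs_weight.
  assert (H := phis_block_modulus m j (len m j) t ltac:(lra) (Nat.le_refl _)).
  assert (B := phis_bounds m (start m j) t Hm).
  assert (B' := phis_bounds m (start m (S j)) t Hm).
  cbn [start] in *.
  set (x := Cmod (phis (verb m) (start m j) t)) in *.
  set (y := Cmod (phis (verb m) (start m j + len m j) t)) in *.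
  assert (Hd := amp_pos m j ltac:(lia)).
  assert (Hd' : amp m j <= / 100000).
  { apply Rle_trans with (1 := amp_le m j ltac:(lia)).
    apply Rinv_le_contravar; lra. }
  assert (Ea : 5600 * / INR m / 2 ^ j = 5600 * amp m j).
  { unfold amp; field; split; [apply pow_nonzero; lra|].
    assert (0 < INR m) by (apply lt_0_INR; lia); lra. }
  rewrite Ea.
  assert (E1 := exp_le_1_2x (700 * amp m j) ltac:(lra)).
  assert (E2 := exp_ineq1_le (- (700 * amp m j))).
  (* [1540 = 2 * 700 * 11/10]; times the factor 7/2 below this is 5390, rounded up to 5600. *)
  assert (D : Rabs (x - y) <= 1540 * amp m j) by (apply Rabs_le; split; nra).
  replace (/ y ^ 2 - / x ^ 2) with ((x - y) * ((x + y) / (x ^ 2 * y ^ 2))) by (field; lra).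
  rewrite Rabs_mult.
  assert (Hx2 : 81 / 100 <= x ^ 2) by nra.
  assert (Hy2 : 81 / 100 <= y ^ 2) by nra.
  assert (Hxy : 0 <= (x + y) / (x ^ 2 * y ^ 2) <= 7 / 2).
  { assert (0 < x ^ 2 * y ^ 2) by nra.
    split; [apply Rdiv_le_0_compat; lra|].
    apply Rmult_le_reg_r with (x ^ 2 * y ^ 2); [lra|].
    unfold Rdiv at 1; rewrite Rmult_assoc, Rinv_l by lra; nra. }
  rewrite (Rabs_pos_eq ((x + y) / _)) by lra.
  apply Rle_trans with (1540 * amp m j * (7 / 2)); [|lra].
  apply Rmult_le_compat; try lra; apply Rabs_pos.
Qed.

(** * Geometric uniform limits *)

Lemma geometric_bound_0 (x K : R) : (forall j : nat, Rabs x <= K / 2 ^ j) -> x = 0.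
Proof.
  intros H; apply Rabs_eq_0, Rle_antisym; [|apply Rabs_pos].
  apply (is_lim_seq_le (fun _ => Rabs x) (fun j => K * (/ 2) ^ j) (Rabs x) 0).
  - intros j; rewrite pow_inv; apply H.
  - apply is_lim_seq_const.
  - replace (Finite 0) with (Rbar_mult K 0) by (simpl; f_equal; ring).
    apply is_lim_seq_scal_l, is_lim_seq_geom; rewrite Rabs_pos_eq; lra.
Qed.

Lemma geometric_limit (f : nat -> R -> R) (c : R) :
  (forall j t, Rabs (f (S j) t - f j t) <= c / 2 ^ j) ->
  exists w, forall j t, Rabs (w t - f j t) <= 2 * c / 2 ^ j.
Proof.
  intros H.
  (* The exact value of the finite geometric sum lets the induction close; the factor [1 - 2^-i] is
     dropped afterwards. *)
  assert (T : forall i j t, Rabs (f (j + i)%nat t - f j t) <= 2 * c / 2 ^ j * (1 - (/ 2) ^ i)).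
  { induction i as [|i IH]; intros j t.
    - rewrite Nat.add_0_r, Rminus_diag, Rabs_R0; simpl; lra.
    - rewrite Nat.add_succ_r.
      replace (f (S (j + i)) t - f j t)
        with ((f (S (j + i)) t - f (j + i)%nat t) + (f (j + i)%nat t - f j t)) by ring.
      eapply Rle_trans; [apply Rabs_triang|].
      eapply Rle_trans; [apply Rplus_le_compat; [apply H | apply IH]|].
      right; rewrite !pow_inv, pow_add; simpl; field; split; apply pow_nonzero; lra. }
  assert (Hc : 0 <= c).
  { generalize (H O 0) (Rabs_pos (f 1%nat 0 - f O 0)); simpl; lra. }
  assert (T' : forall i j t, Rabs (f (j + i)%nat t - f j t) <= 2 * c / 2 ^ j).
  { intros i j t; apply Rle_trans with (1 := T i j t).
    assert (0 < (/ 2) ^ i) by (apply pow_lt; lra).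
    assert (0 <= 2 * c / 2 ^ j) by (apply Rdiv_le_0_compat; [lra | apply pow_lt; lra]).
    nra. }
  assert (Hz : is_lim_seq (fun j => 2 * c * (/ 2) ^ j) 0).
  { replace (Finite 0) with (Rbar_mult (2 * c) 0) by (simpl; f_equal; ring).
    apply is_lim_seq_scal_l, is_lim_seq_geom; rewrite Rabs_pos_eq; lra. }
  assert (L : forall t, ex_finite_lim_seq (fun j => f j t)).
  { intros t; apply ex_lim_seq_cauchy_corr; intros e.
    destruct (proj2 (is_lim_seq_spec _ _) Hz (mkposreal (e / 2) (is_pos_div_2 e))) as [N HN].
    exists N; intros n k Hn Hk.
    specialize (HN N (Nat.le_refl _)); simpl in HN; rewrite Rminus_0_r, pow_inv in HN.
    assert (A := Rle_abs (2 * c * / 2 ^ N)).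
    assert (B1 := T' (n - N)%nat N t); assert (B2 := T' (k - N)%nat N t).
    replace (N + (n - N))%nat with n in B1 by lia; replace (N + (k - N))%nat with k in B2 by lia.
    replace (f n t - f k t) with ((f n t - f N t) + (f N t - f k t)) by ring.
    eapply Rle_lt_trans; [apply Rabs_triang|].
    rewrite (Rabs_minus_sym (f N t)); unfold Rdiv in *; lra. }
  exists (fun t => real (Lim_seq (fun j => f j t))); intros j t.
  assert (Hl := Lim_seq_correct' _ (L t)).
  set (l := real (Lim_seq (fun j => f j t))) in *.
  apply (is_lim_seq_le (fun i => Rabs (f (i + j)%nat t - f j t)) (fun _ => 2 * c / 2 ^ j)
           (Rabs (l - f j t)) (2 * c / 2 ^ j)).
  - intros i; rewrite Nat.add_comm; apply T'.
  - apply (is_lim_seq_abs _ (l - f j t)).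
    apply is_lim_seq_minus'; [|apply is_lim_seq_const].
    now apply is_lim_seq_incr_n with (u := fun j => f j t).
  - apply is_lim_seq_const.
Qed.

Lemma geometric_limit_continuous (f : nat -> R -> R) (w : R -> R) (K : R) :
  (forall j t, continuous (f j) t) -> (forall j t, Rabs (w t - f j t) <= K / 2 ^ j) ->
  forall t, continuous w t.
Proof.
  intros Hf Hw t; apply filterlim_locally; intros e.
  assert (Hz : is_lim_seq (fun j => K * (/ 2) ^ j) 0).
  { replace (Finite 0) with (Rbar_mult K 0) by (simpl; f_equal; ring).
    apply is_lim_seq_scal_l, is_lim_seq_geom; rewrite Rabs_pos_eq; lra. }
  assert (He3 : 0 < e / 3) by (generalize (cond_pos e); lra).
  destruct (proj2 (is_lim_seq_spec _ _) Hz (mkposreal _ He3)) as [N HN].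
  specialize (HN N (Nat.le_refl _)); simpl in HN; rewrite Rminus_0_r, pow_inv in HN.
  assert (A := Rle_abs (K * / 2 ^ N)).
  assert (C := proj1 (filterlim_locally (f N) (f N t)) (Hf N t) (mkposreal _ He3)).
  apply filter_imp with (2 := C); intros s Hs.
  unfold ball in *; simpl in *; unfold AbsRing_ball, abs, minus, plus, opp in *; simpl in *.
  assert (B1 := Hw N t); assert (B2 := Hw N s).
  replace (w s + - w t) with ((w s - f N s) + ((f N s + - f N t) + - (w t - f N t))) by ring.
  eapply Rle_lt_trans; [apply Rabs_triang|].
  eapply Rle_lt_trans; [apply Rplus_le_compat_l, Rabs_triang|].
  rewrite Rabs_Ropp; unfold Rdiv in *; lra.
Qed.

(** * Leading coefficients and the telescoping kernel *)

Fixpoint kap (al : nat -> C) (n : nat) : R :=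
  match n with O => 1 | S n => / rho (al n) * kap al n end.

Lemma szego_lead (al : nat -> C) (n : nat) : szego al n n = RtoC (kap al n).
Proof.
  induction n as [|n IH]; [reflexivity|].
  cbn [szego kap]; rewrite IH, (proj2 (Nat.leb_gt (S n) n)), RtoC_mult by lia; ring.
Qed.

Lemma szego_tail (al : nat -> C) (n : nat) :
  szego al (S n) O = (- (RtoC (kap al (S n)) * Cconj (al n)))%C.
Proof.
  cbn [szego kap]; cbn [Nat.leb]; rewrite Nat.sub_0_r, szego_lead, RtoC_conj, RtoC_mult; ring.
Qed.

Lemma kap_ge_1 (al : nat -> C) (n : nat) : (forall k, Cmod (al k) < 1) -> 1 <= kap al n.
Proof.
  intros Hal; induction n as [|n IH]; simpl; [lra|].
  assert (1 <= / rho (al n)).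
  { rewrite <- Rinv_1; apply Rinv_le_contravar; [apply rho_pos, Hal | apply rho_le_1]. }
  nra.
Qed.

Lemma kap_incr (al : nat -> C) (n : nat) :
  (forall k, Cmod (al k) < 1) -> kap al n <= kap al (S n).
Proof.
  intros Hal; simpl.
  assert (1 <= / rho (al n)).
  { rewrite <- Rinv_1; apply Rinv_le_contravar; [apply rho_pos, Hal | apply rho_le_1]. }
  generalize (kap_ge_1 al n Hal); nra.
Qed.

(** The Christoffel-Darboux kernel with second argument at the origin. *)
Lemma kap_phis_sum (al : nat -> C) (n : nat) (t : R) :
  (forall k, Cmod (al k) < 1) ->
  sum_n (fun k => (Cconj (szego al k O) * phi al k t)%C) n
  = (RtoC (kap al n) * phis al n t)%C :> C.
Proof.
  intros Hal; induction n as [|n IH].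
  - rewrite csum_O, phi_0, phis_0; cbn [szego kap]; now rewrite RtoC_conj.
  - rewrite csum_S, IH, szego_tail, Copp_conj, Cmult_conj, Cconj_conj, RtoC_conj, phi_S, phis_S.
    cbn [kap]; rewrite RtoC_mult.
    assert (Hr : rho (al n) <> 0) by (generalize (rho_pos _ (Hal n)); lra).
    assert (H3 := RtoC_neq_0 _ Hr).
    assert (E3 : (RtoC (rho (al n)) * RtoC (rho (al n)))%C = (1 - al n * Cconj (al n))%C).
    { rewrite <- RtoC_mult.
      replace (rho (al n) * rho (al n)) with (rho (al n) ^ 2) by ring.
      rewrite rho_sqr, RtoC_minus, Cmod2_conj by apply Hal; reflexivity. }
    rewrite RtoC_inv by exact Hr; set (r := RtoC (rho (al n))) in *.
    (* With [kap al n / rho^2] factored out, the coefficient of [phis] is [rho^2 + |al_n|^2 = 1]. *)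
    transitivity (RtoC (kap al n) * (/ r * / r) *
      ((r * r + al n * Cconj (al n)) * phis al n t - al n * circ t * phi al n t))%C.
    + field; exact H3.
    + rewrite E3; field; exact H3.
Qed.

(** * Square summability of the coefficients *)

Lemma kap_le_exp (al : nat -> C) (n : nat) :
  (forall k, Cmod (al k) <= / 2) -> kap al n <= exp (rsum (fun k => Cmod (al k) ^ 2) n).
Proof.
  intros Hal; induction n as [|n IH]; simpl; [rewrite exp_0; lra|].
  rewrite exp_plus, Rmult_comm.
  assert (H0 := Cmod_ge_0 (al n)); assert (H := Hal n).
  apply Rmult_le_compat.
  - apply Rle_trans with 1; [lra|]; apply kap_ge_1; intros k; generalize (Hal k); lra.
  - left; apply Rinv_0_lt_compat, rho_pos; lra.
  - exact IH.
  - apply Rle_trans with (1 + Cmod (al n) ^ 2); [apply inv_rho_le; nra | apply exp_ineq1_le].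
Qed.

Lemma verb_sqr_sum_le (m n : nat) :
  100000 <= INR m -> rsum (fun k => Cmod (verb m k) ^ 2) n <= 1.
Proof.
  intros Hm; assert (Hm1 := INR_ge_1_inv m ltac:(lra)).
  (* The sum is enlarged to complete blocks: a block of [2 P^2] coefficients of modulus [amp / P]
     contributes [2 amp^2], at most [2 amp]. *)
  apply Rle_trans with (rsum (fun k => Cmod (verb m k) ^ 2) (start m n)).
  { apply rsum_mono; [intros; apply pow2_ge_0 | apply start_ge]. }
  apply Rle_trans with (2 * rsum (amp m) n).
  2:{ assert (A := amp_sum_le m n Hm1).
      assert (/ INR m <= / 100000) by (apply Rinv_le_contravar; lra); lra. }
  induction n as [|n IH]; [simpl; lra|].
  cbn [start rsum]; rewrite rsum_split.
  rewrite (rsum_ext (fun k => Cmod (verb m (start m n + k)) ^ 2)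
             (fun _ => (amp m n / INR (side m n)) ^ 2)).
  2:{ intros k Hk; now rewrite verb_start, Cmod_chirp. }
  rewrite rsum_const; unfold len; rewrite !mult_INR; simpl (INR 2).
  assert (Hp := INR_ge_2 _ (side_ge m n)).
  replace ((1 + 1) * (INR (side m n) * INR (side m n)) * (amp m n / INR (side m n)) ^ 2)
    with (2 * amp m n * amp m n) by (field; lra).
  assert (A1 := amp_pos m n Hm1); assert (A2 := amp_le m n Hm1).
  assert (/ INR m <= / 100000) by (apply Rinv_le_contravar; lra).
  nra.
Qed.

Lemma rsum_sum_n (f : nat -> R) (n : nat) : sum_n f n = rsum f (S n).
Proof.
  induction n as [|n IH]; [rewrite sum_O; simpl; ring|].
  rewrite sum_Sn, IH; reflexivity.
Qed.

Lemma ex_series_rsum_bounded (f : nat -> R) (B : R) :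
  (forall k, 0 <= f k) -> (forall n, rsum f n <= B) -> ex_series f.
Proof.
  intros Hf HB.
  destruct (ex_finite_lim_seq_incr (sum_n f) B) as [l Hl].
  - intros n; rewrite !rsum_sum_n; simpl; generalize (Hf (S n)); lra.
  - intros n; rewrite rsum_sum_n; apply HB.
  - exists l; exact Hl.
Qed.

Lemma szego_tail_in_l2 (m : nat) :
  100000 <= INR m -> in_l2 (fun n => Cconj (szego (verb m) n O)).
Proof.
  intros Hm; assert (Hm1 := INR_ge_1_inv m ltac:(lra)).
  unfold in_l2; apply ex_series_incr_1.
  apply (ex_series_le (K := R_AbsRing) (V := R_CompleteNormedModule)) with
    (b := fun n => exp 1 ^ 2 * Cmod (verb m n) ^ 2).
  - intros n; unfold norm; simpl; unfold abs; simpl.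
    rewrite Cmod_conj.
    change (Rabs (Cmod (szego (verb m) (S n) O) ^ 2) <= exp 1 ^ 2 * Cmod (verb m n) ^ 2).
    rewrite szego_tail, Cmod_opp, Cmod_mult, Cmod_R, Cmod_conj.
    rewrite Rabs_pos_eq by apply pow2_ge_0.
    rewrite Rpow_mult_distr; apply Rmult_le_compat_r; [apply pow2_ge_0|].
    assert (K1 := kap_ge_1 (verb m) (S n) (fun k => Cmod_verb_lt_1 m k Hm1)).
    rewrite Rabs_pos_eq by lra; apply pow_incr; split; [lra|].
    apply Rle_trans with (1 := kap_le_exp (verb m) (S n) (fun k => Cmod_verb_le m k Hm1)).
    apply exp_le_mono, verb_sqr_sum_le, Hm.
  - apply (ex_series_scal (V := R_NormedModule)).
    apply ex_series_rsum_bounded with 1.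
    + intros; apply pow2_ge_0.
    + intros; now apply verb_sqr_sum_le.
Qed.

(** * Uniqueness of orthonormal polynomials *)

(** Triangular elimination from the top degree. The value of [la n] is recorded because uniqueness
    compares leading coefficients. *)
Lemma poly_eval_span (c : nat -> nat -> C) (d : nat -> C) (n : nat) :
  (forall k, c k k <> RtoC 0) ->
  exists la : nat -> C, la n = (d n / c n n)%C /\ forall z,
    poly_eval d n z = sum_n (fun k => (la k * poly_eval (c k) k z)%C) n :> C.
Proof.
  intros Hc; revert d; induction n as [|n IH]; intros d.
  - exists (fun _ => (d O / c O O)%C); split; [reflexivity|].
    intros z; unfold poly_eval; rewrite !csum_O; field; apply Hc.
  - set (q := (d (S n) / c (S n) (S n))%C).
    destruct (IH (fun k => (d k - q * c (S n) k)%C)) as [la [_ Hla]].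
    exists (fun k => if Nat.eqb k (S n) then q else la k).
    rewrite Nat.eqb_refl; split; [reflexivity|]; intros z.
    rewrite csum_S, Nat.eqb_refl.
    rewrite (csum_ext _ (fun k => (la k * poly_eval (c k) k z)%C)).
    2:{ intros k Hk; now rewrite (proj2 (Nat.eqb_neq k (S n))) by lia. }
    rewrite <- Hla; unfold poly_eval; rewrite !csum_S.
    rewrite (csum_ext (fun k => ((d k - q * c (S n) k) * pow_n z k)%C)
       (fun k => (d k * pow_n z k + (- q) * (c (S n) k * pow_n z k))%C)) by (intros; ring).
    rewrite csum_plus, csum_scal; unfold q; field; apply Hc.
Qed.

Definition inner (w : R -> R) (f g : R -> C) : C :=
  int_m (fun t => (f t * Cconj (g t) * RtoC (w t))%C).

Lemma Ccont_csum (f : nat -> R -> C) (n : nat) :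
  (forall k, Ccont (f k)) -> Ccont (fun t => sum_n (fun k => f k t) n).
Proof.
  intros Hf; induction n as [|n IH].
  - apply Ccont_ext with (f O); [intros; now rewrite csum_O | apply Hf].
  - apply Ccont_ext with (fun t => (sum_n (fun k => f k t) n + f (S n) t)%C);
      [intros; now rewrite csum_S | now apply Ccont_plus].
Qed.

Lemma inner_ext (w : R -> R) (f g f' g' : R -> C) :
  (forall t, f t = f' t) -> (forall t, g t = g' t) -> inner w f g = inner w f' g'.
Proof. intros Hf Hg; apply int_m_ext; intros t; now rewrite Hf, Hg. Qed.

Lemma Ccont_inner (w : R -> R) (f g : R -> C) :
  (forall t, continuous w t) -> Ccont f -> Ccont g ->
  Ccont (fun t => (f t * Cconj (g t) * RtoC (w t))%C).
Proof.
  intros Hw Hf Hg; apply Ccont_mult; [|now apply Ccont_RtoC].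
  apply Ccont_mult; [assumption | now apply Ccont_conj].
Qed.

Lemma inner_sum_l (w : R -> R) (la : nat -> C) (f : nat -> R -> C) (g : R -> C) (n : nat) :
  (forall t, continuous w t) -> (forall k, Ccont (f k)) -> Ccont g ->
  inner w (fun t => sum_n (fun k => (la k * f k t)%C) n) g
  = sum_n (fun k => (la k * inner w (f k) g)%C) n :> C.
Proof.
  intros Hw Hf Hg; unfold inner.
  assert (Hc : forall k, Ccont (fun t => (la k * (f k t * Cconj (g t) * RtoC (w t)))%C)).
  { intros k; apply Ccont_mult; [apply Ccont_const | now apply Ccont_inner]. }
  induction n as [|n IH].
  - rewrite csum_O, <- int_m_scal by now apply Ccont_inner.
    apply int_m_ext; intros t; rewrite csum_O; ring.
  - rewrite csum_S, <- IH, <- int_m_scal by now apply Ccont_inner.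
    rewrite <- int_m_plus.
    + apply int_m_ext; intros t; rewrite csum_S; ring.
    + apply Ccont_inner; try assumption.
      apply (Ccont_csum (fun k t => (la k * f k t)%C)); intros k.
      now apply Ccont_mult; [apply Ccont_const|].
    + apply Hc.
Qed.

Lemma inner_sym (w : R -> R) (f g : R -> C) :
  (forall t, continuous w t) -> Ccont f -> Ccont g -> inner w g f = Cconj (inner w f g).
Proof.
  intros Hw Hf Hg; unfold inner; rewrite <- int_m_conj by now apply Ccont_inner.
  apply int_m_ext; intros t; rewrite !Cmult_conj, Cconj_conj, RtoC_conj; ring.
Qed.

Definition peval (c : nat -> nat -> C) (n : nat) (t : R) : C := poly_eval (c n) n (circ t).

Lemma Ccont_peval (c : nat -> nat -> C) (n : nat) : Ccont (peval c n).
Proof. apply circle_poly_Ccont, poly_eval_circle_poly. Qed.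

Lemma csum_zero (f : nat -> C) (n : nat) :
  (forall k, (k <= n)%nat -> f k = RtoC 0) -> sum_n f n = RtoC 0 :> C.
Proof.
  intros H; induction n as [|n IH]; [rewrite csum_O; now apply H|].
  rewrite csum_S, IH, H by (intros; try apply H; lia); ring.
Qed.

Lemma csum_single (f : nat -> C) (n k : nat) :
  (k <= n)%nat -> (forall j, (j <= n)%nat -> j <> k -> f j = RtoC 0) -> sum_n f n = f k :> C.
Proof.
  intros Hk H; induction n as [|n IH].
  - replace k with O by lia; apply csum_O.
  - rewrite csum_S; destruct (Nat.eq_dec k (S n)) as [-> | Hne].
    + rewrite csum_zero; [ring|]; intros j Hj; apply H; lia.
    + rewrite IH, (H (S n)) by (intros; try apply H; lia); ring.
Qed.

Lemma orthonormal_diag (w : R -> R) (c : nat -> nat -> C) (n : nat) :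
  orthonormal_polys w c -> c n n = RtoC (fst (c n n)) /\ 0 < fst (c n n).
Proof.
  intros [H _]; destruct (H n) as [H1 H2]; split; [|exact H2].
  destruct (c n n) as [x y]; simpl in *; now rewrite H1.
Qed.

Lemma orthonormal_diag_neq_0 (w : R -> R) (c : nat -> nat -> C) (n : nat) :
  orthonormal_polys w c -> c n n <> RtoC 0.
Proof.
  intros H; destruct (orthonormal_diag w c n H) as [E H2]; rewrite E; apply RtoC_neq_0; lra.
Qed.

Lemma orthonormal_inner_lower (w : R -> R) (c : nat -> nat -> C) (d : nat -> C) (n k : nat) :
  (forall t, continuous w t) -> orthonormal_polys w c -> (k < n)%nat ->
  inner w (fun t => poly_eval d k (circ t)) (peval c n) = RtoC 0.
Proof.
  intros Hw Hc Hk.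
  destruct (poly_eval_span c d k (fun j => orthonormal_diag_neq_0 w c j Hc)) as [la [_ Hla]].
  rewrite (inner_ext w _ _ (fun t => sum_n (fun j => (la j * peval c j t)%C) k) (peval c n)
             (fun t => Hla (circ t)) (fun t => eq_refl)).
  rewrite inner_sum_l by (try exact Hw; intros; apply Ccont_peval).
  apply csum_zero; intros j Hj.
  replace (inner w (peval c j) (peval c n)) with (RtoC 0); [ring|].
  symmetry; unfold inner, peval; rewrite (proj2 Hc).
  now rewrite (proj2 (Nat.eqb_neq j n)) by lia.
Qed.

(** The theorem speaks of every orthonormal system of [w], so an arbitrary one has to be identified
    with the one given by the recursion. Expanded in the [c'] system, the [n]-th polynomial has no
    lower components by orthogonality; positivity and norm one then force the remaining factor [q]
    to be 1. *)
Lemma orthonormal_unique (w : R -> R) (c c' : nat -> nat -> C) (n : nat) (t : R) :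
  (forall t, continuous w t) -> orthonormal_polys w c -> orthonormal_polys w c' ->
  peval c n t = peval c' n t.
Proof.
  intros Hw Hc Hc'.
  destruct (orthonormal_diag w c n Hc) as [E1 P1].
  destruct (orthonormal_diag w c' n Hc') as [E2 P2].
  set (q := fst (c n n) / fst (c' n n)).
  assert (Hq : 0 < q) by now apply Rdiv_lt_0_compat.
  destruct (poly_eval_span c' (c n) n (fun j => orthonormal_diag_neq_0 w c' j Hc')) as [la [Hlan Hla]].
  assert (Hn : la n = RtoC q).
  { rewrite Hlan, E1, E2; unfold q; rewrite RtoC_div by lra; reflexivity. }
  assert (Hz : forall k, (k < n)%nat -> la k = RtoC 0).
  { intros k Hk.
    assert (Z : inner w (peval c n) (peval c' k) = la k).
    { rewrite (inner_ext w (peval c n) (peval c' k) (fun t => sum_n (fun j => (la j * peval c' j t)%C) n) (peval c' k)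
           (fun t => Hla (circ t)) (fun t => eq_refl)).
      rewrite inner_sum_l by (try exact Hw; intros; apply Ccont_peval).
      rewrite (csum_single _ n k).
      - unfold inner, peval; rewrite (proj2 Hc'), Nat.eqb_refl; ring.
      - lia.
      - intros j Hj Hne; unfold inner, peval; rewrite (proj2 Hc').
        rewrite (proj2 (Nat.eqb_neq j k) Hne); ring. }
    rewrite <- Z, inner_sym by (assumption || apply Ccont_peval).
    change (peval c' k) with (fun t => poly_eval (c' k) k (circ t)).
    rewrite (orthonormal_inner_lower w c (c' k) n k Hw Hc Hk); apply RtoC_conj. }
  assert (Hs : forall s, peval c n s = (RtoC q * peval c' n s)%C).
  { intros s; unfold peval; rewrite Hla, <- Hn.
    apply (csum_single (fun k => (la k * poly_eval (c' k) k (circ s))%C)); [lia|].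
    intros j Hj Hne; rewrite Hz by lia; ring. }
  assert (Hnorm : RtoC 1 = RtoC (q * q)).
  { transitivity (inner w (peval c n) (peval c n)).
    - unfold inner, peval; now rewrite (proj2 Hc), Nat.eqb_refl.
    - unfold inner.
      rewrite (int_m_ext _ (fun t => (RtoC (q * q) * (peval c' n t * Cconj (peval c' n t) * RtoC (w t)))%C))
        by (intros; rewrite Hs, Cmult_conj, RtoC_conj, RtoC_mult; ring).
      rewrite int_m_scal by (apply Ccont_inner; try assumption; apply Ccont_peval).
      unfold peval; rewrite (proj2 Hc'), Nat.eqb_refl; ring. }
  apply RtoC_inj in Hnorm.
  assert (Hq1 : q = 1) by nra.
  rewrite Hs, Hq1; ring.
Qed.

(** * Convergence and the Cauchy criterion *)

Lemma seq_converges_Cauchy (u : nat -> C) (e : R) :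
  0 < e -> seq_converges u ->
  exists N, forall n k, (N <= n)%nat -> (N <= k)%nat -> Cmod (u n - u k) <= e.
Proof.
  intros He [l Hl].
  assert (He4 : 0 < e / 4) by lra.
  destruct (proj1 (filterlim_locally u l) Hl (mkposreal _ He4)) as [N HN].
  assert (B : forall n, (N <= n)%nat -> Cmod (u n - l) <= e / 2).
  { intros n Hn; destruct (HN n Hn) as [H1 H2].
    unfold ball in H1, H2; simpl in H1, H2.
    unfold AbsRing_ball, abs, minus, plus, opp in H1, H2; simpl in H1, H2.
    eapply Rle_trans; [apply (Cmod_pair_le (fst (u n - l)%C) (snd (u n - l)%C))|].
    simpl; lra. }
  exists N; intros n k Hn Hk.
  replace (u n - u k)%C with ((u n - l) - (u k - l))%C by ring.
  eapply Rle_trans; [apply Cmod_sub_le|]; generalize (B n Hn) (B k Hk); lra.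
Qed.

(** * The limit weight *)

(** For fixed [n] and [k] the relations hold exactly for all Bernstein-Szego weights of index at
    least [n], so uniform convergence along the block ends carries them over to [w]. *)
Lemma limit_weight_orthonormal (m : nat) (w : R -> R) (K : R) :
  (1 <= m)%nat -> (forall t, continuous w t) ->
  (forall j t, Rabs (w t - bs_weight (verb m) (start m j) t) <= K / 2 ^ j) ->
  orthonormal_polys w (szego (verb m)).
Proof.
  intros Hm Hw HK.
  assert (Hal : forall k, Cmod (verb m k) < 1) by (intros; now apply Cmod_verb_lt_1).
  assert (Hbs : forall n t, continuous (bs_weight (verb m) n) t)
    by (intros; now apply bs_weight_continuous).
  assert (Hphi := Ccont_phi (verb m)).
  assert (Hlow : forall n k, (k <= n)%nat ->
     inner w (phi (verb m) n) (phi (verb m) k) = if Nat.eqb n k then RtoC 1 else RtoC 0).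
  { intros n k Hk.
    set (v := if Nat.eqb n k then RtoC 1 else RtoC 0).
    destruct (circle_poly_bounded _ (circle_poly_mult _ _ (phi_circle_poly (verb m) n)
                (phi_circle_poly (verb m) k))) as [B [HB Bb]].
    assert (Hd : forall j, (n <= j)%nat ->
       Cmod (inner w (phi (verb m) n) (phi (verb m) k) - v) <= 2 * (B * (K / 2 ^ j))).
    { intros j Hj.
      unfold v; rewrite <- (bs_weight_orthonormal (verb m) (start m j) n k Hal Hk)
        by (generalize (start_ge m j); lia).
      unfold inner; rewrite <- int_m_minus by (apply Ccont_inner; auto).
      rewrite (int_m_ext _ (fun t => (phi (verb m) n t * Cconj (phi (verb m) k t)
                 * RtoC (w t - bs_weight (verb m) (start m j) t))%C))
        by (intros; rewrite RtoC_minus; ring).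
      apply int_m_le_const.
      - apply (Ccont_inner (fun t => w t - bs_weight (verb m) (start m j) t)); auto.
        intros t; now apply (continuous_minus w (bs_weight (verb m) (start m j))).
      - intros t; rewrite Cmod_mult, Cmod_mult, Cmod_conj, <- Cmod_mult, Cmod_R.
        apply Rmult_le_compat; [apply Cmod_ge_0 | apply Rabs_pos | apply Bb | apply HK]. }
    set (x := Cmod (inner w (phi (verb m) n) (phi (verb m) k) - v)) in *.
    assert (Hx : x = 0).
    { apply geometric_bound_0 with (2 * B * K).
      intros j; unfold x at 1; rewrite Rabs_pos_eq by apply Cmod_ge_0; fold x.
      assert (HK0 : 0 <= K / 2 ^ j)
        by (apply Rle_trans with (2 := HK j 0); apply Rabs_pos).
      (* [Hd] holds only from [n] on, hence the shift; the extra factor [2^-n] is bounded by 1. *)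
      apply Rle_trans with (1 := Hd (n + j)%nat ltac:(lia)).
      assert (P1 : 0 < 2 ^ n) by (apply pow_lt; lra).
      assert (P2 : 0 < 2 ^ j) by (apply pow_lt; lra).
      assert (P3 : 1 <= 2 ^ n) by (apply pow_R1_Rle; lra).
      replace (2 * (B * (K / 2 ^ (n + j)))) with (2 * B * (K / 2 ^ j) * / 2 ^ n)
        by (rewrite pow_add; field; lra).
      replace (2 * B * K / 2 ^ j) with (2 * B * (K / 2 ^ j) * 1) by (field; lra).
      apply Rmult_le_compat_l; [apply Rmult_le_pos; lra|].
      rewrite <- Rinv_1; apply Rinv_le_contravar; lra. }
    apply Cmod_eq_0 in Hx.
    replace (inner w (phi (verb m) n) (phi (verb m) k))
      with (v + (inner w (phi (verb m) n) (phi (verb m) k) - v))%C by ring.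
    rewrite Hx; ring. }
  split.
  - intros n; rewrite szego_lead; simpl; split; [reflexivity|].
    generalize (kap_ge_1 (verb m) n Hal); lra.
  - intros n k; change (inner w (phi (verb m) n) (phi (verb m) k)
                        = if Nat.eqb n k then RtoC 1 else RtoC 0).
    destruct (Nat.le_ge_cases k n) as [H | H]; [now apply Hlow|].
    rewrite inner_sym, Hlow, Nat.eqb_sym by auto.
    destruct (Nat.eqb n k); apply RtoC_conj.
Qed.

(** The polynomial of degree 0 is the constant 1, so its normalization is the total mass. *)
Lemma orthonormal_mean (w : R -> R) (m : nat) :
  (forall t, continuous w t) -> orthonormal_polys w (szego (verb m)) -> int_m_R w = 1.
Proof.
  intros Hw H; assert (E := proj2 H O O); cbn [Nat.eqb] in E.
  assert (E' : int_m (fun t => RtoC (w t)) = RtoC 1).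
  { rewrite <- E; apply int_m_ext; intros t.
    change (poly_eval (szego (verb m) O) O (circ t)) with (phi (verb m) O t).
    rewrite phi_0, RtoC_conj; ring. }
  rewrite int_m_pair in E' by now apply Ccont_RtoC.
  now injection E'.
Qed.

Lemma phis_period (al : nat -> C) (n : nat) (t : R) : phis al n (t + 2 * PI) = phis al n t.
Proof. unfold phis; now rewrite circ_2PI. Qed.

Lemma phis_diverges (m : nat) (t : R) :
  100000 <= INR m -> ~ seq_converges (fun n => phis (verb m) n t).
Proof.
  intros Hm H; destruct (seq_converges_Cauchy _ (/ 10) ltac:(lra) H) as [N HN].
  destruct (phis_not_Cauchy m t N Hm) as [n [k [Hn [Hk Hgt]]]].
  generalize (HN n k Hn Hk); lra.
Qed.

Lemma kap_Cauchy (m : nat) (e : R) :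
  100000 <= INR m -> 0 < e ->
  exists N, forall n k, (N <= n)%nat -> (N <= k)%nat -> Rabs (kap (verb m) n - kap (verb m) k) <= e.
Proof.
  intros Hm He; assert (Hm1 := INR_ge_1_inv m ltac:(lra)).
  assert (L : ex_finite_lim_seq (kap (verb m))).
  { apply ex_finite_lim_seq_incr with (exp 1).
    - intros n; apply kap_incr; intros; now apply Cmod_verb_lt_1.
    - intros n; apply Rle_trans with (1 := kap_le_exp (verb m) n (fun k => Cmod_verb_le m k Hm1)).
      apply exp_le_mono, verb_sqr_sum_le, Hm. }
  destruct (proj1 (ex_lim_seq_cauchy_corr _) L (mkposreal e He)) as [N HN].
  exists N; intros n k Hn Hk; left; now apply HN.
Qed.

(** The partial sums are [kap] times [phis]. As [kap] converges and is at least 1 and [phis] is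
    bounded, Cauchy partial sums would leave [phis] an oscillation of at most about 1/50, against
    the 1/10 that recurs in every block. *)
Lemma kernel_series_diverges (m : nat) (t : R) :
  100000 <= INR m ->
  ~ seq_converges (fun N => sum_n (fun n => (Cconj (szego (verb m) n O) * phi (verb m) n t)%C) N).
Proof.
  intros Hm H; assert (Hm1 := INR_ge_1_inv m ltac:(lra)).
  assert (Hal : forall k, Cmod (verb m k) < 1) by (intros; now apply Cmod_verb_lt_1).
  destruct (seq_converges_Cauchy _ (/ 100) ltac:(lra) H) as [N1 HN1].
  destruct (kap_Cauchy m (/ 100) Hm ltac:(lra)) as [N2 HN2].
  destruct (phis_not_Cauchy m t (Nat.max N1 N2) Hm) as [n [k [Hn [Hk Hgt]]]].
  specialize (HN1 n k ltac:(lia) ltac:(lia)); specialize (HN2 n k ltac:(lia) ltac:(lia)).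
  rewrite !kap_phis_sum in HN1 by exact Hal.
  set (x := phis (verb m) n t) in *; set (y := phis (verb m) k t) in *.
  assert (By : Cmod y <= 11 / 10) by apply (phis_bounds m k t Hm).
  assert (K1 := kap_ge_1 (verb m) n Hal).
  assert (E : (RtoC (kap (verb m) n) * (x - y))%C
    = ((RtoC (kap (verb m) n) * x - RtoC (kap (verb m) k) * y)
       - RtoC (kap (verb m) n - kap (verb m) k) * y)%C) by (rewrite RtoC_minus; ring).
  assert (L : kap (verb m) n * Cmod (x - y) <= / 100 + / 100 * (11 / 10)).
  { rewrite <- (Rabs_pos_eq (kap (verb m) n)) by lra.
    rewrite <- Cmod_R, <- Cmod_mult, E.
    eapply Rle_trans; [apply Cmod_sub_le|]; apply Rplus_le_compat; [exact HN1|].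
    rewrite Cmod_mult, Cmod_R.
    apply Rmult_le_compat; [apply Rabs_pos | apply Cmod_ge_0 | exact HN2 | exact By]. }
  nra.
Qed.

Lemma seq_converges_ext (u v : nat -> C) :
  (forall n, u n = v n) -> seq_converges u -> seq_converges v.
Proof. intros H [l Hl]; exists l; now apply filterlim_ext with (2 := Hl). Qed.

Theorem theorem3p1 :
  forall eps : R, 0 < eps ->
  exists w : R -> R,
    continuous_on_T w /\
    (forall t, 0 <= w t) /\
    int_m_R w = 1 /\
    (forall t, Rabs (w t - 1) <= eps) /\
    (exists c, orthonormal_polys w c) /\
    (forall c, orthonormal_polys w c ->
       (forall t, ~ seq_converges (fun n => poly_star_eval (c n) n (circ t))) /\
       (exists alpha : nat -> C, in_l2 alpha /\
          forall t, ~ seq_converges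
                        (fun N => sum_n (fun n => Cmult (alpha n)
                                                       (poly_eval (c n) n (circ t))) N))).
Proof.
  intros eps Heps.
  (* 100000 is the threshold of the modulus bounds; [11200 = 2 * 5600] sums the increments of the
     weight from its initial value 1. *)
  destruct (INR_unbounded (100000 + 11200 / eps)) as [m Hm0].
  assert (Hq : 0 < 11200 / eps) by (apply Rdiv_lt_0_compat; lra).
  assert (Hm : 100000 <= INR m) by lra.
  assert (Hm1 := INR_ge_1_inv m ltac:(lra)).
  assert (Hmi : 0 < / INR m <= / 100000)
    by (split; [apply Rinv_0_lt_compat; lra | apply Rinv_le_contravar; lra]).
  assert (Hme : 11200 * / INR m <= eps).
  { apply Rmult_le_reg_r with (INR m); [lra|]; rewrite Rmult_assoc, Rinv_l by lra.
    replace (11200 * 1) with (eps * (11200 / eps)) by (field; lra).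
    apply Rmult_le_compat_l; lra. }
  destruct (geometric_limit (fun j => bs_weight (verb m) (start m j)) (5600 * / INR m)) as [w Hw].
  { intros j t; now apply bs_weight_increment. }
  assert (Hw1 : forall t, Rabs (w t - 1) <= 11200 * / INR m).
  { intros t; assert (H := Hw O t); unfold bs_weight in H.
    cbn [start] in H; rewrite phis_0, Cmod_1, pow1, Rinv_1 in H; simpl in H; lra. }
  assert (Hal : forall k, Cmod (verb m k) < 1) by (intros; now apply Cmod_verb_lt_1).
  assert (Hcont : forall t, continuous w t).
  { apply geometric_limit_continuous with (2 := Hw); intros; now apply bs_weight_continuous. }
  assert (HON : orthonormal_polys w (szego (verb m)))
    by now apply limit_weight_orthonormal with (K := 2 * (5600 * / INR m)).
  exists w; split; [|split; [|split; [|split; [|split]]]].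
  - split; [|exact Hcont]; intros t.
    apply Rminus_diag_uniq.
    apply geometric_bound_0 with (2 * (2 * (5600 * / INR m))); intros j.
    assert (H1 := Hw j (t + 2 * PI)); assert (H2 := Hw j t).
    unfold bs_weight in H1, H2; rewrite phis_period in H1.
    set (b := / Cmod _ ^ 2) in *.
    replace (w (t + 2 * PI) - w t) with ((w (t + 2 * PI) - b) + - (w t - b)) by ring.
    eapply Rle_trans; [apply Rabs_triang|]; rewrite Rabs_Ropp; unfold Rdiv in *; lra.
  (* The sign comes from [11200 / m < 1], not from [eps], which may be large. *)
  - intros t; generalize (Hw1 t); unfold Rabs; destruct Rcase_abs; lra.
  - now apply orthonormal_mean with m.
  - intros t; apply Rle_trans with (2 := Hme), Hw1.
  - now exists (szego (verb m)).
  - intros c Hc.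
    assert (Heq : forall n t, poly_eval (c n) n (circ t) = phi (verb m) n t)
      by (intros n t; exact (orthonormal_unique w c (szego (verb m)) n t Hcont Hc HON)).
    split.
    + intros t H; apply (phis_diverges m t Hm); revert H; apply seq_converges_ext.
      intros n; now rewrite poly_star_eval_circ, Heq, <- phis_phi.
    + exists (fun n => Cconj (szego (verb m) n O)); split; [now apply szego_tail_in_l2|].
      intros t H; apply (kernel_series_diverges m t Hm); revert H; apply seq_converges_ext.
      intros N; apply csum_ext; intros n _; now rewrite Heq.
Qed.
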